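(* Let $\rho$ be a finite, compactly supported, non-negative Borel measure on $\mathbf{R}$, let $\mathcal{H}=L_2(\mathbf{R},\rho)$, let $A$ be the multiplication operator $(Af)(\mu)=\mu f(\mu)$ on $\mathcal{H}$, let $B=(\cdot,g)g$, where $g(\mu)=1$ for $\rho$-almost every $\mu$, and let $A_\gamma=A+\gamma B$. If $\rho$ has the BTB property, then there exists $\delta>0$ such that (i) the family of operators $$U_\gamma^+=I-2\pi\mathrm{i}\gamma\, J M_{\psi_\gamma g}P_+M_{\bar g\tilde\rho}$$ depends holomorphically on $\gamma$ in the open disk $D_\delta=\{\gamma\in\mathbf{C}:|\gamma|<\delta\}$; (ii) for each fixed $\gamma\in(-\delta,\delta)$ the operator $U_\gamma^+$ is unitary on $\mathcal{H}$ and $$A_\gamma=(U_\gamma^+)^{-1}AU_\gamma^+ .$$ In other words, the pair $A,B$ has the HUE property.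
   Context: Inner products are linear in the first argument, so $(\cdot,g)g$ is the operator $f\mapsto (f,g)g$. BTB (Borel Transform Boundedness) property of $\rho$: the Borel transform $\mathrm{B}\rho(\lambda)=\int_{\mathbf{R}}\frac{\rho(dt)}{t-\lambda}$ is bounded on the open upper half-plane. It implies that $\rho$ is absolutely continuous with a density $\tilde\rho\in L_\infty(\mathbf{R})$; $\tilde\rho$ denotes this density. $P_+$ is the Riesz projection, i.e. the orthogonal projection in $L_2(\mathbf{R})$ onto the Hardy space $\mathcal{H}_+=\{f\in L_2(\mathbf{R}): \hat f(\omega)=0\text{ a.e. on }(-\infty,0)\}$, with the convention $\hat f(\omega)=\int f(x)e^{-\mathrm{i}\omega x}dx$ (up to normalization), so that $\mathcal{H}_+$ consists of boundary values of the Hardy class $H_2$ of the upper half-plane. $M_\phi$ is the operator of multiplication by a function $\phi$. $J:L_2(\mathbf{R})\to\mathcal{H}=L_2(\mathbf{R},\rho)$ is the natural bounded (embedding) map sending a function to its class in $L_2(\mathbf{R},\rho)$. The function $g$ is taken to be $1$ on $\mathbf{R}$. In the product defining $U_\gamma^+$, $M_{\bar g\tilde\rho}$ acts from $\mathcal{H}$ to $L_2(\mathbf{R})$, and $P_+$ and $M_{\psi_\gamma g}$ act in $L_2(\mathbf{R})$. The function $\psi_\gamma$ is $$\psi_\gamma(x)=\bigl(1+2\pi\mathrm{i}\gamma\,(P_+\tilde\rho)(x)\bigr)^{-1},$$ which belongs to $L_\infty(\mathbf{R})$ for small $|\gamma|$ because the BTB property gives $P_+\tilde\rho\in L_\infty(\mathbf{R})$.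 HUE (Holomorphic Unitary Equivalence) property of the pair $A,B$: there exist $\delta>0$ and a family of unitary operators $\{U_\gamma\}_{\gamma\in(-\delta,\delta)}$ such that $A_\gamma=(U_\gamma)^{-1}AU_\gamma$ for all $\gamma\in(-\delta,\delta)$, and $\gamma\mapsto U_\gamma$ admits a holomorphic continuation (as a function with values in the bounded operators) from $(-\delta,\delta)$ to $D_\delta$. *)

(* Defs.v *)
From HB Require Import structures.
From mathcomp Require Import all_boot all_order all_algebra.
From mathcomp Require Import complex.
From mathcomp Require Import all_classical all_reals all_analysis.

Set Implicit Arguments.
Unset Strict Implicit.
Unset Printing Implicit Defensive.

Import Order.TTheory GRing.Theory Num.Theory.
Import numFieldNormedType.Exports.
Import ComplexField.Normc.

Local Open Scope classical_set_scope.
Local Open Scope ring_scope.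
Local Open Scope complex_scope.
Local Open Scope charge_scope.

(* Elements of a complex L_2 space are represented by square-integrable
   functions T -> R[i], two representatives of one element being equal almost
   everywhere.  Operators act on representatives; all identities between
   elements or between operators are stated up to almost-everywhere equality. *)
Section L2.
Context d (T : measurableType d) (R : realType).
Implicit Types (mu : {measure set T -> \bar R}) (f g h : T -> R[i]).
Implicit Types S V : (T -> R[i]) -> (T -> R[i]).

Definition aeeq mu f g : Prop := {ae mu, forall x, f x = g x}.

Definition cmeasurable f : Prop :=
  measurable_fun [set: T] (fun x => complex.Re (f x)) /\
  measurable_fun [set: T] (fun x => complex.Im (f x)).

Definition cintegral mu f : R[i] :=
  Rintegral mu [set: T] (fun x => complex.Re (f x)) +i*
  Rintegral mu [set: T] (fun x => complex.Im (f x)).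

Definition Lpnorm mu (p : \bar R) f : \bar R :=
  Lnorm mu p (fun x => (normc (f x))%:E).

Definition memLp mu (p : \bar R) f : Prop :=
  cmeasurable f /\ (Lpnorm mu p f < +oo)%E.

Definition L2norm mu f : \bar R := Lpnorm mu 2%:E f.
Definition memL2 mu f : Prop := memLp mu 2%:E f.

Definition inner mu f g : R[i] := cintegral mu (fun x => f x * (g x)^*).

Definition op_eq mu S V : Prop := forall f, memL2 mu f -> aeeq mu (S f) (V f).

Definition opnorm_le mu S (M : R) : Prop :=
  forall f, memL2 mu f -> (L2norm mu (S f) <= M%:E * L2norm mu f)%E.

Definition bounded_op mu S : Prop :=
  [/\ forall f, memL2 mu f -> memL2 mu (S f),
      forall f g, memL2 mu f -> memL2 mu g -> aeeq mu f g ->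
        aeeq mu (S f) (S g),
      forall (a : R[i]) f g, memL2 mu f -> memL2 mu g ->
        aeeq mu (S (fun x => a * f x + g x)) (fun x => a * S f x + S g x) &
      exists M : R, opnorm_le mu S M].

Definition op_inverse mu S V : Prop :=
  [/\ bounded_op mu V, op_eq mu (V \o S) id & op_eq mu (S \o V) id].

Definition unitary_op mu S : Prop :=
  [/\ bounded_op mu S,
      forall f g, memL2 mu f -> memL2 mu g ->
        inner mu (S f) (S g) = inner mu f g &
      forall h, memL2 mu h -> exists2 f, memL2 mu f & aeeq mu (S f) h].

(* A' = S^-1 A S *)
Definition conjugate_by mu S (A A' : (T -> R[i]) -> (T -> R[i])) : Prop :=
  exists2 V, op_inverse mu S V & op_eq mu A' (V \o A \o S).

(* Complex differentiability in operator norm at every point of D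
   (used for open D). *)
Definition holomorphic_on mu (D : set R[i])
    (U : R[i] -> (T -> R[i]) -> (T -> R[i])) : Prop :=
  (forall z, D z -> bounded_op mu (U z)) /\
  forall z, D z -> exists2 U', bounded_op mu U' &
    forall e : R, 0 < e -> exists2 eta : R, 0 < eta &
      forall h : R[i], 0 < normc h < eta ->
        opnorm_le mu
          (fun f x => h^-1 * (U (z + h) f x - U z f x) - U' f x) e.

Definition mult (phi f : T -> R[i]) : T -> R[i] := fun x => phi x * f x.

(* (., g) g *)
Definition rank_one mu g f : T -> R[i] := fun x => inner mu f g * g x.

Definition perturb (A B : (T -> R[i]) -> (T -> R[i])) (c : R) f : T -> R[i] :=
  fun x => A f x + c%:C * B f x.

(* h represents the orthogonal projection of f onto V. *)
Definition is_orthproj mu (V : set (T -> R[i])) f h : Prop :=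
  V h /\ forall k, V k -> inner mu (fun x => f x - h x) k = 0.

Definition orthproj mu (V : set (T -> R[i])) f : T -> R[i] :=
  xget (fun=> 0) [set h | is_orthproj mu V f h].

Definition cdisk (delta : R) : set R[i] := [set z | normc z < delta].

Definition HUE mu (A B : (T -> R[i]) -> (T -> R[i])) : Prop :=
  exists2 delta : R, 0 < delta &
  exists U : R -> (T -> R[i]) -> (T -> R[i]),
    (forall c : R, `|c| < delta ->
       unitary_op mu (U c) /\ conjugate_by mu (U c) A (perturb A B c)) /\
    exists2 W : R[i] -> (T -> R[i]) -> (T -> R[i]),
      holomorphic_on mu (cdisk delta) W &
      forall c : R, `|c| < delta -> op_eq mu (W c%:C) (U c).

End L2.

Section line.
Context (R : realType).
Local Notation leb := (@lebesgue_measure R).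
Implicit Types f g h : measurableTypeR R -> R[i].
Implicit Type rho : {finite_measure set (measurableTypeR R) -> \bar R}.

(* exp(i t) *)
Definition expi (t : R) : R[i] := cos t +i* sin t.

Definition fourierL1 f (w : R) : R[i] :=
  cintegral leb (fun x => f x * expi (- (w * x))).

Definition trunc (n : nat) f : measurableTypeR R -> R[i] :=
  fun x => if `|x : R| <= n%:R then f x else 0.

(* F represents the L_2 Fourier transform of f, i.e. the L_2 limit of the
   transforms of the integrable functions f 1_[-n, n]. *)
Definition is_fourierL2 f (F : measurableTypeR R -> R[i]) : Prop :=
  memL2 leb F /\
  (fun n => L2norm leb (fun w => fourierL1 (trunc n f) w - F w)) @ \oo --> 0%E.

Definition hardy_plus : set (measurableTypeR R -> R[i]) :=
  [set f | memL2 leb f /\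
     exists2 F, is_fourierL2 f F &
       {ae leb, forall w, (w : R) < 0 -> F w = 0}].

Definition Pplus f : measurableTypeR R -> R[i] := orthproj leb hardy_plus f.

Definition compactly_supported rho : Prop :=
  exists2 K : set R, compact K & rho (~` K) = 0%E.

Definition borel_transform rho (l : R[i]) : R[i] :=
  cintegral rho (fun t => ((t : R)%:C - l)^-1).

Definition BTB rho : Prop :=
  exists M : R, forall l : R[i], 0 < complex.Im l ->
    normc (borel_transform rho l) <= M.

(* The density of rho with respect to Lebesgue measure; it is meaningful when
   rho is absolutely continuous. *)
Definition density rho : measurableTypeR R -> R[i] :=
  fun x => (fine (('d (charge_of_finite_measure rho) '/d leb) x))%:C.

Definition opA f : measurableTypeR R -> R[i] := mult (fun x => (x : R)%:C) f.

(* On representatives the natural map L_2(R) -> L_2(R, rho) is the identity. *)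
Definition J f : measurableTypeR R -> R[i] := f.

Definition twopii : R[i] := (2 * pi : R)%:C * 'i.

Definition psi_denom rho (c : R[i]) : measurableTypeR R -> R[i] :=
  fun x => 1 + twopii * c * Pplus (density rho) x.

Definition psi rho (c : R[i]) : measurableTypeR R -> R[i] :=
  fun x => (psi_denom rho c x)^-1.

Definition Uplus rho g (c : R[i]) f : measurableTypeR R -> R[i] :=
  fun x => f x - twopii * c *
    J (mult (fun y => psi rho c y * g y)
         (Pplus (mult (fun y => (g y)^* * density rho y) f))) x.

(* psi rho c is defined almost everywhere (1 / 0 = 0 in R[i]) and belongs to
   L_oo(R), so that multiplication by it acts in L_2(R). *)
Definition psi_bounded rho (c : R[i]) : Prop :=
  {ae leb, forall x, psi_denom rho c x != 0} /\ memLp leb +oo%E (psi rho c).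

End line.

(* Main.v *)
Require Import Defs.
From HB Require Import structures.
From mathcomp Require Import all_boot all_order all_algebra.
From mathcomp Require Import complex ring lra.
From mathcomp Require Import all_classical all_reals all_analysis.
From mathcomp Require Import measurable_realfun ess_sup_inf.

(** Write [w] for the density of [rho], [d = 2 pi i c], [p = P_+ w],
    [phi = 1 + d p], [psi = 1 / phi] and [Q f = P_+ (w f)].  The Hardy space is
    identified with the functions annihilated by all Cauchy kernels
    [1 / (x - a)], [Im a < 0], and [P_+] with the [L_2] limit of Cauchy
    integrals on lines approaching the real axis; the BTB bound then gives
    [w <= M / pi] and [|p| <= M / (2 pi)] almost everywhere, and [p] and [psi]
    multiply the Hardy space into itself.  Since [w = p + conj p] and
    [conj d = - d] for real [c], one has [phi - conj phi = d w], which makes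
    [V h = h + d Q (conj psi h)], the adjoint of [U f = f - d psi (Q f)], a
    two-sided inverse of [U].  Intertwining with [A] follows from
    [x (P_+ F)(x) = (P_+ (t F))(x) - (2 pi i)^-1 (int F)], and holomorphy from
    the resolvent-type identity for [psi]. *)

Set Implicit Arguments.
Unset Strict Implicit.
Unset Printing Implicit Defensive.

Import Order.TTheory GRing.Theory Num.Theory.
Import numFieldNormedType.Exports.
Import ComplexField.Normc.

Local Open Scope classical_set_scope.
Local Open Scope ring_scope.
Local Open Scope complex_scope.

Local Notation "z ^*" := (Num.conj z) : complex_scope.

(** [Pplus] is a choice among orthogonal projections, so it carries information only once a
    projection is exhibited. This is done for [decaying] functions: integrability and a first moment
    justify Fubini for the Cauchy kernel. Each [w f] with [f] in L_2(rho) is of this kind because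
    [rho] is finite and compactly supported.

    The fact behind the computations is bilinear: the product of two Hardy functions has integral
    zero, and what [P_+] removes from [F] is the conjugate of a Hardy function. A projection is
    therefore computed by exhibiting a splitting [F = h + conj k].

    BTB enters twice. The imaginary part of the Borel transform is a Poisson integral, which
    compares [rho] with Lebesgue measure on intervals and so produces the density. And the Cauchy
    integral of [w] at height [e] is the Borel transform divided by [2 pi i], which bounds [p].
    Hence [|2 pi i c p| <= 1/2] as soon as [|c| <= 1 / (2 M)], and an iteration then controls
    [1 / phi] on the Hardy space. The final radius is half of that, [1 / (4 M)], so that increments
    [c + h] stay in the admissible range. *)

Section ComplexNumbers.
Context (R : realType).
Implicit Types z w : R[i].

Lemma conjcE z : z^* = conjc z. Proof. by []. Qed.

Lemma normc_ge0 z : 0 <= normc z.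
Proof. by case: z => a b; exact: sqrtr_ge0. Qed.

Lemma sqr_normcE z : normc z ^+ 2 = complex.Re z ^+ 2 + complex.Im z ^+ 2.
Proof. by case: z => a b /=; rewrite sqr_sqrtr// addr_ge0// sqr_ge0. Qed.

Lemma normc_conj z : normc z^* = normc z.
Proof. by rewrite conjcE; case: z => a b /=; rewrite sqrrN. Qed.

Lemma normc_opp z : normc (- z) = normc z.
Proof. by case: z => a b /=; rewrite !sqrrN. Qed.

Lemma normc_add z w : normc (z + w) <= normc z + normc w.
Proof. exact: le_normcD. Qed.

Lemma normc_sub z w : normc (z - w) <= normc z + normc w.
Proof. by rewrite (le_trans (normc_add _ _))// normc_opp. Qed.

Lemma mulc_conj z : z * z^* = (normc z ^+ 2)%:C.
Proof.
by rewrite conjcE; case: z => a b /=;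
  rewrite sqr_sqrtr ?addr_ge0 ?sqr_ge0//; apply/eqP;
  rewrite eq_complex /=; apply/andP; split; apply/eqP; ring.
Qed.

Lemma normc_eq0 z : (normc z == 0) = (z == 0).
Proof. by apply/eqP/eqP => [/eq0_normc|->]//; rewrite normc0. Qed.

Lemma normc_gt0 z : (0 < normc z) = (z != 0).
Proof. by rewrite lt_def normc_ge0 andbT normc_eq0. Qed.

Lemma ler_normc_Re z : `|complex.Re z| <= normc z.
Proof.
rewrite -ler_sqr ?nnegrE ?normc_ge0// sqr_normcE real_normK ?num_real//.
by rewrite lerDl sqr_ge0.
Qed.

Lemma ler_normc_Im z : `|complex.Im z| <= normc z.
Proof.
rewrite -ler_sqr ?nnegrE ?normc_ge0// sqr_normcE real_normK ?num_real//.
by rewrite lerDr sqr_ge0.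
Qed.

Lemma Re_le_normc z : complex.Re z <= normc z.
Proof. exact: le_trans (ler_norm _) (ler_normc_Re z). Qed.

Lemma normc_real (x : R) : normc x%:C = `|x|.
Proof. by rewrite /= expr0n addr0 sqrtr_sqr. Qed.

Lemma normc_le_ReIm z : normc z <= `|complex.Re z| + `|complex.Im z|.
Proof.
rewrite -ler_sqr ?nnegrE ?normc_ge0 ?addr_ge0// sqr_normcE sqrrD.
by rewrite !real_normK ?num_real// addrAC lerDl mulrn_wge0// mulr_ge0.
Qed.

Lemma normc_distl z w : normc (z - w) = normc (w - z).
Proof. by rewrite -normc_opp opprB. Qed.

Lemma Re_conj z : complex.Re z^* = complex.Re z. Proof. by rewrite conjcE; case: z. Qed.
Lemma Im_conj z : complex.Im z^* = - complex.Im z.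
Proof. by rewrite conjcE; case: z. Qed.
Lemma ReD z w : complex.Re (z + w) = complex.Re z + complex.Re w.
Proof. by case: z w => [? ?] []. Qed.
Lemma ImD z w : complex.Im (z + w) = complex.Im z + complex.Im w.
Proof. by case: z w => [? ?] []. Qed.
Lemma ReN z : complex.Re (- z) = - complex.Re z. Proof. by case: z. Qed.
Lemma ImN z : complex.Im (- z) = - complex.Im z. Proof. by case: z. Qed.
Lemma ReM z w : complex.Re (z * w) =
  complex.Re z * complex.Re w - complex.Im z * complex.Im w.
Proof. by case: z w => [? ?] []. Qed.
Lemma ImM z w : complex.Im (z * w) =
  complex.Re z * complex.Im w + complex.Im z * complex.Re w.
Proof. by case: z w => [? ?] []. Qed.
Lemma ReV z : complex.Re z^-1 = complex.Re z / normc z ^+ 2.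
Proof. by rewrite sqr_normcE; case: z. Qed.
Lemma ImV z : complex.Im z^-1 = - complex.Im z / normc z ^+ 2.
Proof. by rewrite sqr_normcE; case: z => a b; rewrite [LHS]/= mulNr. Qed.

Lemma conjc_realc (x : R) : (x%:C)^* = x%:C.
Proof. by rewrite conjcE /= oppr0. Qed.
Lemma conjcM z w : (z * w)^* = z^* * w^*. Proof. exact: rmorphM. Qed.
Lemma conjcD z w : (z + w)^* = z^* + w^*. Proof. exact: rmorphD. Qed.
Lemma conjcB z w : (z - w)^* = z^* - w^*. Proof. exact: rmorphB. Qed.
Lemma complexP z w :
  complex.Re z = complex.Re w -> complex.Im z = complex.Im w -> z = w.
Proof. by case: z w => [? ?] [? ?] /= -> ->. Qed.

End ComplexNumbers.

(** * Measurability of complex-valued functions *)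

Section ComplexMeasurable.
Context d (T : measurableType d) (R : realType).
Implicit Types (f g : T -> R[i]) (u : T -> R).

(** On nonnegative functions the inverse is the power -1, also at 0, where both conventions give 0;
    measurability of [powR] then applies. *)
Lemma measurable_funV u : measurable_fun setT u ->
  (forall x, 0 <= u x) -> measurable_fun setT (fun x => (u x)^-1).
Proof.
move=> mu u0; have -> : (fun x => (u x)^-1) = (fun x => (u x) `^ (-1)).
  by apply/funext => x; rewrite powR_inv1.
by apply: (measurableT_comp (measurable_powR (-1))).
Qed.

Lemma cmeasurable_cst (z : R[i]) : cmeasurable (fun _ : T => z).
Proof. by split; exact: measurable_cst. Qed.

Lemma cmeasurable_real u : measurable_fun setT u ->
  cmeasurable (fun x => (u x)%:C).
Proof. by move=> mu; split => //=; exact: measurable_cst. Qed.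

Lemma cmeasurableD f g : cmeasurable f -> cmeasurable g ->
  cmeasurable (fun x => f x + g x).
Proof.
move=> [fr fi] [gr gi]; split.
- rewrite (_ : (fun _ => _) = (fun x => complex.Re (f x) + complex.Re (g x))).
    exact: measurable_funD.
  by apply/funext => x; rewrite ReD.
- rewrite (_ : (fun _ => _) = (fun x => complex.Im (f x) + complex.Im (g x))).
    exact: measurable_funD.
  by apply/funext => x; rewrite ImD.
Qed.

Lemma cmeasurableN f : cmeasurable f -> cmeasurable (fun x => - f x).
Proof.
move=> [fr fi]; split.
- rewrite (_ : (fun _ => _) = (fun x => - complex.Re (f x))).
    exact: measurable_funN.
  by apply/funext => x; rewrite ReN.
- rewrite (_ : (fun _ => _) = (fun x => - complex.Im (f x))).
    exact: measurable_funN.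
  by apply/funext => x; rewrite ImN.
Qed.

Lemma cmeasurableB f g : cmeasurable f -> cmeasurable g ->
  cmeasurable (fun x => f x - g x).
Proof. by move=> mf mg; apply: cmeasurableD => //; exact: cmeasurableN. Qed.

Lemma cmeasurable_conj f : cmeasurable f -> cmeasurable (fun x => (f x)^*).
Proof.
move=> [fr fi]; split.
- rewrite (_ : (fun _ => _) = (fun x => complex.Re (f x)))//.
  by apply/funext => x; rewrite Re_conj.
- rewrite (_ : (fun _ => _) = (fun x => - complex.Im (f x))).
    exact: measurable_funN.
  by apply/funext => x; rewrite Im_conj.
Qed.

Lemma cmeasurableM f g : cmeasurable f -> cmeasurable g ->
  cmeasurable (fun x => f x * g x).
Proof.
move=> [fr fi] [gr gi]; split.
- rewrite (_ : (fun _ => _) = (fun x => complex.Re (f x) * complex.Re (g x) -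
    complex.Im (f x) * complex.Im (g x))).
    by apply: measurable_funB; exact: measurable_funM.
  by apply/funext => x; rewrite ReM.
- rewrite (_ : (fun _ => _) = (fun x => complex.Re (f x) * complex.Im (g x) +
    complex.Im (f x) * complex.Re (g x))).
    by apply: measurable_funD; exact: measurable_funM.
  by apply/funext => x; rewrite ImM.
Qed.

Lemma measurable_sqr_normc f : cmeasurable f ->
  measurable_fun setT (fun x => normc (f x) ^+ 2).
Proof.
move=> [fr fi]; under eq_fun do rewrite sqr_normcE.
by apply: measurable_funD; exact: measurable_funX.
Qed.

Lemma measurable_normc f : cmeasurable f ->
  measurable_fun setT (fun x => normc (f x)).
Proof.
move=> mf; rewrite (_ : (fun _ => _) = (fun x => (normc (f x) ^+ 2) `^ 2^-1)).
  apply: (measurableT_comp (measurable_powR _)).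
  exact: measurable_sqr_normc.
by apply/funext => x; rewrite powR12_sqrt ?sqr_ge0// sqrtr_sqr ger0_norm// normc_ge0.
Qed.

Lemma cmeasurableV f : cmeasurable f -> cmeasurable (fun x => (f x)^-1).
Proof.
move=> mf; have mV : measurable_fun setT (fun x => (normc (f x) ^+ 2)^-1).
  by apply: measurable_funV => [|x]; [exact: measurable_sqr_normc|exact: sqr_ge0].
case: mf => fr fi; split.
- under eq_fun do rewrite ReV; exact: measurable_funM.
- under eq_fun do rewrite ImV; apply: measurable_funM => //.
  exact: measurable_funN.
Qed.

Lemma cmeasurable_indic (A : set T) : measurable A ->
  cmeasurable (fun x => (\1_A x)%:C : R[i]).
Proof. by move=> mA; apply: cmeasurable_real. Qed.

Lemma cmeasurable_eq f g : f =1 g -> cmeasurable f -> cmeasurable g.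
Proof. by move=> /funext ->. Qed.

Lemma cmeasurable_compT d' (T' : measurableType d') (h : T' -> T) f :
  measurable_fun setT h -> cmeasurable f -> cmeasurable (f \o h).
Proof.
by move=> mh [fr fi]; split; [exact: (measurableT_comp fr mh)|
  exact: (measurableT_comp fi mh)].
Qed.

End ComplexMeasurable.

(** * Integration of complex-valued functions *)

Section ComplexIntegral.
Context d (T : measurableType d) (R : realType).
Variable mu : {measure set T -> \bar R}.
Implicit Types (f g h : T -> R[i]) (u v : T -> R).

Definition cintegrable f : Prop :=
  mu.-integrable setT (EFin \o (fun x => complex.Re (f x))) /\
  mu.-integrable setT (EFin \o (fun x => complex.Im (f x))).

Lemma integrable_measurable u : mu.-integrable setT (EFin \o u) ->
  measurable_fun setT u.
Proof. by move=> /measurable_int /measurable_EFinP. Qed.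

Lemma cintegrable_cmeasurable f : cintegrable f -> cmeasurable f.
Proof. by move=> [/integrable_measurable ? /integrable_measurable ?]. Qed.

Lemma integrable_le u v : measurable_fun setT u ->
  mu.-integrable setT (EFin \o v) -> (forall x, `|u x| <= v x) ->
  mu.-integrable setT (EFin \o u).
Proof.
move=> mu' iv uv; apply: (le_integrable measurableT _ _ iv).
  exact/measurable_EFinP.
by move=> x _ /=; rewrite lee_fin (le_trans (uv x))// ler_norm.
Qed.

Lemma cintegrable_le f v : cmeasurable f ->
  mu.-integrable setT (EFin \o v) -> (forall x, normc (f x) <= v x) ->
  cintegrable f.
Proof.
move=> [fr fi] iv fv; split; apply: (integrable_le _ iv) => // x.
  exact: le_trans (ler_normc_Re _) (fv x).
exact: le_trans (ler_normc_Im _) (fv x).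
Qed.

Lemma integrable_add u v : mu.-integrable setT (EFin \o u) ->
  mu.-integrable setT (EFin \o v) ->
  mu.-integrable setT (EFin \o (fun x => u x + v x)).
Proof. by move=> iu iv; exact: (integrableD measurableT iu iv). Qed.

Lemma integrable_scale (k : R) u : mu.-integrable setT (EFin \o u) ->
  mu.-integrable setT (EFin \o (fun x => k * u x)).
Proof. by move=> iu; exact: (integrableZl measurableT k iu). Qed.

Lemma cintegrable_normc f : cintegrable f ->
  mu.-integrable setT (EFin \o (fun x => normc (f x))).
Proof.
move=> [fr fi]; have mf : cmeasurable f by apply: cintegrable_cmeasurable.
apply: (@integrable_le _ (fun x => `|complex.Re (f x)| + `|complex.Im (f x)|)).
- exact: measurable_normc.
- by apply: integrable_add; exact: integrable_norm.
- by move=> x; rewrite ger0_norm ?normc_ge0// normc_le_ReIm.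
Qed.

Lemma cintegrableD f g : cintegrable f -> cintegrable g ->
  cintegrable (fun x => f x + g x).
Proof.
move=> [fr fi] [gr gi]; split.
- by under [X in EFin \o X]eq_fun do rewrite ReD; exact: integrable_add.
- by under [X in EFin \o X]eq_fun do rewrite ImD; exact: integrable_add.
Qed.

Lemma cintegrableZ (a : R[i]) f : cintegrable f ->
  cintegrable (fun x => a * f x).
Proof.
move=> if_; apply: (@cintegrable_le _ (fun x => normc a * normc (f x))).
- apply: cmeasurableM; first exact: cmeasurable_cst.
  exact: cintegrable_cmeasurable.
- by apply: integrable_scale; exact: cintegrable_normc.
- by move=> x; rewrite normcM.
Qed.

Lemma cintegrableN f : cintegrable f -> cintegrable (fun x => - f x).
Proof. by move=> /(cintegrableZ (-1)); under eq_fun do rewrite mulN1r. Qed.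

Lemma cintegrableB f g : cintegrable f -> cintegrable g ->
  cintegrable (fun x => f x - g x).
Proof. by move=> fi gi; apply: cintegrableD => //; exact: cintegrableN. Qed.

Lemma cintegrable_conj f : cintegrable f -> cintegrable (fun x => (f x)^*).
Proof.
move=> if_; apply: (@cintegrable_le _ (fun x => normc (f x))).
- by apply: cmeasurable_conj; exact: cintegrable_cmeasurable.
- exact: cintegrable_normc.
- by move=> x; rewrite normc_conj.
Qed.

Lemma cintegrable_bounded f h (M : R) : cmeasurable h ->
  (forall x, normc (h x) <= M) -> cintegrable f ->
  cintegrable (fun x => h x * f x).
Proof.
move=> mh hM if_; apply: (@cintegrable_le _ (fun x => M * normc (f x))).
- by apply: cmeasurableM => //; exact: cintegrable_cmeasurable.
- by apply: integrable_scale; exact: cintegrable_normc.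
- by move=> x; rewrite normcM ler_wpM2r// normc_ge0.
Qed.

Lemma cintegrable_real u : mu.-integrable setT (EFin \o u) ->
  cintegrable (fun x => (u x)%:C).
Proof.
move=> iu; split => //=.
by rewrite (_ : EFin \o _ = cst 0%E)//; exact: integrable0.
Qed.

Lemma cintegral_real u : cintegral mu (fun x => (u x)%:C) = (\int[mu]_x u x)%:C.
Proof.
by rewrite /cintegral /=; congr Complex; rewrite /Rintegral integral0.
Qed.

Lemma cintegralD f g : cintegrable f -> cintegrable g ->
  cintegral mu (fun x => f x + g x) = cintegral mu f + cintegral mu g.
Proof.
move=> [fr fi] [gr gi]; apply: complexP; rewrite ?ReD ?ImD /=.
- by rewrite -RintegralD//; apply: eq_Rintegral => x _; rewrite ReD.
- by rewrite -RintegralD//; apply: eq_Rintegral => x _; rewrite ImD.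
Qed.

Lemma cintegralZ (a : R[i]) f : cintegrable f ->
  cintegral mu (fun x => a * f x) = a * cintegral mu f.
Proof.
move=> [fr fi]; apply: complexP; rewrite ?ReM ?ImM /=.
- rewrite -!RintegralZl// -RintegralB//; try exact: integrable_scale.
  by apply: eq_Rintegral => x _; rewrite ReM.
- rewrite -!RintegralZl// -RintegralD//; try exact: integrable_scale.
  by apply: eq_Rintegral => x _; rewrite ImM.
Qed.

Lemma cintegralN f : cintegrable f ->
  cintegral mu (fun x => - f x) = - cintegral mu f.
Proof.
by move=> h; rewrite -mulN1r -cintegralZ//; under [in RHS]eq_fun do rewrite mulN1r.
Qed.

Lemma cintegralB f g : cintegrable f -> cintegrable g ->
  cintegral mu (fun x => f x - g x) = cintegral mu f - cintegral mu g.
Proof.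
by move=> fi gi; rewrite cintegralD// ?cintegralN//; exact: cintegrableN.
Qed.

Lemma cintegral_conj f : cintegrable f ->
  cintegral mu (fun x => (f x)^*) = (cintegral mu f)^*.
Proof.
move=> [fr fi]; apply: complexP; rewrite ?Re_conj ?Im_conj /=.
- by apply: eq_Rintegral => x _; rewrite Re_conj.
- rewrite -mulN1r -RintegralZl//; apply: eq_Rintegral => x _.
  by rewrite Im_conj mulN1r.
Qed.

Lemma cintegral0 : cintegral mu (fun=> 0) = 0 :> R[i].
Proof. by rewrite cintegral_real /Rintegral integral0. Qed.

Lemma le_normc_cintegral f : cintegrable f ->
  normc (cintegral mu f) <= \int[mu]_x normc (f x).
Proof.
move=> if_; have in_ := cintegrable_normc if_.
set I := cintegral mu f.
have [I0|I0] := eqVneq I 0; first (rewrite I0 normc0; apply: Rintegral_ge0 => x _; exact: normc_ge0).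
(* A unimodular constant that rotates the integral onto the nonnegative real axis, so that only a
   real part has to be estimated. *)
pose a := I^* / (normc I)%:C.
have nI : normc I != 0 by rewrite normc_eq0.
have na : normc a = 1.
  by rewrite normcM normc_conj normcV normc_real ger0_norm ?normc_ge0// divff.
have aI : a * I = (normc I)%:C.
  rewrite /a mulrAC [_ * I]mulrC mulc_conj expr2 rmorphM/= -mulrA divff ?mulr1//.
  by apply: contra nI => /eqP h; apply/eqP; exact: (@complexI R (normc I) 0 h).
suff : complex.Re (a * I) <= \int[mu]_x normc (f x) by rewrite aI.
rewrite /I -cintegralZ//=.
have ia := cintegrableZ a if_.
apply: le_Rintegral => //; first by case: ia.
by move=> x _; rewrite (le_trans (Re_le_normc _))// normcM na mul1r.
Qed.

Lemma eq_cintegral f g : f =1 g -> cintegral mu f = cintegral mu g.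
Proof. by move=> /funext ->. Qed.

Lemma ae_eq_Rintegral u v : measurable_fun setT u -> measurable_fun setT v ->
  {ae mu, forall x, u x = v x} -> \int[mu]_x u x = \int[mu]_x v x.
Proof.
move=> mu' mv uv; congr fine; apply: ae_eq_integral => //.
- exact/measurable_EFinP.
- exact/measurable_EFinP.
- by apply: filterS uv => x -> _.
Qed.

Lemma ae_eq_cintegral f g : cmeasurable f -> cmeasurable g -> aeeq mu f g ->
  cintegral mu f = cintegral mu g.
Proof.
move=> [fr fi] [gr gi] fg; apply: complexP => /=.
- by apply: ae_eq_Rintegral => //; apply: filterS fg => x ->.
- by apply: ae_eq_Rintegral => //; apply: filterS fg => x ->.
Qed.

(** Replacing [u] by [min u v] changes it on a null set only and makes the inequality hold at every
    point. *)
Lemma ae_le_Rintegral u v : mu.-integrable setT (EFin \o u) ->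
  mu.-integrable setT (EFin \o v) ->
  {ae mu, forall x, u x <= v x} -> \int[mu]_x u x <= \int[mu]_x v x.
Proof.
move=> iu iv uv.
have mu' := integrable_measurable iu; have mv := integrable_measurable iv.
have im : mu.-integrable setT (EFin \o (fun x => Num.min (u x) (v x))).
  apply: (@integrable_le _ (fun x => `|u x| + `|v x|)).
  - exact: measurable_minr.
  - by apply: integrable_add; exact: integrable_norm.
  - move=> x; have [_|_] := leP (u x) (v x); first by rewrite lerDl.
    by rewrite lerDr.
rewrite (_ : \int[mu]_x u x = \int[mu]_x (Num.min (u x) (v x)))%R; last first.
  apply: ae_eq_Rintegral => //; first exact: measurable_minr.
  by apply: filterS uv => x /min_l ->.
by apply: le_Rintegral => // x _; rewrite ge_min lexx orbT.
Qed.

Lemma integrable_ae_le u v : measurable_fun setT u ->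
  mu.-integrable setT (EFin \o v) -> {ae mu, forall x, `|u x| <= v x} ->
  mu.-integrable setT (EFin \o u).
Proof.
move=> mu' iv uv; have mv := integrable_measurable iv.
apply/integrableP; split; first exact/measurable_EFinP.
have /integrableP[_] := integrable_norm iv; apply: le_lt_trans.
have mN (w : T -> R) : measurable_fun setT w ->
    measurable_fun setT (fun x => `|(w x)%:E|%E).
  by move=> mw; apply: measurableT_comp => //; exact/measurable_EFinP.
apply: ae_ge0_le_integral => //=.
- exact: mN.
- by apply: mN; exact: measurableT_comp.
- apply: filterS uv => x uv _; rewrite lee_fin normr_id.
  exact: le_trans (ler_norm _).
Qed.

Lemma dominated_cvg_Rintegral (u_ : nat -> T -> R) u v :
  (forall n, measurable_fun setT (u_ n)) -> measurable_fun setT u ->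
  mu.-integrable setT (EFin \o v) ->
  {ae mu, forall x n, `|u_ n x| <= v x} ->
  {ae mu, forall x, u_ ^~ x @ \oo --> u x} ->
  (fun n => \int[mu]_x u_ n x) @ \oo --> \int[mu]_x u x.
Proof.
move=> mu_ mu' iv uv cu.
have cu' : {ae mu, forall x, [set: T] x ->
    (fun n => (u_ n x)%:E) @ \oo --> (u x)%:E}.
  apply: filterS cu => x cx _; apply/fine_cvgP; split; last exact: cx.
  by apply: nearW.
have uv' : {ae mu, forall x n, [set: T] x ->
    (`|(u_ n x)%:E| <= (EFin \o v) x)%E}.
  by apply: filterS uv => x uvx n _ /=; rewrite lee_fin.
have [iu _ h] := dominated_convergence measurableT
  (fun n => (measurable_EFinP _ _).2 (mu_ n)) ((measurable_EFinP _ _).2 mu')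
  cu' iv uv'.
apply: fine_cvg; rewrite fineK//; exact: integrable_fin_num.
Qed.

End ComplexIntegral.

(** * Complex sequences and dominated convergence *)

Section ComplexSequences.
Context (R : realType).
Implicit Types (zs ws : nat -> R[i]) (z w : R[i]).

(** Convergence is taken componentwise, so that the real limit theorems apply to each part
    separately. *)
Definition ccvg zs z : Prop :=
  (fun n => complex.Re (zs n)) @ \oo --> complex.Re z /\
  (fun n => complex.Im (zs n)) @ \oo --> complex.Im z.

Lemma ccvg_cst z : ccvg (fun=> z) z.
Proof. by split; exact: cvg_cst. Qed.

Lemma ccvgD zs ws z w : ccvg zs z -> ccvg ws w ->
  ccvg (fun n => zs n + ws n) (z + w).
Proof.
move=> [zr zi] [wr wi]; split.
- rewrite ReD; under eq_fun do rewrite ReD; exact: cvgD.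
- rewrite ImD; under eq_fun do rewrite ImD; exact: cvgD.
Qed.

Lemma ccvgN zs z : ccvg zs z -> ccvg (fun n => - zs n) (- z).
Proof.
move=> [zr zi]; split.
- rewrite ReN; under eq_fun do rewrite ReN; exact: cvgN.
- rewrite ImN; under eq_fun do rewrite ImN; exact: cvgN.
Qed.

Lemma ccvgB zs ws z w : ccvg zs z -> ccvg ws w ->
  ccvg (fun n => zs n - ws n) (z - w).
Proof. by move=> hz hw; apply: ccvgD => //; exact: ccvgN. Qed.

Lemma ccvgM zs ws z w : ccvg zs z -> ccvg ws w ->
  ccvg (fun n => zs n * ws n) (z * w).
Proof.
move=> [zr zi] [wr wi]; split.
- by rewrite ReM; under eq_fun do rewrite ReM; apply: cvgB; exact: cvgM.
- by rewrite ImM; under eq_fun do rewrite ImM; apply: cvgD; exact: cvgM.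
Qed.

Lemma ccvg_conj zs z : ccvg zs z -> ccvg (fun n => (zs n)^*) z^*.
Proof.
move=> [zr zi]; split.
- by rewrite Re_conj; under eq_fun do rewrite Re_conj.
- rewrite Im_conj; under eq_fun do rewrite Im_conj; exact: cvgN.
Qed.

Lemma ccvg_real (u : nat -> R) (l : R) : u @ \oo --> l ->
  ccvg (fun n => (u n)%:C) l%:C.
Proof. by move=> ul; split => //=; exact: cvg_cst. Qed.

Lemma ccvg_unique zs z w : ccvg zs z -> ccvg zs w -> z = w.
Proof.
move=> [zr zi] [wr wi].
by apply: complexP; [exact: (cvg_unique _ zr wr)|exact: (cvg_unique _ zi wi)].
Qed.

Lemma ccvg_sub (s : nat -> nat) zs z : s @ \oo --> \oo -> ccvg zs z ->
  ccvg (zs \o s) z.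
Proof.
by move=> hs [zr zi]; split;
  [exact: (cvg_comp _ _ hs zr)|exact: (cvg_comp _ _ hs zi)].
Qed.

Lemma ccvg_normc zs z : ccvg zs z -> (fun n => normc (zs n)) @ \oo --> normc z.
Proof.
move=> [zr zi].
have h : (fun n => complex.Re (zs n) ^+ 2 + complex.Im (zs n) ^+ 2) @ \oo -->
    complex.Re z ^+ 2 + complex.Im z ^+ 2.
  by apply: cvgD; rewrite expr2; under eq_fun do rewrite expr2; exact: cvgM.
have := cvg_comp _ _ h (@sqrt_continuous R _).
rewrite -sqr_normcE sqrtr_sqr ger0_norm ?normc_ge0//; apply: cvg_trans.
apply: near_eq_cvg; apply: nearW => n /=.
by rewrite -sqr_normcE sqrtr_sqr ger0_norm ?normc_ge0.
Qed.

Lemma squeeze0_cvg (u v : nat -> R) : (forall n, `|u n| <= v n) ->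
  v @ \oo --> (0 : R) -> u @ \oo --> (0 : R).
Proof.
move=> uv v0; have /norm_cvg0 : (fun n => `|u n|) @ \oo --> (0 : R).
  apply: (@squeeze_cvgr _ _ _ _ (fun=> 0) v) => //; last exact: cvg_cst.
  by apply: nearW => n; rewrite uv normr_ge0.
by [].
Qed.

Lemma ccvg_le zs z (v : nat -> R) : (forall n, normc (zs n - z) <= v n) ->
  v @ \oo --> (0 : R) -> ccvg zs z.
Proof.
move=> zv v0; split; apply/subr_cvg0; apply: (squeeze0_cvg _ v0) => n.
- by rewrite (le_trans _ (zv n))// (le_trans _ (ler_normc_Re _))// ReD ReN.
- by rewrite (le_trans _ (zv n))// (le_trans _ (ler_normc_Im _))// ImD ImN.
Qed.

Lemma ccvg_normc_le zs z (M : R) : ccvg zs z -> (forall n, normc (zs n) <= M) ->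
  normc z <= M.
Proof.
move=> /ccvg_normc h hM; rewrite -(cvg_lim _ h)//.
by apply: limr_le; [by apply/cvg_ex; eexists; exact: h|exact: nearW].
Qed.

End ComplexSequences.

Section ComplexDominatedConvergence.
Context d (T : measurableType d) (R : realType).
Variable mu : {measure set T -> \bar R}.

Lemma dominated_ccvg (f_ : nat -> T -> R[i]) (f : T -> R[i]) (v : T -> R) :
  (forall n, cmeasurable (f_ n)) -> cmeasurable f ->
  mu.-integrable setT (EFin \o v) ->
  {ae mu, forall x n, normc (f_ n x) <= v x} ->
  {ae mu, forall x, ccvg (f_ ^~ x) (f x)} ->
  ccvg (fun n => cintegral mu (f_ n)) (cintegral mu f).
Proof.
move=> mf_ [mfr mfi] iv fv cf; split => /=.
- apply: (dominated_cvg_Rintegral (v := v)) => //.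
  + by move=> n; case: (mf_ n).
  + by apply: filterS fv => x fvx n; exact: le_trans (ler_normc_Re _) (fvx n).
  + by apply: filterS cf => x [].
- apply: (dominated_cvg_Rintegral (v := v)) => //.
  + by move=> n; case: (mf_ n).
  + by apply: filterS fv => x fvx n; exact: le_trans (ler_normc_Im _) (fvx n).
  + by apply: filterS cf => x [].
Qed.

Lemma cmeasurable_ccvg (f_ : nat -> T -> R[i]) (f : T -> R[i]) :
  (forall n, cmeasurable (f_ n)) -> (forall x, ccvg (f_ ^~ x) (f x)) ->
  cmeasurable f.
Proof.
move=> mf_ cf; split.
- apply: (@measurable_fun_cvg _ _ _ _ (fun n x => complex.Re (f_ n x))) => //.
  + by move=> n; case: (mf_ n).
  + by move=> x _; case: (cf x).
- apply: (@measurable_fun_cvg _ _ _ _ (fun n x => complex.Im (f_ n x))) => //.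
  + by move=> n; case: (mf_ n).
  + by move=> x _; case: (cf x).
Qed.

End ComplexDominatedConvergence.

(** * Fubini for complex integrands *)

Section ComplexFubini.
Context d1 d2 (T1 : measurableType d1) (T2 : measurableType d2) (R : realType).
Variable m1 : {sigma_finite_measure set T1 -> \bar R}.
Variable m2 : {sigma_finite_measure set T2 -> \bar R}.
Variables (f : T1 * T2 -> R[i]) (a : T1 -> R) (b : T2 -> R).
Hypothesis mf : cmeasurable f.
Hypothesis ia : m1.-integrable setT (EFin \o a).
Hypothesis ib : m2.-integrable setT (EFin \o b).
(** Domination by a product makes every section integrable, not just almost every one, so the inner
    integrals are genuine finite values at all points. *)
Hypothesis fab : forall x y, normc (f (x, y)) <= a x * b y.

Let dominated_prod (g : T1 * T2 -> R) : measurable_fun setT g ->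
  (forall x y, `|g (x, y)| <= a x * b y) ->
  (m1 \x m2)%E.-integrable setT (EFin \o g).
Proof.
move=> mg gab; have mg' : measurable_fun setT (EFin \o g) by exact/measurable_EFinP.
have maa : measurable_fun setT (fun x => `|(a x)%:E|%E).
  by apply: measurableT_comp => //; exact: measurable_int ia.
have mbb : measurable_fun setT (fun x => `|(b x)%:E|%E).
  by apply: measurableT_comp => //; exact: measurable_int ib.
have mag : measurable_fun setT (abse \o (EFin \o g)) by exact: measurableT_comp.
apply/integrable12ltyP => //.
apply: (@le_lt_trans _ _ (\int[m1]_x (`|(a x)%:E| * \int[m2]_y `|(b y)%:E|))%E).
  apply: ge0_le_integral => //.
  - by move=> x _; exact: integral_ge0.
  - exact: (measurable_fun_fubini_tonelli_F (m2 := m2)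
      (abse \o (EFin \o g)) mag (fun=> abse_ge0 _)).
  - by apply: emeasurable_funM => //; exact: measurable_cst.
  - move=> x _; rewrite -ge0_integralZl//=.
    apply: ge0_le_integral => //=.
    + exact: (measurableT_comp mag (pair1_measurable x)).
    + exact: measurable_funeM.
    + move=> y _; rewrite -EFinM lee_fin (le_trans (gab x y))//.
      by rewrite -normrM ler_norm.
rewrite ge0_integralZr//; last exact: integral_ge0.
have /integrableP[_ ia'] := ia; have /integrableP[_ ib'] := ib.
by rewrite lte_mul_pinfty// ?integral_ge0// ge0_fin_numE// integral_ge0.
Qed.

Let fubini_real (g : T1 * T2 -> R) : measurable_fun setT g ->
  (forall x y, `|g (x, y)| <= a x * b y) ->
  [/\ m1.-integrable setT (EFin \o (fun x => \int[m2]_y g (x, y))),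
      m2.-integrable setT (EFin \o (fun y => \int[m1]_x g (x, y))) &
      \int[m1]_x \int[m2]_y g (x, y) = \int[m2]_y \int[m1]_x g (x, y)].
Proof.
move=> mg gab; have ig := dominated_prod mg gab.
have s1 x : (\int[m2]_y (g (x, y))%:E)%E = (\int[m2]_y g (x, y))%:E.
  rewrite /Rintegral fineK//; apply: integrable_fin_num => //.
  apply: (integrable_le (v := fun y => a x * b y)) => //.
    exact: (measurableT_comp mg (pair1_measurable x)).
  exact: integrable_scale.
have s2 y : (\int[m1]_x (g (x, y))%:E)%E = (\int[m1]_x g (x, y))%:E.
  rewrite /Rintegral fineK//; apply: integrable_fin_num => //.
  apply: (integrable_le (v := fun x => b y * a x)) => //.
  - exact: (measurableT_comp mg (pair2_measurable y)).
  - exact: integrable_scale.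
  - by move=> x; rewrite mulrC.
split.
- by have := integrable_fubini_F ig; apply: eq_integrable => // x _; exact: s1.
- apply: (@integrable_le _ _ _ _ _ (fun y => (\int[m1]_x a x) * b y)).
  + apply/measurable_EFinP; have := measurable_fubini_G ig.
    by apply: eq_measurable_fun => y _; exact: s2.
  + exact: integrable_scale.
  + move=> y; have ig' : m1.-integrable setT (EFin \o (fun x => g (x, y))).
      apply: (integrable_le (v := fun x => b y * a x)) => //.
      * exact: (measurableT_comp mg (pair2_measurable y)).
      * exact: integrable_scale.
      * by move=> x; rewrite mulrC.
    apply: (le_trans (le_normr_Rintegral measurableT ig')).
    rewrite mulrC -RintegralZl//; apply: le_Rintegral => //.
    * exact: integrable_norm.
    * exact: integrable_scale.
    * by move=> x _; rewrite mulrC.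
- have := Fubini ig => /= h; rewrite [LHS]/Rintegral [RHS]/Rintegral.
  congr fine; under eq_integral do rewrite -s1.
  by rewrite h; apply: eq_integral => y _; rewrite s2.
Qed.

Let fRe := fubini_real (proj1 mf)
  (fun x y => le_trans (ler_normc_Re (f (x, y))) (fab x y)).
Let fIm := fubini_real (proj2 mf)
  (fun x y => le_trans (ler_normc_Im (f (x, y))) (fab x y)).

Lemma cintegrable_fubini1 : cintegrable m1 (fun x => cintegral m2 (fun y => f (x, y))).
Proof. by have [? _ _] := fRe; have [? _ _] := fIm; split. Qed.

Lemma cintegrable_fubini2 : cintegrable m2 (fun y => cintegral m1 (fun x => f (x, y))).
Proof. by have [_ ? _] := fRe; have [_ ? _] := fIm; split. Qed.

Lemma cfubini : cintegral m1 (fun x => cintegral m2 (fun y => f (x, y))) =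
  cintegral m2 (fun y => cintegral m1 (fun x => f (x, y))).
Proof. by have [_ _ ?] := fRe; have [_ _ ?] := fIm; apply: complexP. Qed.

End ComplexFubini.

(** * Square-integrable functions and Cauchy-Schwarz *)

Section SquareIntegrable.
Context d (T : measurableType d) (R : realType).
Variable mu : {measure set T -> \bar R}.
Implicit Types (f g h : T -> R[i]).

(** A form of [memL2] (see [memL2P]) in which the squared norm is an ordinary real integral, free of
    extended reals and square roots. *)
Definition sqi f : Prop := cmeasurable f /\
  mu.-integrable setT (EFin \o (fun x => normc (f x) ^+ 2)).

Definition nrm2 f : R := \int[mu]_x (normc (f x) ^+ 2).

Lemma nrm2_ge0 f : 0 <= nrm2 f.
Proof. by apply: Rintegral_ge0 => x _; exact: sqr_ge0. Qed.

Lemma sqi_le f (v : T -> R) : cmeasurable f ->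
  mu.-integrable setT (EFin \o v) -> {ae mu, forall x, normc (f x) ^+ 2 <= v x} ->
  sqi f.
Proof.
move=> mf iv fv; split=> //; apply: (integrable_ae_le _ iv).
  exact: measurable_sqr_normc.
by apply: filterS fv => x; rewrite ger0_norm// sqr_ge0.
Qed.

Lemma sqi_conj f : sqi f -> sqi (fun x => (f x)^*).
Proof.
move=> [mf if_]; split; first exact: cmeasurable_conj.
by apply: eq_integrable if_ => // x _ /=; rewrite normc_conj.
Qed.

Lemma nrm2_conj f : nrm2 (fun x => (f x)^*) = nrm2 f.
Proof. by apply: eq_Rintegral => x _; rewrite normc_conj. Qed.

Lemma nrm2_distl f g : nrm2 (fun x => f x - g x) = nrm2 (fun x => g x - f x).
Proof. by apply: eq_Rintegral => x _; rewrite normc_distl. Qed.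

Lemma normcD_sqr (z w : R[i]) :
  normc (z + w) ^+ 2 <= 2 * normc z ^+ 2 + 2 * normc w ^+ 2.
Proof.
have h := normc_add z w; have z0 := normc_ge0 z; have w0 := normc_ge0 w.
have zw0 := normc_ge0 (z + w).
apply: (@le_trans _ _ ((normc z + normc w) ^+ 2)).
  by rewrite ler_sqr ?nnegrE ?addr_ge0.
rewrite -subr_ge0 (_ : _ - _ = (normc z - normc w) ^+ 2) ?sqr_ge0//; ring.
Qed.

Lemma sqiD f g : sqi f -> sqi g -> sqi (fun x => f x + g x).
Proof.
move=> [mf if_] [mg ig].
apply: (sqi_le (v := fun x => 2 * normc (f x) ^+ 2 + 2 * normc (g x) ^+ 2)).
- exact: cmeasurableD.
- by apply: integrable_add; exact: integrable_scale.
- by apply: aeW => x; exact: normcD_sqr.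
Qed.

Lemma nrm2D f g : sqi f -> sqi g ->
  nrm2 (fun x => f x + g x) <= 2 * nrm2 f + 2 * nrm2 g.
Proof.
move=> hf hg; have [_ ifg] := sqiD hf hg; case: hf hg => [mf if_] [mg ig].
rewrite /nrm2 -!RintegralZl// -RintegralD//; last 2 first.
- exact: integrable_scale.
- exact: integrable_scale.
apply: le_Rintegral => //.
- by apply: integrable_add; exact: integrable_scale.
- by move=> x _; exact: normcD_sqr.
Qed.

Lemma sqi_ae_bounded f h (M : R) : cmeasurable h ->
  {ae mu, forall x, normc (h x) <= M} -> sqi f -> sqi (fun x => h x * f x).
Proof.
move=> mh hM [mf if_]; apply: (sqi_le (v := fun x => M ^+ 2 * normc (f x) ^+ 2)).
- exact: cmeasurableM.
- exact: integrable_scale.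
- apply: filterS hM => x hx; rewrite normcM exprMn ler_wpM2r ?sqr_ge0//.
  by rewrite ler_sqr ?nnegrE ?normc_ge0// (le_trans _ hx)// normc_ge0.
Qed.

Lemma nrm2_ae_bounded f h (M : R) : cmeasurable h ->
  {ae mu, forall x, normc (h x) <= M} -> sqi f ->
  nrm2 (fun x => h x * f x) <= M ^+ 2 * nrm2 f.
Proof.
move=> mh hM hf; have [_ ihf] := sqi_ae_bounded mh hM hf; case: hf => mf if_.
rewrite /nrm2 -RintegralZl//; apply: ae_le_Rintegral => //.
  exact: integrable_scale.
apply: filterS hM => x hx; rewrite normcM exprMn ler_wpM2r ?sqr_ge0//.
by rewrite ler_sqr ?nnegrE ?normc_ge0// (le_trans _ hx)// normc_ge0.
Qed.

Lemma sqiZ (a : R[i]) f : sqi f -> sqi (fun x => a * f x).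
Proof.
by apply: (sqi_ae_bounded (M := normc a)); [exact: cmeasurable_cst|exact: aeW].
Qed.

Lemma nrm2Z (a : R[i]) f : sqi f ->
  nrm2 (fun x => a * f x) = normc a ^+ 2 * nrm2 f.
Proof.
move=> [_ if_]; rewrite /nrm2 -RintegralZl//; apply: eq_Rintegral => x _.
by rewrite normcM exprMn.
Qed.

Lemma sqiN f : sqi f -> sqi (fun x => - f x).
Proof. by move=> /(sqiZ (-1)); under eq_fun do rewrite mulN1r. Qed.

Lemma sqiB f g : sqi f -> sqi g -> sqi (fun x => f x - g x).
Proof. by move=> hf hg; apply: sqiD => //; exact: sqiN. Qed.

Lemma sqi_ae_eq f g : cmeasurable g -> aeeq mu f g -> sqi f -> sqi g.
Proof.
move=> mg fg [mf if_]; apply: (sqi_le mg if_).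
by apply: filterS fg => x ->.
Qed.

Lemma nrm2_ae_eq f g : cmeasurable f -> cmeasurable g -> aeeq mu f g ->
  nrm2 f = nrm2 g.
Proof.
move=> mf mg fg; apply: ae_eq_Rintegral; [exact: measurable_sqr_normc..|].
by apply: filterS fg => x ->.
Qed.

Lemma nrm2_eq0 f : sqi f -> nrm2 f = 0 -> aeeq mu f (fun=> 0).
Proof.
move=> [mf if_] f0; have mn := measurable_sqr_normc mf.
have : (\int[mu]_x `|(normc (f x) ^+ 2)%:E| = 0)%E.
  rewrite -[RHS]/(0%R%:E) -f0 /nrm2 /Rintegral fineK.
    by apply: eq_integral => x _; rewrite gee0_abs// lee_fin sqr_ge0.
  exact: integrable_fin_num.
have /(ae_eq_integral_abs mu measurableT)[h _] : measurable_fun setT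
    (EFin \o (fun x => normc (f x) ^+ 2)) by exact/measurable_EFinP.
move=> /h {h}.
apply: filterS => x /(_ I) /= [/eqP].
by rewrite sqrf_eq0 normc_eq0 => /eqP.
Qed.

Lemma cintegrableM f g : sqi f -> sqi g -> cintegrable mu (fun x => f x * g x).
Proof.
move=> [mf if_] [mg ig].
apply: (cintegrable_le (v := fun x => normc (f x) ^+ 2 + normc (g x) ^+ 2)).
- exact: cmeasurableM.
- exact: integrable_add.
- move=> x; rewrite normcM.
  have : 0 <= (normc (f x) - normc (g x)) ^+ 2 by exact: sqr_ge0.
  have := normc_ge0 (f x); have := normc_ge0 (g x); nra.
Qed.

(** The discriminant argument. For [b > 0] the choice [s = b], [t = k] gives
    [b (a b - k^2) >= 0]. *)
Lemma quadratic_ge0_le (a b k : R) : 0 <= a -> 0 <= b -> 0 <= k ->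
  (forall s t, 0 <= s ^+ 2 * a - 2 * (s * t * k) + t ^+ 2 * b) ->
  k ^+ 2 <= a * b.
Proof.
move=> a0 b0 k0 h; have [b00|bn0] := eqVneq b 0.
  (* In the degenerate case [k] must vanish; dividing by [a + 1] instead of [a] also covers
     [a = 0]. *)
  have := h (k / (a + 1)) 1; rewrite b00 !mulr0 addr0 => {}h.
  have a1 : 0 < a + 1 by lra.
  have {h} : 0 <= (k / (a + 1)) ^+ 2 * (a + 1) - 2 * (k / (a + 1) * 1 * k).
    by apply: le_trans h _; rewrite lerB// ler_wpM2l ?sqr_ge0//; lra.
  rewrite (_ : _ - _ = - (k ^+ 2 / (a + 1))); last by field; lra.
  rewrite oppr_ge0 => h; have := divr_ge0 (sqr_ge0 k) (ltW a1) => h'.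
  have /eqP : k ^+ 2 / (a + 1) = 0 by apply/eqP; rewrite eq_le h h'.
  by rewrite mulf_eq0 invr_eq0 (gt_eqF a1) orbF => /eqP ->.
have bp : 0 < b by rewrite lt_def bn0.
have := h b k; rewrite (_ : _ + _ = b * (a * b - k ^+ 2)); last by ring.
by rewrite pmulr_rge0// subr_ge0.
Qed.

(** Stated for the bilinear pairing, without conjugation, since Hardy functions are tested
    bilinearly against Cauchy kernels. The quadratic form is the integral of [(s |f| - t |g|)^2]. *)
Lemma cauchy_schwarz f g : sqi f -> sqi g ->
  normc (cintegral mu (fun x => f x * g x)) ^+ 2 <= nrm2 f * nrm2 g.
Proof.
move=> hf hg; have ifg := cintegrableM hf hg.
have infg := cintegrable_normc ifg.
set k := \int[mu]_x normc (f x * g x).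
have k0 : 0 <= k by apply: Rintegral_ge0 => x _; exact: normc_ge0.
apply: (@le_trans _ _ (k ^+ 2)).
  by rewrite ler_sqr ?nnegrE ?normc_ge0// le_normc_cintegral.
apply: quadratic_ge0_le => //; [exact: nrm2_ge0..|move=> s t].
case: hf hg => mf if_ [mg ig].
rewrite /nrm2 /k -mulrA [2 * (s * _)]mulrA [2 * s * (t * _)]mulrA.
rewrite -!RintegralZl// -RintegralB//; [|exact: integrable_scale..].
rewrite -RintegralD//; last 2 first.
- under [X in EFin \o X]eq_fun do rewrite -mulNr.
  by apply: integrable_add; exact: integrable_scale.
- exact: integrable_scale.
apply: Rintegral_ge0 => x _; rewrite normcM.
rewrite (_ : _ + _ = (s * normc (f x) - t * normc (g x)) ^+ 2) ?sqr_ge0//; ring.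
Qed.

Lemma memL2P f : memL2 mu f <-> sqi f.
Proof.
have E : cmeasurable f -> (Lpnorm mu 2%:E f < +oo)%E <->
    (\int[mu]_x (normc (f x) ^+ 2)%:E < +oo)%E.
  move=> mf.
  have <- : ((Lpnorm mu 2%:E f) `^ 2)%E = (\int[mu]_x (normc (f x) ^+ 2)%:E)%E.
    rewrite /Lpnorm powR_Lnorm ?pnatr_eq0//; apply: eq_integral => x _.
    by rewrite gee0_abs ?lee_fin ?normc_ge0// poweR_EFin powR_mulrn ?normc_ge0.
  by split; [exact: poweR_lty|apply: lty_poweRy; rewrite pnatr_eq0].
split=> [[mf /(E mf) h]|[mf /integrableP[_ h]]]; split=> //.
- apply/integrableP; split; first by apply/measurable_EFinP; exact: measurable_sqr_normc.
  by under eq_integral do rewrite gee0_abs ?lee_fin ?sqr_ge0//.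
- apply/(E mf); apply: le_lt_trans h; apply: ge0_le_integral => //=.
  + by move=> x _; rewrite lee_fin sqr_ge0.
  + by apply/measurable_EFinP; exact: measurable_sqr_normc.
  + apply/measurable_EFinP; apply: measurableT_comp => //.
    exact: measurable_sqr_normc.
  + by move=> x _; rewrite lee_fin ler_norm.
Qed.

Lemma L2normE f : sqi f -> L2norm mu f = (Num.sqrt (nrm2 f))%:E.
Proof.
move=> [mf if_].
have h : ((L2norm mu f) `^ 2)%E = (nrm2 f)%:E.
  rewrite /L2norm /Lpnorm powR_Lnorm ?pnatr_eq0// /nrm2 /Rintegral fineK.
    apply: eq_integral => x _.
    by rewrite gee0_abs ?lee_fin ?normc_ge0// poweR_EFin powR_mulrn ?normc_ge0.
  exact: integrable_fin_num.
have := Lnorm_ge0 mu 2%:E (fun x => (normc (f x))%:E).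
rewrite -/(Lpnorm mu 2%:E f) -/(L2norm mu f).
case: (L2norm mu f) h => [r| |]//; last by rewrite poweRyr ?pnatr_eq0.
rewrite poweR_EFin => -[<-]; rewrite lee_fin => r0.
by rewrite powR_mulrn// sqrtr_sqr ger0_norm.
Qed.

Lemma opnorm_le_nrm2 (S : (T -> R[i]) -> T -> R[i]) (M : R) : 0 <= M ->
  (forall f, sqi f -> sqi (S f)) ->
  (forall f, sqi f -> nrm2 (S f) <= M ^+ 2 * nrm2 f) -> opnorm_le mu S M.
Proof.
move=> M0 hS h f /memL2P hf; rewrite !L2normE//; last exact: hS.
rewrite -EFinM lee_fin -[M in leRHS]ger0_norm// -sqrtr_sqr -sqrtrM ?sqr_ge0//.
by rewrite ler_wsqrtr// h.
Qed.

Definition l2cvg (fs : nat -> T -> R[i]) f : Prop :=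
  (fun n => nrm2 (fun x => fs n x - f x)) @ \oo --> (0 : R).

Lemma l2cvg_cintegralM (fs : nat -> T -> R[i]) f g :
  (forall n, sqi (fs n)) -> sqi f -> sqi g -> l2cvg fs f ->
  ccvg (fun n => cintegral mu (fun x => fs n x * g x))
       (cintegral mu (fun x => f x * g x)).
Proof.
move=> hfs hf hg c.
apply: (ccvg_le (v := fun n => Num.sqrt (nrm2 (fun x => fs n x - f x) * nrm2 g))).
  move=> n; have ha := cintegrableM (hfs n) hg; have hb := cintegrableM hf hg.
  rewrite -cintegralB//.
  under [X in cintegral _ X]eq_fun do rewrite -mulrBl.
  rewrite -[leLHS]ger0_norm ?normc_ge0// -sqrtr_sqr ler_wsqrtr//.
  by apply: cauchy_schwarz => //; exact: sqiB.
rewrite -[X in _ --> X](@sqrtr0 R).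
have c' : (fun n => nrm2 (fun x => fs n x - f x) * nrm2 g) @ \oo --> (0 : R).
  by rewrite -(mul0r (nrm2 g)); apply: cvgM; [exact: c|exact: cvg_cst].
exact: (cvg_comp _ _ c' (@sqrt_continuous R _)).
Qed.

Lemma l2cvg_L2norm (fs : nat -> T -> R[i]) f :
  (forall n, sqi (fs n)) -> sqi f ->
  l2cvg fs f <-> (fun n => L2norm mu (fun x => fs n x - f x)) @ \oo --> 0%E.
Proof.
move=> hfs hf.
have E n : L2norm mu (fun x => fs n x - f x) =
    (Num.sqrt (nrm2 (fun x => fs n x - f x)))%:E by apply: L2normE; exact: sqiB.
split=> [c|].
  under eq_fun do rewrite E; apply/fine_cvgP; split; first exact: nearW.
  rewrite -[X in _ --> X](@sqrtr0 R).
  exact: (cvg_comp _ _ c (@sqrt_continuous R _)).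
under eq_fun do rewrite E; move=> /fine_cvgP[_] c.
have c' : (fun n => Num.sqrt (nrm2 (fun x => fs n x - f x))) @ \oo --> (0 : R).
  exact: c.
rewrite /l2cvg (_ : (fun n => _) = (fun n =>
  Num.sqrt (nrm2 (fun x => fs n x - f x)) * Num.sqrt (nrm2 (fun x => fs n x - f x)))).
  by rewrite -(mulr0 (0 : R)); apply: cvgM; exact: c'.
by apply/funext => n; rewrite -expr2 sqr_sqrtr// nrm2_ge0.
Qed.

Lemma l2cvg_unique (fs : nat -> T -> R[i]) f g :
  (forall n, sqi (fs n)) -> sqi f -> sqi g ->
  l2cvg fs f -> l2cvg fs g -> aeeq mu f g.
Proof.
move=> hfs hf hg cf cg.
have hfg := sqiB hf hg.
suff : nrm2 (fun x => f x - g x) = 0.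
  by move=> /(nrm2_eq0 hfg); apply: filterS => x /eqP; rewrite subr_eq0 => /eqP.
apply/eqP; rewrite eq_le nrm2_ge0 andbT.
have h n : nrm2 (fun x => f x - g x) <=
    2 * nrm2 (fun x => fs n x - f x) + 2 * nrm2 (fun x => fs n x - g x).
  rewrite [nrm2 (fun x => fs n x - f x)]nrm2_distl.
  apply: le_trans (nrm2D (sqiB hf (hfs n)) (sqiB (hfs n) hg)).
  by rewrite le_eqVlt; apply/orP; left; apply/eqP; congr nrm2;
    apply/funext => x; ring.
have c : (fun n => 2 * nrm2 (fun x => fs n x - f x) + 2 * nrm2 (fun x => fs n x - g x))
    @ \oo --> (0 : R).
  rewrite -[X in _ --> X](addr0 0) -{1}(mulr0 2) -[X in _ + X](mulr0 2).
  by apply: cvgD; apply: cvgM; by [exact: cf|exact: cg|exact: cvg_cst].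
rewrite -(cvg_lim _ c)//; apply: limr_ge; last exact: nearW.
by apply/cvg_ex; eexists; exact: c.
Qed.

End SquareIntegrable.

(** * Completeness of L_2 *)

Section RieszFischer.
Context d (T : measurableType d) (R : realType).
Variable mu : {measure set T -> \bar R}.
Implicit Types (f g h : T -> R[i]).

(** Lower semicontinuity of the norm under almost-everywhere convergence. It yields both the
    completeness of L_2 and the passage to the limit in Bessel's inequality. *)
Lemma fatou_sqi (gs : nat -> T -> R[i]) g (B : R) :
  (forall n, sqi mu (gs n)) -> cmeasurable g ->
  {ae mu, forall x, ccvg (gs ^~ x) (g x)} ->
  (forall n, nrm2 mu (gs n) <= B) -> sqi mu g /\ nrm2 mu g <= B.
Proof.
move=> hgs mg cg hB.
have mn n : measurable_fun setT (fun x => (normc (gs n x) ^+ 2)%:E).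
  by apply/measurable_EFinP; case: (hgs n) => /measurable_sqr_normc.
have mgn := measurable_sqr_normc mg.
have nE n : (\int[mu]_x (normc (gs n x) ^+ 2)%:E = (nrm2 mu (gs n))%:E)%E.
  by rewrite /nrm2 /Rintegral fineK//; apply: integrable_fin_num => //; case: (hgs n).
have le_B : (\int[mu]_x (normc (g x) ^+ 2)%:E <= B%:E)%E.
  have F := fatou mu measurableT mn (fun n x _ => sqr_ge0 _ : (0 <= (_)%:E)%E).
  have -> : (\int[mu]_x (normc (g x) ^+ 2)%:E =
      \int[mu]_x limn_einf (fun n => (normc (gs n x) ^+ 2)%:E))%E.
    apply: ae_eq_integral => //.
    - exact/measurable_EFinP.
    - rewrite /limn_einf; apply: measurableT_comp => //.
      apply: measurable_fun_limn_esup => n.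
      exact: (measurableT_comp (@oppe_measurable _ _) (mn n)).
    - apply: filterS cg => x cx _.
      have c : (fun n => (normc (gs n x) ^+ 2)%:E) @ \oo --> (normc (g x) ^+ 2)%:E.
        apply/fine_cvgP; split; first exact: nearW.
        by have h := ccvg_normc cx; rewrite expr2; under eq_fun do rewrite /= expr2;
          exact: cvgM.
      by rewrite (cvg_limn_einf_sup c).1.
  apply: le_trans F _; rewrite limn_einf_lim; apply: lime_le; first exact: is_cvg_einfs.
  apply: nearW => n; apply: (@le_trans _ _ (\int[mu]_x (normc (gs n x) ^+ 2)%:E)%E).
    by apply: ereal_inf_lbound; exists n => //=.
  by rewrite nE lee_fin.
have ig : mu.-integrable setT (EFin \o (fun x => normc (g x) ^+ 2)).
  apply/integrableP; split; first exact/measurable_EFinP.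
  under eq_integral do rewrite gee0_abs ?lee_fin ?sqr_ge0//.
  exact: le_lt_trans le_B (ltry _).
split=> //; rewrite -lee_fin /nrm2 /Rintegral fineK//.
exact: integrable_fin_num.
Qed.

Lemma cvg_geometric_increments (u : nat -> R) (C : R) :
  (forall k, `|u k.+1 - u k| <= C * 2^-1 ^+ k) -> cvgn u.
Proof.
move=> hu.
have C0 : 0 <= C by rewrite -(mulr1 C); apply: le_trans (hu 0%N).
have h : cvgn (series (telescope u)).
  apply: normed_cvg; apply: (@series_le_cvg _ _ (geometric C 2^-1)).
  - by move=> n /=.
  - by move=> n /=; rewrite mulr_ge0// exprn_ge0// invr_ge0.
  - by move=> n /=; exact: hu.
  - by apply: is_cvg_geometric_series; rewrite ger0_norm ?invr_ge0// invf_lt1// ltr1n.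
have -> : u = (fun n => u 0%N + series (telescope u) n).
  by apply/funext => n; rewrite -eq_sum_telescope.
by apply: is_cvgD => //; exact: is_cvg_cst.
Qed.

Definition l2cauchy (fs : nat -> T -> R[i]) : Prop :=
  forall e : R, 0 < e -> exists N : nat, forall m n, (N <= m)%N -> (N <= n)%N ->
    nrm2 mu (fun x => fs m x - fs n x) <= e.

(** The almost-everywhere convergent subsequence is part of the conclusion because pointwise bounds
    and identities for boundary values are later read off along it. *)
Lemma riesz_fischer (fs : nat -> T -> R[i]) :
  (forall n, sqi mu (fs n)) -> l2cauchy fs ->
  exists f, exists s : nat -> nat, [/\ sqi mu f, l2cvg mu fs f, s @ \oo --> \oo &
    {ae mu, forall x, ccvg (fun k => fs (s k) x) (f x)}].
Proof.
move=> hfs cau.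
(* With squared increments below [8^-k], the weights [4^k] in [G] still leave a summable [2^-k],
   while finiteness of [G x] forces increments of order [2^-k] at [x]. *)
have e8 k : 0 < (8^-1 : R) ^+ k by rewrite exprn_gt0// invr_gt0.
have [N HN] := choice (fun k => cau _ (e8 k)).
(* The sum makes [s] nondecreasing and at least [N k]; the summand [k] makes it tend to infinity. *)
pose s k := (k + \sum_(j < k.+1) N j)%N.
have sN k : (N k <= s k)%N by rewrite /s big_ord_recr /= addnA leq_addl.
have sS k : (s k <= s k.+1)%N by rewrite /s [X in (_ <= _ + X)%N]big_ord_recr /= leq_add ?leq_addr.
have sk k : (k <= s k)%N by rewrite /s leq_addr.
have smono k l : (k <= l)%N -> (s k <= s l)%N.
  by move=> /subnK <-; elim: (l - k)%N => // i; rewrite addSn => /leq_trans; apply.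
have soo : s @ \oo --> \oo.
  move=> P [M _ HM]; exists M => // n /= Mn; apply: HM => /=.
  exact: leq_trans Mn (sk n).
pose D k x := fs (s k.+1) x - fs (s k) x.
have hD k : sqi mu (D k) by apply: sqiB.
have nD k : nrm2 mu (D k) <= 8^-1 ^+ k.
  by apply: HN; rewrite ?(leq_trans (sN k) (sS k)).
pose G x := (\sum_(k <oo) (4 ^+ k * normc (D k x) ^+ 2)%:E)%E.
have G0 k x : (0 <= (4 ^+ k * normc (D k x) ^+ 2)%:E)%E.
  by rewrite lee_fin mulr_ge0 ?sqr_ge0// exprn_ge0.
have mGk k : measurable_fun setT (fun x => (4 ^+ k * normc (D k x) ^+ 2)%:E).
  apply/measurable_EFinP; apply: measurable_funM => //.
  by apply: measurable_sqr_normc; case: (hD k).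
have mG : measurable_fun setT G.
  have -> : G = (fun x => \sum_(k <oo | k \in xpredT) (4 ^+ k * normc (D k x) ^+ 2)%:E)%E.
    by [].
  by apply: ge0_emeasurable_sum.
have iGk k : (\int[mu]_x (4 ^+ k * normc (D k x) ^+ 2)%:E <= (2^-1 ^+ k)%:E)%E.
  have -> : (\int[mu]_x (4 ^+ k * normc (D k x) ^+ 2)%:E)%E =
      (4 ^+ k * nrm2 mu (D k))%:E.
    have [_ iD] := hD k.
    rewrite /nrm2 -RintegralZl// /Rintegral fineK//.
    by apply: integrable_fin_num => //; exact: integrable_scale.
  rewrite lee_fin (@le_trans _ _ (4 ^+ k * 8^-1 ^+ k))//.
    by rewrite ler_wpM2l// exprn_ge0.
  by rewrite -exprMn (_ : 4 * 8^-1 = 2^-1 :> R)//; lra.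
have iG : (\int[mu]_x G x < +oo)%E.
  rewrite integral_nneseries//.
  apply: (@le_lt_trans _ _ 2%:E); last exact: ltry.
  apply: lime_le; first by apply: is_cvg_nneseries => n _ _; exact: integral_ge0.
  apply: nearW => n.
  apply: (@le_trans _ _ (\sum_(0 <= k < n) (2^-1 ^+ k)%:E)%E); first exact: lee_sum.
  rewrite sumEFin lee_fin.
  have -> : \sum_(0 <= k < n) 2^-1 ^+ k = 2 - 2 * 2^-1 ^+ n :> R.
    elim: n => [|n ih]; first by rewrite big_geq// expr0 mulr1 subrr.
    by rewrite big_nat_recr//= ih exprS; field.
  by rewrite gerBl mulr_ge0// exprn_ge0// invr_ge0.
have aeG : {ae mu, forall x, (G x < +oo)%E}.
  have : mu.-integrable setT G.
    apply/integrableP; split=> //.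
    under eq_integral => x _. rewrite gee0_abs; last by apply: nneseries_ge0.
      over.
    by [].
  move=> /(integrable_ae measurableT); apply: filterS => x /(_ I).
  by move=> /fin_numPlt /andP[].
pose A := [set x | (G x < +oo)%E].
have mA : measurable A.
  by rewrite -(setTI A); apply: emeasurable_fun_infty_o.
(* Setting the functions to zero off the convergence set makes the limit exist everywhere, hence
   measurable as a pointwise limit. *)
pose hs k x := if x \in A then fs (s k) x else 0.
have chs x : exists z, ccvg (hs ^~ x) z.
  rewrite /hs; have [/set_mem xA|xA] := boolP (x \in A); last first.
    by exists 0; exact: ccvg_cst.
  pose C := Num.sqrt (fine (G x)).
  have hC k : normc (D k x) <= C * 2^-1 ^+ k.
    have hk : 4 ^+ k * normc (D k x) ^+ 2 <= fine (G x).
      rewrite -lee_fin fineK; last first.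
        rewrite ge0_fin_numE//; exact: nneseries_ge0.
      apply: le_trans (nneseries_lim_ge (P := xpredT) k.+1 _) => //.
      by rewrite big_nat_recr//= leeDr// sume_ge0.
    have -> : normc (D k x) = Num.sqrt (4 ^+ k * normc (D k x) ^+ 2) * 2^-1 ^+ k.
      rewrite sqrtrM ?exprn_ge0// sqrtr_sqr ger0_norm ?normc_ge0//.
      rewrite (_ : 4 = 2 ^+ 2); last by rewrite -natrX.
      rewrite -exprM mulnC exprM sqrtr_sqr ger0_norm ?exprn_ge0//.
      by rewrite mulrAC -exprMn mulfV ?expr1n ?mul1r// pnatr_eq0.
    by rewrite ler_wpM2r ?exprn_ge0 ?invr_ge0// ler_wsqrtr.
  have /cvg_ex[/= a ha] : cvgn (fun k => complex.Re (fs (s k) x)).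
    apply: (@cvg_geometric_increments _ C) => k.
    by rewrite -ReN -ReD (le_trans (ler_normc_Re _))//; exact: hC.
  have /cvg_ex[/= b hb] : cvgn (fun k => complex.Im (fs (s k) x)).
    apply: (@cvg_geometric_increments _ C) => k.
    by rewrite -ImN -ImD (le_trans (ler_normc_Im _))//; exact: hC.
  by exists (a +i* b).
have [f cf] := choice chs.
have mhs k : cmeasurable (hs k).
  apply: (@cmeasurable_eq _ _ _ (fun x => (\1_A x)%:C * fs (s k) x)).
    by move=> x; rewrite /hs indicE; case: ifP => _; rewrite ?mul1r ?mul0r.
  by apply: cmeasurableM; [exact: cmeasurable_indic|case: (hfs (s k))].
have mf : cmeasurable f := cmeasurable_ccvg mhs cf.
have cfs : {ae mu, forall x, ccvg (fun k => fs (s k) x) (f x)}.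
  apply: filterS aeG => x xA; have := cf x.
  by rewrite /hs mem_set.
(* Fatou along the subsequence, with [n] fixed, upgrades the pointwise limit to L_2 convergence of
   the whole sequence. *)
have key k n : (s k <= n)%N ->
    sqi mu (fun x => f x - fs n x) /\ nrm2 mu (fun x => f x - fs n x) <= 8^-1 ^+ k.
  move=> kn; apply: (fatou_sqi (gs := fun l x => fs (s (l + k)%N) x - fs n x)).
  - by move=> l; exact: sqiB.
  - by apply: cmeasurableB => //; case: (hfs n).
  - apply: filterS cfs => x cx; apply: ccvgB; last exact: ccvg_cst.
    have ck : (fun l => (l + k)%N) @ \oo --> \oo.
      by move=> P [M _ HM]; exists M => // l /= Ml; apply: HM => /=; rewrite (leq_trans Ml)// leq_addr.
    exact: (ccvg_sub ck cx).
  - move=> l; apply: HN; last exact: leq_trans (sN k) kn.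
    by rewrite (leq_trans (sN k))// smono// leq_addl.
have hf : sqi mu f.
  have [h _] := key 0%N _ (leqnn _).
  have := sqiD h (hfs (s 0%N)).
  by under eq_fun do rewrite subrK.
exists f, s; split=> //.
apply/cvgrPdist_le => e e0.
have c8 : (fun k => 8^-1 ^+ k : R) @ \oo --> (0 : R).
  by apply: cvg_expr; rewrite ger0_norm ?invr_ge0// invf_lt1// ltr1n.
have /cvgrPdist_le/(_ e e0)[K _ HK] := c8.
have {HK} := HK K (leqnn K); rewrite sub0r normrN ger0_norm ?exprn_ge0 ?invr_ge0// => HK.
exists (s K) => // n /= Kn; rewrite sub0r normrN ger0_norm ?nrm2_ge0//.
rewrite nrm2_distl; exact: le_trans (key _ _ Kn).2 HK.
Qed.

Lemma l2cvg_l2cauchy (fs : nat -> T -> R[i]) f :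
  (forall n, sqi mu (fs n)) -> sqi mu f -> l2cvg mu fs f -> l2cauchy fs.
Proof.
move=> hfs hf c e e0.
have e4 : 0 < e / 4 by rewrite divr_gt0.
have /cvgrPdist_le/(_ _ e4)[N _ HN] := c; exists N => m n Nm Nn.
have hN k : (N <= k)%N -> nrm2 mu (fun x => fs k x - f x) <= e / 4.
  by move=> /HN /=; rewrite sub0r normrN ger0_norm ?nrm2_ge0.
have -> : (fun x => fs m x - fs n x) = (fun x => (fs m x - f x) + (f x - fs n x)).
  by apply/funext => x; ring.
apply: le_trans (nrm2D (sqiB (hfs m) hf) (sqiB hf (hfs n))) _.
rewrite [nrm2 mu (fun x => f x - fs n x)]nrm2_distl.
by have := hN m Nm; have := hN n Nn; lra.
Qed.

Lemma l2cvg_ae_subseq (fs : nat -> T -> R[i]) f :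
  (forall n, sqi mu (fs n)) -> sqi mu f -> l2cvg mu fs f ->
  exists2 s : nat -> nat, s @ \oo --> \oo &
    {ae mu, forall x, ccvg (fun k => fs (s k) x) (f x)}.
Proof.
move=> hfs hf c.
have [g [s [hg cg soo ag]]] := riesz_fischer hfs (l2cvg_l2cauchy hfs hf c).
exists s => //; have fg := l2cvg_unique hfs hf hg c cg.
by apply: filterS2 fg ag => x ->.
Qed.

Lemma l2cvg_sub (fs : nat -> T -> R[i]) f (s : nat -> nat) :
  s @ \oo --> \oo -> l2cvg mu fs f -> l2cvg mu (fs \o s) f.
Proof. by move=> soo c; exact: (cvg_comp _ _ soo c). Qed.

End RieszFischer.

(** * Integrals over the line and half-lines from antiderivatives *)

Section FundamentalTheorem.
Context (R : realType).
Local Notation leb := (@lebesgue_measure R).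
Implicit Types (f F : R -> R) (A : set R).

Lemma ftc_itv f F (a b : R) : a < b -> continuous f ->
  (forall x : R, is_derive x (1 : R) F (f x)) ->
  \int[leb]_x (f x * \1_`[a, b] x) = F b - F a.
Proof.
move=> ab cf dF.
have cF : continuous F.
  by move=> x; apply: differentiable_continuous; apply/derivable1_diffP; case: (dF x).
have h : (\int[leb]_(x in `[a, b]) (f x)%:E = (F b)%:E - (F a)%:E)%E.
  apply: continuous_FTC2 => //.
  - exact: continuous_subspaceT.
  - split; first by move=> x _; case: (dF x).
      exact/cvg_at_right_filter/cF.
    exact/cvg_at_left_filter/cF.
  - by move=> x _; rewrite derive1E; exact: derive_val.
rewrite (_ : F b - F a = \int[leb]_(x in `[a, b]) f x); last by rewrite /Rintegral h.
rewrite [RHS]Rintegral_mkcond; apply: eq_Rintegral => x _.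
by rewrite patchE indicE; case: ifP => _; rewrite ?mulr1 ?mulr0.
Qed.

(** One notion for the line and both half-lines. Restrictions are expressed by indicator factors, so
    that all integrals are over the whole line. *)
Definition exhausts (a b : nat -> R) A : Prop :=
  [/\ forall n, a n < b n, measurable (A : set (measurableTypeR R)),
      forall n, `[a n, b n] `<=` A &
      forall x, A x -> \forall n \near \oo, x \in `[a n, b n]].

Lemma exhausts_cvg a b A x : exhausts a b A ->
  (fun n => \1_`[a n, b n] x : R) @ \oo --> (\1_A x : R).
Proof.
move=> [_ _ sub ev]; rewrite [X in _ --> X]indicE.
have [/set_mem xA|xA] := boolP (x \in A).
  apply: cvg_near_cst; apply: filterS (ev _ xA) => n xn.
  by rewrite indicE mem_set.
apply: cvg_near_cst; apply: nearW => n; rewrite indicE memNset// => /sub /mem_set.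
by rewrite (negbTE xA).
Qed.

Lemma continuous_measurableR f : continuous f ->
  measurable_fun setT (f : measurableTypeR R -> R).
Proof. exact: continuous_measurable_fun. Qed.

Lemma ftc_exhausts f F a b A (L : R) : exhausts a b A -> continuous f ->
  (forall x : R, is_derive x (1 : R) F (f x)) ->
  leb.-integrable setT (EFin \o (fun x => f x * \1_A x)) ->
  (fun n => F (b n) - F (a n)) @ \oo --> L ->
  \int[leb]_x (f x * \1_A x) = L.
Proof.
move=> ex cf dF ifA FL; have [ab mA sub ev] := ex.
have mf := continuous_measurableR cf.
apply: (cvg_unique _ _ FL) => //.
rewrite (_ : (fun n => _) = (fun n => \int[leb]_x (f x * \1_`[a n, b n] x))); last first.
  by apply/funext => n; rewrite (ftc_itv (ab n) cf dF).
apply: (@dominated_cvg_Rintegral _ _ _ leb (fun n x => f x * \1_`[a n, b n] x)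
  (fun x => f x * \1_A x) (fun x => `|f x * \1_A x|)).
- move=> n; apply: measurable_funM => //.
- by apply: measurable_funM => //; exact: measurable_indic.
- exact: integrable_norm.
- apply: aeW => x n; rewrite !normrM ler_wpM2l// !indicE.
  have [/set_mem/sub/mem_set -> //|_] := boolP (x \in _).
  by rewrite normr0.
- by apply: aeW => x; apply: cvgM; [exact: cvg_cst|exact: exhausts_cvg].
Qed.

(** For a nonnegative integrand, Fatou turns a uniform bound on the increments of an antiderivative
    into integrability. *)
Lemma integrable_exhausts f F a b A (C : R) : exhausts a b A -> continuous f ->
  (forall x, 0 <= f x) -> (forall x : R, is_derive x (1 : R) F (f x)) ->
  (forall n, F (b n) - F (a n) <= C) ->
  leb.-integrable setT (EFin \o (fun x => f x * \1_A x)).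
Proof.
move=> ex cf f0 dF FC; have [ab mA sub ev] := ex.
have mf := continuous_measurableR cf.
have mfA : measurable_fun setT (EFin \o (fun x => f x * \1_A x)).
  by apply/measurable_EFinP; apply: measurable_funM => //; exact: measurable_indic.
apply/integrableP; split => //.
apply: (@le_lt_trans _ _ C%:E); last exact: ltry.
have mfn n : measurable_fun setT (fun x => (f x * \1_`[a n, b n] x)%:E).
  by apply/measurable_EFinP; apply: measurable_funM.
have fn0 n x : (0 <= (f x * \1_`[a n, b n] x)%:E)%E.
  by rewrite lee_fin mulr_ge0.
have := fatou leb measurableT mfn (fun n x _ => fn0 n x).
have -> : (\int[leb]_x limn_einf (fun n => (f x * \1_`[a n, b n] x)%:E) =
   \int[leb]_x `|(EFin \o (fun x => f x * \1_A x)%R) x|)%E.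
  apply: eq_integral => x _; rewrite gee0_abs ?lee_fin ?mulr_ge0//.
  have c : (fun n => (f x * \1_`[a n, b n] x)%:E) @ \oo --> (f x * \1_A x)%:E.
    apply/fine_cvgP; split; first exact: nearW.
    by apply: cvgM; [exact: cvg_cst|exact: exhausts_cvg].
  by rewrite (cvg_limn_einf_sup c).1.
move=> /le_trans; apply.
rewrite limn_einf_lim; apply: lime_le; first exact: is_cvg_einfs.
apply: nearW => n; apply: (@le_trans _ _ (\int[leb]_x (f x * \1_`[a n, b n] x)%:E)%E).
  by apply: ereal_inf_lbound; exists n => //=.
rewrite -[X in (X <= _)%E]fineK; last first.
  apply: integrable_fin_num => //.
  have : leb.-integrable `[a n, b n] (EFin \o f).
    apply: continuous_compact_integrable => //; first exact: segment_compact.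
    exact: continuous_subspaceT.
  move=> h; have := (integrable_mkcond (mu := leb) (EFin \o f) (measurable_itv `[a n, b n])).1 h.
  apply: eq_integrable => // x _ /=.
  by rewrite patchE indicE; case: ifP => _; rewrite ?mulr1 ?mulr0.
by rewrite lee_fin; have := ftc_itv (ab n) cf dF; rewrite /Rintegral => ->.
Qed.

(** Starting at 1 keeps the interval nondegenerate for [n = 0]. *)
Lemma exhausts_line : exhausts (fun n => - n.+1%:R) (fun n => n.+1%:R) setT.
Proof.
split=> //.
- by move=> n; rewrite gtrN.
- move=> x _; exists (Num.Def.truncn `|x|) => // n /= xn.
  rewrite in_itv /= -ler_norml.
  have /andP[_ h] := truncn_itv (normr_ge0 x).
  by rewrite (le_trans (ltW h))// ler_nat ltnS.
Qed.

Lemma exhausts_right : exhausts (fun n => 0) (fun n => n.+1%:R) [set x | 0 <= x].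
Proof.
have E : [set x : R | 0 <= x] = `[0, +oo[%classic by rewrite set_itvcy.
split=> //.
- by rewrite E; exact: measurable_itv.
- by move=> n x /=; rewrite in_itv /= => /andP[].
- move=> x /= x0; have [_ _ _ /(_ x I)] := exhausts_line.
  by apply: filterS => n /=; rewrite !in_itv /= x0 => /andP[_ ->].
Qed.

Lemma exhausts_left : exhausts (fun n => - n.+1%:R) (fun n => 0) [set x | x <= 0].
Proof.
have E : [set x : R | x <= 0] = `]-oo, 0]%classic by rewrite set_itvNyc.
split=> //.
- by rewrite E; exact: measurable_itv.
- by move=> n x /=; rewrite in_itv /= => /andP[].
- move=> x /= x0; have [_ _ _ /(_ x I)] := exhausts_line.
  by apply: filterS => n /=; rewrite !in_itv /= x0 andbT => /andP[-> _].
Qed.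

End FundamentalTheorem.

Section DerivativeTools.
Context (R : realType).
Implicit Types (f g : R -> R) (c x : R).

Lemma is_derive_comp f g x df dg : is_derive (g x) (1 : R) f df ->
  is_derive x (1 : R) g dg -> is_derive x (1 : R) (fun y => f (g y)) (df * dg).
Proof. by move=> hf hg; exact: (is_derive1_comp hf hg). Qed.

Lemma is_derive_affine (a c : R) x : is_derive x (1 : R) (fun y : R => c * (y - a)) c.
Proof.
have h : is_derive x (1 : R) (fun y : R => y - a) 1.
  by apply: is_derive_eq; rewrite subr0.
apply: (is_derive_eq (is_deriveZ c h)); by rewrite /GRing.scale/= mulr1.
Qed.

Lemma is_derive_linear c x : is_derive x (1 : R) (fun y : R => c * y) c.
Proof.
have := is_derive_affine 0 c x.
by under eq_fun do rewrite subr0.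
Qed.

Lemma is_derive_lin f g (a b : R) x df dg : is_derive x (1 : R) f df ->
  is_derive x (1 : R) g dg ->
  is_derive x (1 : R) (fun y => a * f y + b * g y) (a * df + b * dg).
Proof. by move=> hf hg; exact: (is_deriveD (is_deriveZ a hf) (is_deriveZ b hg)). Qed.

Lemma is_derive_prod f g x df dg : is_derive x (1 : R) f df ->
  is_derive x (1 : R) g dg ->
  is_derive x (1 : R) (fun y => f y * g y) (f x * dg + g x * df).
Proof. by move=> hf hg; exact: (is_deriveM hf hg). Qed.

End DerivativeTools.

(** * Complex exponentials and their integrals over half-lines *)

Section ComplexExponential.
Context (R : realType).
Local Notation leb := (@lebesgue_measure R).
Implicit Types (s t : R[i]) (w x : R).

(** The exponential of [s w] for complex [s] and real [w]. *)
Definition kexp s w : R[i] :=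
  (expR (complex.Re s * w))%:C * expi (complex.Im s * w).

Lemma Re_kexp s w : complex.Re (kexp s w) =
  expR (complex.Re s * w) * cos (complex.Im s * w).
Proof. by rewrite ReM /= mul0r subr0. Qed.

Lemma Im_kexp s w : complex.Im (kexp s w) =
  expR (complex.Re s * w) * sin (complex.Im s * w).
Proof. by rewrite ImM /= mul0r addr0. Qed.

Lemma normc_expi x : normc (expi x) = 1.
Proof. by rewrite /expi /= cos2Dsin2 sqrtr1. Qed.

Lemma expiD x y : expi (x + y) = expi x * expi y.
Proof.
apply: complexP; rewrite ?ReM ?ImM /=; first exact: cosD.
by rewrite sinD addrC.
Qed.

Lemma expi0 : expi 0 = 1 :> R[i].
Proof. by rewrite /expi cos0 sin0. Qed.

Lemma expi_conj x : (expi x)^* = expi (- x).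
Proof. by rewrite conjcE /expi /= cosN sinN. Qed.

Lemma normc_kexp s w : normc (kexp s w) = expR (complex.Re s * w).
Proof. by rewrite normcM normc_expi mulr1 normc_real gtr0_norm ?expR_gt0. Qed.

Lemma kexpD s t w : kexp (s + t) w = kexp s w * kexp t w.
Proof.
by rewrite /kexp ReD ImD !mulrDl expRD expiD rmorphM/=; ring.
Qed.

Lemma kexp0 s : kexp s 0 = 1.
Proof. by rewrite /kexp !mulr0 expR0 expi0 mulr1. Qed.

Lemma is_derive_Re_kexp s w : is_derive w (1 : R)
  (fun w => complex.Re (kexp s w)) (complex.Re (s * kexp s w)).
Proof.
under eq_fun do rewrite Re_kexp.
have h := is_derive_prod
  (is_derive_comp (is_derive_expR (complex.Re s * w)) (is_derive_linear (complex.Re s) w))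
  (is_derive_comp (is_derive_cos (complex.Im s * w)) (is_derive_linear (complex.Im s) w)).
apply: (is_derive_eq h); rewrite ReM Re_kexp Im_kexp; ring.
Qed.

Lemma is_derive_Im_kexp s w : is_derive w (1 : R)
  (fun w => complex.Im (kexp s w)) (complex.Im (s * kexp s w)).
Proof.
under eq_fun do rewrite Im_kexp.
have h := is_derive_prod
  (is_derive_comp (is_derive_expR (complex.Re s * w)) (is_derive_linear (complex.Re s) w))
  (is_derive_comp (is_derive_sin (complex.Im s * w)) (is_derive_linear (complex.Im s) w)).
apply: (is_derive_eq h); rewrite ImM Re_kexp Im_kexp; ring.
Qed.

Lemma is_derive_continuous (f df : R -> R) :
  (forall x : R, is_derive x (1 : R) f (df x)) -> continuous f.
Proof.
move=> d x; apply: differentiable_continuous; apply/derivable1_diffP.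
by case: (d x).
Qed.

Lemma continuous_Re_kexp s : continuous (fun w => complex.Re (kexp s w)).
Proof. exact: (is_derive_continuous (is_derive_Re_kexp s)). Qed.

Lemma continuous_Im_kexp s : continuous (fun w => complex.Im (kexp s w)).
Proof. exact: (is_derive_continuous (is_derive_Im_kexp s)). Qed.

Lemma cmeasurable_kexp s : cmeasurable (kexp s : measurableTypeR R -> R[i]).
Proof.
by split; apply: continuous_measurableR;
  [exact: continuous_Re_kexp|exact: continuous_Im_kexp].
Qed.

Lemma expR_cvg0 (u : nat -> R) : u @ \oo --> -oo ->
  (fun n => expR (u n)) @ \oo --> (0 : R).
Proof.
move=> h; have h' : (fun n => - u n) @ \oo --> +oo%R by apply/(cvgNry u).
have := cvg_comp _ _ h' (@cvgr_expR R).
by rewrite /comp; under eq_fun do rewrite opprK.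
Qed.

Lemma kexp_cvg0 s (b : nat -> R) : (fun n => complex.Re s * b n) @ \oo --> -oo ->
  ccvg (fun n => kexp s (b n)) 0.
Proof.
move=> h; apply: (ccvg_le (v := fun n => expR (complex.Re s * b n))).
  by move=> n; rewrite subr0 normc_kexp.
exact: expR_cvg0.
Qed.

Lemma integrable_exp_exhausts (c : R) (a b : nat -> R) (A : set R) :
  c != 0 -> exhausts a b A -> (forall x, A x -> c * x <= 0) ->
  leb.-integrable setT (EFin \o (fun w : R => expR (c * w) * \1_A w)).
Proof.
move=> c0 ex cA; have [ab _ sub _] := ex.
apply: (@integrable_exhausts _ _ (fun w => c^-1 * expR (c * w)) a b A (2 * `|c^-1|)) => //.
- move=> w; apply: differentiable_continuous; apply/derivable1_diffP.
  by case: (is_derive_comp (is_derive_expR (c * w)) (is_derive_linear c w)).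
- move=> x; apply: (is_derive_eq (is_deriveZ c^-1
    (is_derive_comp (is_derive_expR (c * x)) (is_derive_linear c x)))).
  by rewrite /GRing.scale/= mulrC -mulrA divff ?mulr1.
- move=> n; rewrite -mulrBr (le_trans (ler_norm _))// normrM mulrC ler_wpM2r//.
  have ha : A (a n) by apply: (sub n); rewrite /= in_itv /= lexx ltW.
  have hb : A (b n) by apply: (sub n); rewrite /= in_itv /= lexx andbT ltW.
  have := cA _ ha; have := cA _ hb; rewrite -!expR_le1.
  have := expR_ge0 (c * a n); have := expR_ge0 (c * b n).
  by rewrite ler_norml; lra.
Qed.

(** After multiplication by [s] the integrand is the derivative of [kexp s], so [L] is the limit of
    the boundary terms. The sign condition on [A] keeps the exponential decaying there. *)
Lemma cintegral_kexp_exhausts s (a b : nat -> R) (A : set R) (L : R[i]) :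
  complex.Re s != 0 -> exhausts a b A ->
  (forall x, A x -> complex.Re s * x <= 0) ->
  ccvg (fun n => kexp s (b n) - kexp s (a n)) L ->
  cintegrable leb (fun w => kexp s w * (\1_A w)%:C) /\
  cintegral leb (fun w => kexp s w * (\1_A w)%:C) = s^-1 * L.
Proof.
move=> s0 ex sA cL; have [_ mA _ _] := ex.
have sn0 : s != 0 by apply: contra s0 => /eqP ->.
have ik : cintegrable leb (fun w => kexp s w * (\1_A w)%:C).
  apply: (cintegrable_le _ (integrable_exp_exhausts s0 ex sA)).
    apply: cmeasurableM; first exact: cmeasurable_kexp.
    exact: cmeasurable_indic.
  by move=> w; rewrite normcM normc_kexp normc_real ger0_norm.
split=> //; apply: (mulfI sn0); rewrite mulrA divff// mul1r -cintegralZ//.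
have isk := cintegrableZ s ik.
have [ir ii] := isk; have [cr ci] := cL.
have Er w : complex.Re (s * (kexp s w * (\1_A w)%:C)) =
    complex.Re (s * kexp s w) * \1_A w.
  by rewrite mulrA ReM /= mulr0 subr0.
have Ei w : complex.Im (s * (kexp s w * (\1_A w)%:C)) =
    complex.Im (s * kexp s w) * \1_A w.
  by rewrite mulrA ImM /= mulr0 add0r.
apply: complexP => /=.
- under eq_Rintegral do rewrite Er.
  apply: (ftc_exhausts (F := fun w => complex.Re (kexp s w)) ex).
  + move=> w; under eq_fun do rewrite ReM; apply: cvgB; apply: cvgM;
      by [exact: cvg_cst|exact: continuous_Re_kexp|exact: continuous_Im_kexp].
  + by move=> w; exact: is_derive_Re_kexp.
  + by under [X in EFin \o X]eq_fun do rewrite -Er.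
  + by under eq_fun do rewrite -ReN -ReD.
- under eq_Rintegral do rewrite Ei.
  apply: (ftc_exhausts (F := fun w => complex.Im (kexp s w)) ex).
  + move=> w; under eq_fun do rewrite ImM; apply: cvgD; apply: cvgM;
      by [exact: cvg_cst|exact: continuous_Re_kexp|exact: continuous_Im_kexp].
  + by move=> w; exact: is_derive_Im_kexp.
  + by under [X in EFin \o X]eq_fun do rewrite -Ei.
  + by under eq_fun do rewrite -ImN -ImD.
Qed.

Lemma cvg_natS_pinfty : (fun n => n.+1%:R : R) @ \oo --> +oo%R.
Proof. exact: (cvg_comp _ _ (cvg_addnl 1%N) (@cvgr_idn R)). Qed.

Lemma cvg_lt0_natS (c : R) : c < 0 ->
  (fun n => c * n.+1%:R : R) @ \oo --> -oo%R.
Proof.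
move=> c0; apply/cvgrNyPle => A; have /cvgryPge/(_ (A / c)) := cvg_natS_pinfty.
apply: filterS => n h; rewrite -[A](@divfK _ c) ?lt_eqF// mulrC.
by rewrite ler_wnM2r// ltW.
Qed.

Lemma cintegral_kexp_right s : complex.Re s < 0 ->
  cintegrable leb (fun w => kexp s w * (\1_[set x : R | 0 <= x] w)%:C) /\
  cintegral leb (fun w => kexp s w * (\1_[set x : R | 0 <= x] w)%:C) = - s^-1.
Proof.
move=> s0; rewrite -mulrN1.
apply: (cintegral_kexp_exhausts _ (exhausts_right R)); first by rewrite lt_eqF.
  by move=> x /= x0; rewrite nmulr_rle0.
rewrite -[X in ccvg _ X]add0r; apply: ccvgB; last by rewrite kexp0; exact: ccvg_cst.
exact/kexp_cvg0/cvg_lt0_natS.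
Qed.

Lemma cintegral_kexp_left s : 0 < complex.Re s ->
  cintegrable leb (fun w => kexp s w * (\1_[set x : R | x <= 0] w)%:C) /\
  cintegral leb (fun w => kexp s w * (\1_[set x : R | x <= 0] w)%:C) = s^-1.
Proof.
move=> s0; rewrite -[s^-1]mulr1.
apply: (cintegral_kexp_exhausts _ (exhausts_left R)); first by rewrite gt_eqF.
  by move=> x /= x0; rewrite pmulr_rle0.
rewrite -[X in ccvg _ X]subr0; apply: ccvgB; first by rewrite kexp0; exact: ccvg_cst.
apply: kexp_cvg0; under eq_fun do rewrite mulrN -mulNr.
by apply: cvg_lt0_natS; rewrite oppr_lt0.
Qed.

End ComplexExponential.

(** * A function with vanishing integrals over intervals is null *)

Section IntervalUniqueness.
Context (R : realType).
Local Notation leb := (@lebesgue_measure R).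

Lemma real_itv_ae0 (u : R -> R) :
  measurable_fun setT (u : measurableTypeR R -> R) ->
  (forall a b : R, leb.-integrable setT (EFin \o (fun x => u x * \1_`[a, b] x))) ->
  (forall a b : R, a < b -> \int[leb]_x (u x * \1_`[a, b] x) = 0) ->
  {ae leb, forall x, u x = 0}.
Proof.
move=> mu iu u0.
have patchE' (a b : R) : (u \_ `[a, b] : R -> R) = (fun x => u x * \1_`[a, b] x).
  by apply/funext => x; rewrite patchE indicE; case: ifP => _; rewrite ?mulr1 ?mulr0.
have iab (a b : R) : leb.-integrable `[a, b] (EFin \o u).
  apply: (integrable_mkcond (mu := leb) (EFin \o u) (measurable_itv `[a, b])).2.
  by rewrite restrict_EFin patchE'.
have Iab (a b : R) : (\int[leb]_(x in `[a, b]) u x)%R = 0.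
  have [ab|ba] := ltP a b.
    by rewrite Rintegral_mkcond patchE' u0.
  have : (\int[leb]_(x in `[a, b]) (u x)%:E = 0)%E.
    apply: null_set_integral; first exact: measurable_itv.
      exact/measurable_EFinP/measurable_funTS.
    by have := lebesgue_measure_itv `[a, b]; rewrite /= lte_fin ltNge ba.
  by rewrite /Rintegral => ->.
have locu : locally_integrable [set: R] u.
  split=> //; first exact: openT.
  move=> K _ cK; have mK : measurable (K : set (measurableTypeR R)).
    exact: compact_measurable.
  have [M [_ HM]] := compact_bounded cK.
  have HM1 : forall x, K x -> `|x| <= M + 1.
    by move=> x Kx; apply: (HM (M + 1) _ x Kx); rewrite ltrDl.
  have : leb.-integrable K (EFin \o u).
    apply: (integrableS _ mK _ (iab (- (M + 1)) (M + 1))); first exact: measurable_itv.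
    by move=> x /HM1; rewrite /= in_itv /= ler_norml.
  by move=> /integrableP[].
(* The primitive based at [-n] is identically zero, and by Lebesgue differentiation its derivative
   is [u] almost everywhere to the right of [-n]; countably many [n] cover the line. *)
have H n : {ae leb, forall x : R, - n%:R < x -> u x = 0}.
  have := FTC1 (a := BLeft (- n%:R : R)) (fun y => iab _ y) locu.
  rewrite (_ : (fun x => \int[leb]_(t in [set` Interval (BLeft (- n%:R)) (BRight x)]) u t) =
    cst 0); last by apply/funext => y; exact: Iab.
  apply: filterS; first exact: (ae_filter_ringOfSetsType leb).
  move=> x h nx; have [] := h.
    by rewrite lte_fin.
  by rewrite derive1_cst => _ <-.
have := ae_foralln H; apply: filterS => x h.
apply: (h (Num.Def.truncn `|x|).+1).
have /andP[_ hx] := truncn_itv (normr_ge0 x).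
by rewrite ltrNl (le_lt_trans _ hx)// -normrN ler_norm.
Qed.

Lemma cintegral_itv_ae0 (f : measurableTypeR R -> R[i]) : cmeasurable f ->
  (forall a b : R, cintegrable leb (fun x => f x * (\1_`[a, b] x)%:C)) ->
  (forall a b : R, a < b -> cintegral leb (fun x => f x * (\1_`[a, b] x)%:C) = 0) ->
  aeeq leb f (fun=> 0).
Proof.
move=> [mr mi] if_ f0.
have Er a b : (fun x => complex.Re (f x * (\1_`[a, b] x)%:C)) =
    (fun x => complex.Re (f x) * \1_`[a, b] x).
  by apply/funext => x; rewrite ReM /= mulr0 subr0.
have Ei a b : (fun x => complex.Im (f x * (\1_`[a, b] x)%:C)) =
    (fun x => complex.Im (f x) * \1_`[a, b] x).
  by apply/funext => x; rewrite ImM /= mulr0 add0r.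
have hr : {ae leb, forall x, complex.Re (f x) = 0}.
  apply: real_itv_ae0 => // a b => [|ab]; first by rewrite -Er; case: (if_ a b).
  by have := f0 _ _ ab; rewrite /cintegral Er => -[].
have hi : {ae leb, forall x, complex.Im (f x) = 0}.
  apply: real_itv_ae0 => // a b => [|ab]; first by rewrite -Ei; case: (if_ a b).
  by have := f0 _ _ ab; rewrite /cintegral Ei => -[].
by apply: filterS2 hr hi => x hx hx'; apply: complexP.
Qed.

Lemma sqi_indic_itv (a b : R) : sqi leb (fun x : measurableTypeR R => (\1_`[a, b] x)%:C).
Proof.
apply: (@sqi_le _ _ _ leb _ (fun x : measurableTypeR R => \1_`[a, b] x)).
- exact: cmeasurable_indic.
- exact: integrable_indic_itv.
- apply: aeW => x; rewrite normc_real indicE.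
  by case: (x \in _); rewrite ?normr1 ?normr0 ?expr1n ?expr0n.
Qed.

Lemma sqi_cintegrable_itv (f : measurableTypeR R -> R[i]) (a b : R) : sqi leb f ->
  cintegrable leb (fun x => f x * (\1_`[a, b] x)%:C).
Proof. by move=> hf; apply: cintegrableM => //; exact: sqi_indic_itv. Qed.

End IntervalUniqueness.

(** * Cauchy and Poisson kernels *)

Section Kernels.
Context (R : realType).
Local Notation leb := (@lebesgue_measure R).
Local Notation T := (measurableTypeR R).
Implicit Types (a b : R[i]) (x y t : R).

(** The Cauchy kernel with pole [a]. For [Im a < 0] it is holomorphic in the upper half-plane, so
    integrating it against a Hardy function should give zero. *)
Definition ckernel a (x : T) : R[i] := (x%:C - a)^-1.

Lemma sub_real_neq0 a x : complex.Im a != 0 -> x%:C - a != 0.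
Proof. by apply: contraNneq => /eqP; rewrite subr_eq0 => /eqP <-. Qed.

Lemma normc_ge_Im_sub a x : `|complex.Im a| <= normc (x%:C - a).
Proof. by apply: le_trans (ler_normc_Im _); rewrite ImD ImN /= add0r normrN. Qed.

Lemma ckernel_bounded a x : complex.Im a != 0 ->
  normc (ckernel a x) <= `|complex.Im a|^-1.
Proof.
move=> a0; rewrite normcV lef_pV2 ?posrE ?normr_gt0// ?normc_ge_Im_sub//.
by rewrite normc_gt0 sub_real_neq0.
Qed.

Lemma cmeasurable_ckernel a : cmeasurable (ckernel a).
Proof.
apply: cmeasurableV; apply: cmeasurableB; last exact: cmeasurable_cst.
exact: cmeasurable_real.
Qed.

(** The Poisson kernel at height [e], normalized to have total mass [pi]. *)
Definition pkernel (e u : R) : R := e / (e ^+ 2 + u ^+ 2).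

Lemma pkernel_den_gt0 (e u : R) : 0 < e -> 0 < e ^+ 2 + u ^+ 2.
Proof. by move=> e0; rewrite ltr_pwDl ?sqr_ge0// exprn_gt0. Qed.

Lemma pkernel_ge0 (e u : R) : 0 < e -> 0 <= pkernel e u.
Proof. by move=> e0; rewrite divr_ge0 ?ltW// pkernel_den_gt0. Qed.

Lemma pkernel_le (e u : R) : 0 < e -> pkernel e u <= e^-1.
Proof.
move=> e0; rewrite /pkernel ler_pdivrMr ?pkernel_den_gt0//.
by rewrite mulrDr expr2 mulrA mulVf ?gt_eqF// mul1r lerDl mulr_ge0 ?sqr_ge0// invr_ge0 ltW.
Qed.

Lemma is_derive_pkernel (e t x : R) : 0 < e ->
  is_derive x (1 : R) (fun y => atan (e^-1 * (y - t))) (pkernel e (x - t)).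
Proof.
move=> e0.
have h := @is_derive_comp _ atan (fun y => e^-1 * (y - t)) _ _ _
  (is_derive1_atan (e^-1 * (x - t))) (is_derive_affine t e^-1 x).
apply: (is_derive_eq h); rewrite /pkernel.
have e1 : e != 0 by rewrite gt_eqF.
have h0 : e ^+ 2 + (x - t) ^+ 2 != 0 by rewrite gt_eqF// pkernel_den_gt0.
have h1 : 1 + (e^-1 * (x - t)) ^+ 2 = (e ^+ 2 + (x - t) ^+ 2) / e ^+ 2 by field.
by rewrite h1; field; rewrite e1 h0.
Qed.

End Kernels.

Section PoissonKernel.
Context (R : realType).
Local Notation leb := (@lebesgue_measure R).
Local Notation T := (measurableTypeR R).
Implicit Types (x y t u e : R).

Lemma continuous_pkernel e t : 0 < e -> continuous (fun x : R => pkernel e (x - t)).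
Proof.
move=> e0 x; apply: cvgM; first exact: cvg_cst.
apply: cvgV; first by rewrite gt_eqF// pkernel_den_gt0.
apply: cvgD; first exact: cvg_cst.
by rewrite expr2; under eq_fun do rewrite expr2; apply: cvgM; apply: cvgB;
  by [exact: cvg_id|exact: cvg_cst].
Qed.

Lemma pkernelN e u : pkernel e (- u) = pkernel e u.
Proof. by rewrite /pkernel sqrrN. Qed.

Lemma integral_pkernel_itv e t (a b : R) : 0 < e -> a < b ->
  \int[leb]_x (pkernel e (x - t) * \1_`[a, b] x) =
  atan (e^-1 * (b - t)) - atan (e^-1 * (a - t)).
Proof.
move=> e0 ab; apply: (ftc_itv (F := fun y => atan (e^-1 * (y - t)))) => //.
  exact: continuous_pkernel.
by move=> x; exact: is_derive_pkernel.
Qed.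

Lemma atan_bounded x : `|atan x| <= pi / 2.
Proof. by rewrite ler_norml !ltW// ?atan_ltpi2// atan_gtNpi2. Qed.

Lemma cvg_atan_pos u (v : nat -> R) : v @ \oo --> +oo%R ->
  (fun n => atan (v n)) @ \oo --> pi / 2.
Proof. by move=> h; exact: (cvg_comp _ _ h (@cvgy_atan R)). Qed.

Lemma cvg_affine_natS c t : 0 < c -> (fun n => c * (n.+1%:R - t) : R) @ \oo --> +oo%R.
Proof.
move=> c0; apply/cvgryPge => A; have /cvgryPge/(_ (A / c + t)) := @cvg_natS_pinfty R.
by apply: filterS => n h; rewrite -ler_pdivrMl// lerBrDr mulrC.
Qed.

Lemma atan_affine_cvg e t : 0 < e ->
  (fun n => atan (e^-1 * (n.+1%:R - t)) - atan (e^-1 * (- n.+1%:R - t))) @ \oo --> (pi : R).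
Proof.
move=> e0; have e1 : 0 < e^-1 by rewrite invr_gt0.
rewrite (_ : (fun n => _) = (fun n => atan (e^-1 * (n.+1%:R - t)) +
  atan (e^-1 * (n.+1%:R - - t)))); last first.
  by apply/funext => n; rewrite -atanN; congr (_ + atan _); ring.
rewrite [X in _ --> X](splitr pi).
by apply: cvgD; apply: cvg_atan_pos => //; exact: cvg_affine_natS.
Qed.

Lemma integrable_pkernel e t : 0 < e ->
  leb.-integrable setT (EFin \o (fun x : T => pkernel e (x - t))) /\
  \int[leb]_x (pkernel e (x - t)) = pi.
Proof.
move=> e0.
have E : (fun x : R => pkernel e (x - t) * \1_[set: R] x) = (fun x : R => pkernel e (x - t)).
  by apply/funext => x; rewrite indicE in_setT mulr1.
have I : leb.-integrable setT (EFin \o (fun x : R => pkernel e (x - t) * \1_[set: R] x)).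
  apply: (@integrable_exhausts _ _ (fun y => atan (e^-1 * (y - t))) _ _ _ pi
    (exhausts_line R)).
  - exact: continuous_pkernel.
  - by move=> x; exact: pkernel_ge0.
  - by move=> x; exact: is_derive_pkernel.
  - move=> n; rewrite (splitr pi); apply: lerD; first by rewrite ltW// atan_ltpi2.
    by rewrite -atanN ltW// atan_ltpi2.
split; first by rewrite -E.
rewrite -[in LHS]E; apply: (ftc_exhausts (F := fun y => atan (e^-1 * (y - t))) (exhausts_line R)) => //.
- exact: continuous_pkernel.
- by move=> x; exact: is_derive_pkernel.
- exact: atan_affine_cvg.
Qed.

Lemma cvg_atan_natS u : (fun n => atan (n.+1%:R * u) : R) @ \oo --> Num.sg u * (pi / 2).
Proof.
have [u0|u0|->] := ltrgt0P u.
- rewrite gtr0_sg// mul1r; apply: cvg_atan_pos => //.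
  have := @cvg_affine_natS u 0 u0; apply: cvg_trans; apply: near_eq_cvg.
  by apply: nearW => n; rewrite subr0 mulrC.
- rewrite ltr0_sg// mulN1r.
  rewrite (_ : (fun n => _) = (fun n => - atan (n.+1%:R * - u))); last first.
    by apply/funext => n; rewrite -atanN mulrN opprK.
  apply: cvgN; apply: cvg_atan_pos => //.
  have Nu0 : 0 < - u by rewrite oppr_gt0.
  have := @cvg_affine_natS _ 0 Nu0; apply: cvg_trans; apply: near_eq_cvg.
  by apply: nearW => n; rewrite subr0 mulrC.
- rewrite sgr0 mul0r; under eq_fun do rewrite mulr0 atan0; exact: cvg_cst.
Qed.

(** The heights at which the real axis is approached; a sequence suits dominated convergence and
    subsequence arguments. *)
Definition harm (n : nat) : R := n.+1%:R^-1.

Lemma harm_gt0 n : 0 < harm n. Proof. by rewrite invr_gt0. Qed.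

Lemma harm_cvg0 : harm @ \oo --> (0 : R).
Proof. exact: cvg_harmonic. Qed.

(** The integral is a difference of arctangents. The endpoints are excluded because the limit there
    is [pi / 2]. *)
Lemma poisson_itv_cvg (a b t : R) : a < b -> t != a -> t != b ->
  (fun n => \int[leb]_x (pkernel (harm n) (x - t) * \1_`[a, b] x)) @ \oo -->
  pi * \1_`[a, b] t.
Proof.
move=> ab ta tb.
rewrite (_ : (fun n => _) = (fun n => atan (n.+1%:R * (b - t)) - atan (n.+1%:R * (a - t)))).
  rewrite (_ : pi * _ = Num.sg (b - t) * (pi / 2) - Num.sg (a - t) * (pi / 2)).
    by apply: cvgB; exact: cvg_atan_natS.
  rewrite indicE mem_setE in_itv /=.
  have [at_|at_|at_] := ltgtP a t; last by rewrite at_ eqxx in ta.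
  - have [bt|bt|bt] := ltgtP t b; last by rewrite bt eqxx in tb.
    + by rewrite gtr0_sg ?subr_gt0// ltr0_sg ?subr_lt0//=; field.
    + by rewrite ltr0_sg ?subr_lt0// ltr0_sg ?subr_lt0//=; field.
  - by rewrite gtr0_sg ?subr_gt0 ?(lt_trans at_ ab)// gtr0_sg ?subr_gt0//=; field.
by apply/funext => n; rewrite integral_pkernel_itv ?harm_gt0// /harm invrK.
Qed.

Lemma poisson_itv_bounded (n : nat) (a b t : R) : a < b ->
  `|\int[leb]_x (pkernel (harm n) (x - t) * \1_`[a, b] x)| <= pi.
Proof.
move=> ab; rewrite integral_pkernel_itv ?harm_gt0//.
rewrite (le_trans (ler_normB _ _))// [X in _ <= X](splitr pi).
by apply: lerD; exact: atan_bounded.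
Qed.

Lemma sqr_normc_ckernel (a : R[i]) (x : T) : complex.Im a != 0 ->
  normc (ckernel a x) ^+ 2 =
  `|complex.Im a|^-1 * pkernel `|complex.Im a| (x - complex.Re a).
Proof.
move=> a0; rewrite normcV exprVn sqr_normcE !(ReD, ImD, ReN, ImN) /= add0r sqrrN.
rewrite /pkernel real_normK ?num_real// mulrA mulVf ?normr_eq0// mul1r.
by rewrite addrC.
Qed.

Lemma sqi_ckernel (a : R[i]) : complex.Im a != 0 -> sqi leb (ckernel a).
Proof.
move=> a0; apply: (@sqi_le _ _ _ leb _ (fun x : T =>
  `|complex.Im a|^-1 * pkernel `|complex.Im a| (x - complex.Re a))).
- exact: cmeasurable_ckernel.
- by apply: integrable_scale; apply: (integrable_pkernel _ _).1; rewrite normr_gt0.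
- by apply: aeW => x; rewrite sqr_normc_ckernel.
Qed.

End PoissonKernel.

(** * Fourier transforms of half-line exponentials *)

Section KernelFourier.
Context (R : realType).
Local Notation leb := (@lebesgue_measure R).
Local Notation T := (measurableTypeR R).
Implicit Types (s a b : R[i]) (x y t u e w : R).

Lemma expi_kexp w x : expi (- (w * x)) = kexp (0 -i* x) w.
Proof. by rewrite /kexp /= mul0r expR0 mul1r mulrC mulNr. Qed.

Lemma invNi : (- 'i)^-1 = 'i :> R[i].
Proof.
apply: (@mulfI _ (- 'i)); first by rewrite oppr_eq0 eq_complex /= oner_eq0 andbF.
rewrite divff ?oppr_eq0 ?eq_complex /= ?oner_eq0 ?andbF//.
by apply: complexP => /=; ring.
Qed.

(** Poles in the lower half-plane correspond to negative frequencies: this is the bridge from the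
    Fourier definition of the Hardy space to Cauchy kernels. *)
Lemma cfourier_left a x : complex.Im a < 0 ->
  cintegrable leb (fun w : T => kexp ('i * a) w * (\1_[set x : R | x <= 0] w)%:C) /\
  cintegral leb (fun w : T => kexp ('i * a) w * (\1_[set x : R | x <= 0] w)%:C *
    expi (- (w * x))) = 'i * ckernel a x.
Proof.
move=> a0; split.
  by apply: (cintegral_kexp_left _).1; rewrite ReM /= mul0r mul1r sub0r oppr_gt0.
under eq_cintegral do rewrite mulrAC expi_kexp -kexpD.
rewrite (cintegral_kexp_left _).2; last first.
  by rewrite ReD ReM /= mul0r mul1r sub0r addr0 oppr_gt0.
have -> : 'i * a + (0 -i* x) = - 'i * (x%:C - a).
  by apply: complexP; case: a {a0} => ar ai /=; ring.
by rewrite invfM invNi.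
Qed.

Lemma cfourier_right b t : 0 < complex.Im b ->
  cintegrable leb (fun w : T => kexp ('i * b) w * (\1_[set x : R | 0 <= x] w)%:C) /\
  cintegral leb (fun w : T => kexp ('i * b) w * (\1_[set x : R | 0 <= x] w)%:C *
    expi (- (w * t))) = - 'i * ckernel b t.
Proof.
move=> b0; split.
  by apply: (cintegral_kexp_right _).1; rewrite ReM /= mul0r mul1r sub0r oppr_lt0.
under eq_cintegral do rewrite mulrAC expi_kexp -kexpD.
rewrite (cintegral_kexp_right _).2; last first.
  by rewrite ReD ReM /= mul0r mul1r sub0r addr0 oppr_lt0.
have -> : 'i * b + (0 -i* t) = - 'i * (t%:C - b).
  by apply: complexP; case: b {b0} => br bi /=; ring.
by rewrite invfM invNi mulNr.
Qed.

(** The Abel weight [exp (- e |w|)], except at [w = 0], where both indicators count and the value is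
    2. The split form is integrated by the half-line formulas. *)
Definition pweight e (w : T) : R :=
  expR (- e * w) * \1_[set x : R | 0 <= x] w + expR (e * w) * \1_[set x : R | x <= 0] w.

Lemma pweightE e w : (pweight e w)%:C =
  kexp (- e)%:C w * (\1_[set x : R | 0 <= x] w)%:C +
  kexp e%:C w * (\1_[set x : R | x <= 0] w)%:C.
Proof. by rewrite /kexp /= !mul0r expi0 !mulr1 rmorphD !rmorphM. Qed.

Lemma indic_mkset (P : pred R) (w : R) : \1_[set x | P x] w = (P w)%:R :> R.
Proof. by rewrite indicE; congr (nat_of_bool _)%:R; apply/idP/idP; rewrite inE. Qed.

Lemma expR_le_pweight e w : expR (- (e * `|w|)) <= pweight e w.
Proof.
rewrite /pweight; have [w0|w0] := ger0P w.
- by rewrite (indic_mkset (fun x => 0 <= x)) w0 /= mulr1 mulNr lerDl mulr_ge0// expR_ge0.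
- by rewrite (indic_mkset (fun x => x <= 0)) (ltW w0) /= mulr1 mulrN opprK lerDr mulr_ge0// expR_ge0.
Qed.

Lemma pweight_gt0 e w : 0 < pweight e w.
Proof. exact: lt_le_trans (expR_gt0 _) (expR_le_pweight e w). Qed.

Lemma integrable_pweight e : 0 < e -> leb.-integrable setT (EFin \o pweight e).
Proof.
move=> e0; apply: integrable_add.
- apply: (integrable_exp_exhausts _ (exhausts_right R)).
    by rewrite oppr_eq0 gt_eqF.
  by move=> x /= x0; rewrite mulNr oppr_le0 mulr_ge0// ltW.
- apply: (integrable_exp_exhausts _ (exhausts_left R)); first by rewrite gt_eqF.
  by move=> x /= x0; rewrite pmulr_rle0.
Qed.

Lemma cfourier_pweight e u : 0 < e ->
  cintegral leb (fun w : T => (pweight e w)%:C * expi (w * u)) = (2 * pkernel e u)%:C.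
Proof.
move=> e0.
have E w : (pweight e w)%:C * expi (w * u) =
    kexp ((- e) +i* u) w * (\1_[set x : R | 0 <= x] w)%:C +
    kexp (e +i* u) w * (\1_[set x : R | x <= 0] w)%:C.
  rewrite pweightE mulrDl; congr (_ + _); rewrite mulrAC; congr (_ * _);
  by rewrite /kexp /= mul0r expi0 mulr1 [w * u]mulrC.
under eq_cintegral do rewrite E.
have s1 : complex.Re ((- e) +i* u) < 0 by rewrite oppr_lt0.
have s2 : 0 < complex.Re (e +i* u) by [].
have [i1 h1] := cintegral_kexp_right s1; have [i2 h2] := cintegral_kexp_left s2.
rewrite cintegralD// h1 h2 /pkernel; have h := pkernel_den_gt0 u e0.
by apply: complexP; rewrite !(ReD, ImD, ReN, ImN, ReV, ImV) !sqr_normcE /= sqrrN;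
  field; rewrite gt_eqF.
Qed.

End KernelFourier.

(** * The Fourier transform of integrable functions *)

Section FourierTransform.
Context (R : realType).
Local Notation leb := (@lebesgue_measure R).
Local Notation T := (measurableTypeR R).
Implicit Types (f phi : T -> R[i]).

Lemma cmeasurable_expi d (S : measurableType d) (u : S -> R) :
  measurable_fun setT u -> cmeasurable (fun p => expi (u p)).
Proof.
move=> mu; split => /=.
- apply: (measurableT_comp _ mu); apply: continuous_measurableR.
  exact: continuous_cos.
- apply: (measurableT_comp _ mu); apply: continuous_measurableR.
  exact: continuous_sin.
Qed.

Lemma cmeasurable_fst f : cmeasurable f -> cmeasurable (fun p : T * T => f p.1).
Proof. by move=> mf; apply: (cmeasurable_compT _ mf); exact: measurable_fst. Qed.

Lemma cmeasurable_snd f : cmeasurable f -> cmeasurable (fun p : T * T => f p.2).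
Proof. by move=> mf; apply: (cmeasurable_compT _ mf); exact: measurable_snd. Qed.

Let mexp2 : cmeasurable (fun p : T * T => expi (- (p.1 * p.2)) : R[i]).
Proof.
apply: cmeasurable_expi; apply: measurable_funN; apply: measurable_funM.
  exact: measurable_fst.
exact: measurable_snd.
Qed.

Lemma cmeasurable_fourier_integrand f phi : cmeasurable f -> cmeasurable phi ->
  cmeasurable (fun p : T * T => phi p.1 * (f p.2 * expi (- (p.1 * p.2)))).
Proof.
move=> mf mphi; apply: cmeasurableM; first exact: cmeasurable_fst.
by apply: cmeasurableM; [exact: cmeasurable_snd|exact: mexp2].
Qed.

Let fourier_dominated f phi (w x : T) :
  normc (phi w * (f x * expi (- (w * x)))) <= normc (phi w) * normc (f x).
Proof. by rewrite !normcM normc_expi mulr1. Qed.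

Lemma cintegrable_expiM f (u : T -> R) : measurable_fun setT u -> cintegrable leb f ->
  cintegrable leb (fun x => f x * expi (u x)).
Proof.
move=> mu if_; under eq_fun do rewrite mulrC.
apply: (cintegrable_bounded (M := 1)) => //; first exact: cmeasurable_expi.
by move=> x; rewrite normc_expi.
Qed.

Let measurable_char (w : R) : measurable_fun setT (fun x : T => - (w * x)).
Proof. by apply: measurable_funN; apply: measurable_funM. Qed.

Lemma measurable_mulr (w : R) : measurable_fun setT (fun x : T => x * w).
Proof. by apply: measurable_funM. Qed.

Lemma multiplication_formula f phi : cintegrable leb f -> cintegrable leb phi ->
  cintegral leb (fun w => phi w * fourierL1 f w) =
  cintegral leb (fun x => f x * cintegral leb (fun w => phi w * expi (- (w * x)))).
Proof.
move=> if_ ip; have mf := cintegrable_cmeasurable if_.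
have mp := cintegrable_cmeasurable ip.
have := @cfubini _ _ _ _ _ leb leb
  (fun p => phi p.1 * (f p.2 * expi (- (p.1 * p.2)))) _ _
  (cmeasurable_fourier_integrand mf mp) (cintegrable_normc ip) (cintegrable_normc if_)
  (fourier_dominated f phi) => /= h.
transitivity (cintegral leb (fun w => cintegral leb (fun x => phi w * (f x * expi (- (w * x)))))).
  apply: eq_cintegral => w; rewrite /fourierL1 -cintegralZ; first by [].
  exact: (cintegrable_expiM (measurable_char w) if_).
rewrite h; apply: eq_cintegral => x; rewrite -cintegralZ; last first.
  exact: (cintegrable_expiM (measurable_funN (measurable_mulr x)) ip).
by apply: eq_cintegral => w; rewrite mulrCA.
Qed.

(** Fubini gives measurability after multiplication by an integrable weight in the frequency; the
    weight is positive and is divided out. *)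
Lemma cmeasurable_fourierL1 f : cintegrable leb f -> cmeasurable (fourierL1 f).
Proof.
move=> if_; have mf := cintegrable_cmeasurable if_.
have ip : cintegrable leb (fun w => (pweight 1 w)%:C : R[i]).
  by apply: cintegrable_real; exact: integrable_pweight.
have mp := cintegrable_cmeasurable ip.
have /cintegrable_cmeasurable := @cintegrable_fubini1 _ _ _ _ _ leb leb
  (fun p => (pweight 1 p.1)%:C * (f p.2 * expi (- (p.1 * p.2)))) _ _
  (cmeasurable_fourier_integrand mf mp) (cintegrable_normc ip) (cintegrable_normc if_)
  (fourier_dominated f (fun w => (pweight 1 w)%:C)) => h.
have {h} := cmeasurableM (cmeasurableV mp) h; apply: cmeasurable_eq => w /=.
rewrite cintegralZ; last exact: (cintegrable_expiM (measurable_char w) if_).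
rewrite mulrA mulVf ?mul1r// ; apply/eqP => -[/eqP].
by rewrite gt_eqF// pweight_gt0.
Qed.

Lemma fourierL1_bounded f (w : T) : cintegrable leb f ->
  normc (fourierL1 f w) <= \int[leb]_x normc (f x).
Proof.
move=> if_; apply: le_trans (le_normc_cintegral _) _; first exact: cintegrable_expiM.
rewrite le_eqVlt; apply/orP; left; apply/eqP; apply: eq_Rintegral => x _.
by rewrite normcM normc_expi mulr1.
Qed.

Definition poisson_avg (e : R) f (y : T) : R[i] :=
  cintegral leb (fun x => f x * (pkernel e (y - x))%:C).

Lemma measurable_pkernel2 e : 0 < e ->
  measurable_fun setT (fun p : T * T => pkernel e (p.1 - p.2)).
Proof.
move=> e0.
have mp : measurable_fun setT (fun x : T => pkernel e x).
  apply: continuous_measurableR => x; have := @continuous_pkernel _ e 0 e0 x.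
  by rewrite /continuous_at subr0; under eq_fun do rewrite subr0.
apply: (measurableT_comp mp); apply: measurable_funB.
  exact: measurable_fst.
exact: measurable_snd.
Qed.

Lemma measurable_pkernel_section e (y : R) : 0 < e ->
  measurable_fun setT (fun x : T => pkernel e (y - x)).
Proof. by move=> e0; exact: (measurableT_comp (measurable_pkernel2 e0) (pair1_measurable y)). Qed.

Lemma normc_pkernel e (y : R) : 0 < e -> normc (pkernel e y)%:C <= e^-1.
Proof. by move=> e0; rewrite normc_real ger0_norm ?pkernel_ge0// pkernel_le. Qed.

Lemma cintegrable_poisson e f (y : T) : 0 < e -> cintegrable leb f ->
  cintegrable leb (fun x => f x * (pkernel e (y - x))%:C).
Proof.
move=> e0 if_; under eq_fun do rewrite mulrC.
apply: (cintegrable_bounded (M := e^-1)) => //.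
  by apply: cmeasurable_real; exact: measurable_pkernel_section.
by move=> x; exact: normc_pkernel.
Qed.

(** Abel-regularized Fourier inversion: damping the frequencies amounts to Poisson averaging. *)
Lemma fourier_poisson e f (y : T) : 0 < e -> cintegrable leb f ->
  cintegral leb (fun w => (pweight e w)%:C * expi (w * y) * fourierL1 f w) =
  2 * poisson_avg e f y.
Proof.
move=> e0 if_; rewrite multiplication_formula//; last first.
  apply: cintegrable_expiM; first exact: measurable_mulr.
  by apply: cintegrable_real; exact: integrable_pweight.
rewrite -cintegralZ; last exact: cintegrable_poisson.
apply: eq_cintegral => x.
have E w : (pweight e w)%:C * expi (w * y) * expi (- (w * x)) =
    (pweight e w)%:C * expi (w * (y - x)).
  by rewrite -mulrA -expiD; congr (_ * expi _); ring.
rewrite (eq_cintegral _ E) cfourier_pweight// rmorphM/=.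
have -> : (2 : R)%:C = 2 :> R[i] by rewrite rmorph_nat.
by rewrite mulrCA.
Qed.

Lemma cmeasurable_poisson_integrand e f (phi : T -> R[i]) : 0 < e ->
  cmeasurable f -> cmeasurable phi ->
  cmeasurable (fun p : T * T => phi p.1 * (f p.2 * (pkernel e (p.1 - p.2))%:C)).
Proof.
move=> e0 mf mp; apply: cmeasurableM; first exact: cmeasurable_fst.
apply: cmeasurableM; first exact: cmeasurable_snd.
by apply: cmeasurable_real; exact: measurable_pkernel2.
Qed.

Lemma poisson_avg_itv e f (a b : R) : 0 < e -> cintegrable leb f ->
  cintegral leb (fun y => (\1_`[a, b] y)%:C * poisson_avg e f y) =
  cintegral leb (fun x => f x * (\int[leb]_y (pkernel e (y - x) * \1_`[a, b] y))%:C).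
Proof.
move=> e0 if_; have mf := cintegrable_cmeasurable if_.
have iI : leb.-integrable setT (EFin \o (fun y : T => e^-1 * \1_`[a, b] y)).
  by apply: integrable_scale; exact: integrable_indic_itv.
have dom (y x : T) : normc ((\1_`[a, b] y)%:C * (f x * (pkernel e (y - x))%:C)) <=
    (e^-1 * \1_`[a, b] y) * normc (f x).
  have i0 : 0 <= \1_`[a, b] y :> R by [].
  rewrite !normcM (normc_real (\1_`[a, b] y)) (ger0_norm i0).
  rewrite [leRHS](_ : _ = \1_`[a, b] y * (normc (f x) * e^-1)); last by ring.
  by rewrite ler_wpM2l// ler_wpM2l ?normc_ge0 ?normc_pkernel.
have mI : cmeasurable (fun y : T => (\1_`[a, b] y)%:C : R[i]) by exact: cmeasurable_indic.
have := @cfubini _ _ _ _ _ leb leb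
  (fun p => (\1_`[a, b] p.1)%:C * (f p.2 * (pkernel e (p.1 - p.2))%:C)) _ _
  (cmeasurable_poisson_integrand e0 mf mI) iI (cintegrable_normc if_) dom => /= h.
transitivity (cintegral leb (fun y => cintegral leb (fun x =>
  (\1_`[a, b] y)%:C * (f x * (pkernel e (y - x))%:C)))).
  apply: eq_cintegral => y; rewrite /poisson_avg -cintegralZ; first by [].
  exact: cintegrable_poisson.
rewrite h; apply: eq_cintegral => x; rewrite -cintegral_real -cintegralZ; last first.
  apply: cintegrable_real; apply: (@integrable_le _ _ _ leb _ (fun y : T => e^-1 * \1_`[a, b] y)).
  - apply: measurable_funM; last exact: measurable_indic.
    exact: (measurableT_comp (measurable_pkernel2 e0) (pair2_measurable x)).
  - exact: iI.
  - move=> y; have i0 : 0 <= \1_`[a, b] y :> R by [].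
    rewrite normrM (ger0_norm (pkernel_ge0 (y - x) e0)) (ger0_norm i0).
    exact: (ler_wpM2r i0 (pkernel_le (y - x) e0)).
apply: eq_cintegral => y; rewrite [LHS]mulrCA.
by rewrite -(rmorphM (real_complex R)) [X in (X)%:C]mulrC.
Qed.

(** Testing on intervals moves the average onto the indicator, whose Poisson integrals are bounded
    by [pi] and converge off two points. This weak form is enough to recover [f] almost
    everywhere. *)
Lemma poisson_avg_cvg f (a b : R) : a < b -> cintegrable leb f ->
  ccvg (fun n => cintegral leb (fun y => (\1_`[a, b] y)%:C * poisson_avg (harm R n) f y))
       (cintegral leb (fun x => f x * (pi * \1_`[a, b] x)%:C)).
Proof.
move=> ab if_; have mf := cintegrable_cmeasurable if_.
rewrite (_ : (fun n => _) = (fun n => cintegral leb (fun x => f x *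
  (\int[leb]_y (pkernel (harm R n) (y - x) * \1_`[a, b] y))%:C))); last first.
  by apply/funext => n; rewrite poisson_avg_itv ?harm_gt0.
apply: (@dominated_ccvg _ _ _ leb _ _ (fun x => pi * normc (f x))).
- move=> n; apply: cmeasurableM => //; apply: cmeasurable_real.
  rewrite (_ : (fun x => _) = (fun x => atan ((harm R n)^-1 * (b - x)) -
    atan ((harm R n)^-1 * (a - x)))); last first.
    by apply/funext => x; rewrite integral_pkernel_itv ?harm_gt0.
  have mA (c : R) : measurable_fun setT (fun x : T => atan ((harm R n)^-1 * (c - x))).
    apply: (@measurableT_comp _ _ _ _ _ _ (@atan R : T -> T)).
      by apply: continuous_measurableR => x; exact: continuous_atan.
    by apply: measurable_funM => //; exact: measurable_funB.
  by apply: measurable_funB.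
- apply: cmeasurableM => //; apply: cmeasurable_real.
  by apply: measurable_funM => //; exact: measurable_indic.
- by apply: integrable_scale; exact: cintegrable_normc.
- apply: aeW => x n; rewrite normcM normc_real mulrC ler_wpM2r ?normc_ge0//.
  exact: poisson_itv_bounded.
- have ne c : {ae leb, forall x : T, x != c :> R}.
    exists [set c]; split; first exact: measurable_set1.
      exact: lebesgue_measure_set1.
    by move=> x /= /negP; rewrite negbK => /eqP.
  apply: filterS2 (ne a) (ne b) => x xa xb.
  by apply: ccvgM; [exact: ccvg_cst|apply: ccvg_real; exact: poisson_itv_cvg].
Qed.

Lemma fourier_inj f : cintegrable leb f -> (forall w, fourierL1 f w = 0) ->
  aeeq leb f (fun=> 0).
Proof.
move=> if_ f0; have mf := cintegrable_cmeasurable if_.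
have P0 n y : poisson_avg (harm R n) f y = 0.
  have := fourier_poisson y (harm_gt0 R n) if_.
  under eq_cintegral do rewrite f0 mulr0.
  rewrite cintegral0 => /esym/eqP; rewrite mulf_eq0 pnatr_eq0 /=.
  by move=> /eqP.
have if1 (a b : R) : cintegrable leb (fun x => f x * (\1_`[a, b] x)%:C).
  under eq_fun do rewrite mulrC.
  apply: (cintegrable_bounded (M := 1)) => //; first exact: cmeasurable_indic.
  by move=> x; rewrite normc_real indicE; case: (_ \in _); rewrite ?normr1 ?normr0.
apply: cintegral_itv_ae0 => // a b ab.
have := poisson_avg_cvg ab if_.
under eq_fun => n do under eq_cintegral do rewrite P0 mulr0.
under eq_fun => n do rewrite cintegral0.
move=> /(ccvg_unique (ccvg_cst 0)).
under eq_cintegral do rewrite rmorphM/= mulrCA.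
rewrite cintegralZ// => /esym/eqP; rewrite mulf_eq0 => /orP[/eqP[/eqP]|/eqP//].
by rewrite gt_eqF// pi_gt0.
Qed.

End FourierTransform.

(** * Bessel's inequality with an Abel weight *)

Section Bessel.
Context (R : realType).
Local Notation leb := (@lebesgue_measure R).
Local Notation T := (measurableTypeR R).

Lemma poisson_l1 (e : R) (g : T -> R) : 0 < e -> (forall x, 0 <= g x) ->
  leb.-integrable setT (EFin \o g) ->
  leb.-integrable setT (EFin \o (fun x => \int[leb]_y (pkernel e (x - y) * g y))) /\
  \int[leb]_x (\int[leb]_y (pkernel e (x - y) * g y)) = pi * \int[leb]_x g x.
Proof.
move=> e0 g0 ig; have mg := integrable_measurable ig.
pose k (p : T * T) := pkernel e (p.1 - p.2) * g p.2.
have mk : measurable_fun setT k.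
  apply: measurable_funM; first exact: measurable_pkernel2.
  by apply: (measurableT_comp mg); exact: measurable_snd.
have k0 p : 0 <= k p by rewrite mulr_ge0// pkernel_ge0.
have mk' : measurable_fun setT (EFin \o k) by exact/measurable_EFinP.
have kx (y : T) : (\int[leb]_x (k (x, y))%:E = (pi * g y)%:E)%E.
  have [ip1 ip2] := integrable_pkernel y e0.
  rewrite mulrC -ip2 -RintegralZl// /Rintegral fineK.
    by apply: eq_integral => x _; rewrite mulrC.
  by apply: integrable_fin_num => //; exact: integrable_scale.
have ik : (leb \x leb)%E.-integrable setT (EFin \o k).
  apply/integrable21ltyP => //.
  under eq_integral => y _.
    rewrite (_ : (\int[leb]_x _ = (pi * g y)%:E)%E); last first.
      by rewrite -kx; apply: eq_integral => x _; rewrite gee0_abs// lee_fin.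
    over.
  by apply: integrable_lty => //; exact: integrable_scale.
have sec (x : T) : (\int[leb]_y (k (x, y))%:E)%E = (\int[leb]_y k (x, y))%:E.
  rewrite /Rintegral fineK//; apply: integrable_fin_num => //.
  apply: (@integrable_le _ _ _ _ _ (fun y => e^-1 * g y)).
  - exact: (measurableT_comp mk (pair1_measurable x)).
  - exact: integrable_scale.
  - by move=> y; rewrite ger0_norm// ler_wpM2r// pkernel_le.
have iF : leb.-integrable setT (EFin \o (fun x => \int[leb]_y k (x, y))).
  by have := integrable_fubini_F ik; apply: eq_integrable => // x _; exact: sec.
split => //; have h := Fubini ik.
rewrite -RintegralZl// [LHS]/Rintegral [RHS]/Rintegral; congr fine.
under eq_integral do rewrite -sec.
by rewrite h; apply: eq_integral => y _; rewrite kx.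
Qed.

Lemma cmeasurable_poisson_avg (e : R) (f : T -> R[i]) : 0 < e -> cintegrable leb f ->
  cmeasurable (poisson_avg e f).
Proof.
move=> e0 if_; have mf := cintegrable_cmeasurable if_.
have ip : cintegrable leb (fun w : T => (pweight 1 w)%:C : R[i]).
  by apply: cintegrable_real; exact: integrable_pweight.
have mp := cintegrable_cmeasurable ip.
have dom (y x : T) : normc ((pweight 1 y)%:C * (f x * (pkernel e (y - x))%:C)) <=
    pweight 1 y * (e^-1 * normc (f x)).
  rewrite !normcM (normc_real (pweight 1 y)) (gtr0_norm (pweight_gt0 1 y)).
  rewrite ler_wpM2l ?(ltW (pweight_gt0 _ _))// mulrC.
  exact: (ler_wpM2r (normc_ge0 _) (normc_pkernel _ e0)).
have /cintegrable_cmeasurable := @cintegrable_fubini1 _ _ _ _ _ leb leb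
  (fun p => (pweight 1 p.1)%:C * (f p.2 * (pkernel e (p.1 - p.2))%:C)) _ _
  (cmeasurable_poisson_integrand e0 mf mp) (integrable_pweight ltr01)
  (integrable_scale e^-1 (cintegrable_normc if_)) dom => h.
have {h} := cmeasurableM (cmeasurableV mp) h; apply: cmeasurable_eq => w /=.
rewrite cintegralZ; last exact: (cintegrable_poisson w e0 if_).
rewrite mulrA mulVf ?mul1r//; apply/eqP => -[/eqP].
by rewrite gt_eqF// pweight_gt0.
Qed.

(** The multiplication formula with the conjugate of the weighted transform as test function turns
    the weighted energy into twice the pairing of [f] with the conjugate of its Poisson average,
    which is a quadratic form with a kernel of mass [pi]. *)
Lemma bessel_weighted (e : R) (f : T -> R[i]) : 0 < e ->
  cintegrable leb f -> sqi leb f ->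
  leb.-integrable setT (EFin \o (fun w => pweight e w * normc (fourierL1 f w) ^+ 2)) /\
  \int[leb]_w (pweight e w * normc (fourierL1 f w) ^+ 2) <= 4 * pi * nrm2 leb f.
Proof.
move=> e0 if_ hf; have mf := cintegrable_cmeasurable if_.
have mF := cmeasurable_fourierL1 if_.
have ipw := integrable_pweight e0.
pose C := \int[leb]_x normc (f x).
have ipF : cintegrable leb (fun w => ((pweight e w)%:C * fourierL1 f w)^*).
  apply: cintegrable_conj; under eq_fun do rewrite mulrC.
  apply: (cintegrable_bounded (M := C)) => //; first by move=> w; exact: fourierL1_bounded.
  exact: cintegrable_real.
have EI w : ((pweight e w)%:C * fourierL1 f w)^* * fourierL1 f w =
    (pweight e w * normc (fourierL1 f w) ^+ 2)%:C.
  rewrite conjcM -mulrA [_^* * fourierL1 f w]mulrC mulc_conj conjc_realc.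
  by rewrite -(rmorphM (real_complex R)).
have iI : leb.-integrable setT (EFin \o (fun w => pweight e w * normc (fourierL1 f w) ^+ 2)).
  have : cintegrable leb (fun w => fourierL1 f w * ((pweight e w)%:C * fourierL1 f w)^*).
    by apply: (cintegrable_bounded (M := C)) => // w; exact: fourierL1_bounded.
  by under eq_fun do rewrite mulrC EI; case.
split => //.
have key := multiplication_formula if_ ipF.
rewrite (eq_cintegral _ EI) cintegral_real in key.
have Ex (x : T) : cintegral leb (fun w => ((pweight e w)%:C * fourierL1 f w)^* *
    expi (- (w * x))) = (2 * poisson_avg e f x)^*.
  rewrite -fourier_poisson// -cintegral_conj; last first.
    under eq_fun do rewrite mulrC.
    apply: (cintegrable_bounded (M := C)) => //; first by move=> w; exact: fourierL1_bounded.
    apply: cintegrable_expiM; first exact: measurable_mulr.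
    exact: cintegrable_real.
  by apply: eq_cintegral => w; rewrite -expi_conj -conjcM; congr (_^*); ring.
rewrite (eq_cintegral _ (fun x => congr1 (fun z => f x * z) (Ex x))) in key.
set I := \int[leb]_w _ in key *.
have I0 : 0 <= I.
  by apply: Rintegral_ge0 => w _; rewrite mulr_ge0 ?sqr_ge0// ltW// pweight_gt0.
have -> : I = normc I%:C by rewrite normc_real ger0_norm.
rewrite key.
case: hf => _ isf.
(* Pointwise [|f x| |f y| <= |f x|^2 + |f y|^2]; this crude bound is why the constant is [4 pi] and
   not the Plancherel value [2 pi]. *)
pose v x := pi * normc (f x) ^+ 2 + \int[leb]_y (pkernel e (x - y) * normc (f y) ^+ 2).
have [iv1 iv2] := poisson_l1 e0 (fun x => sqr_ge0 (normc (f x))) isf.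
have iv : leb.-integrable setT (EFin \o v).
  by apply: integrable_add => //; exact: integrable_scale.
have fv x : normc (f x * (2 * poisson_avg e f x)^*) <= 2 * v x.
  rewrite normcM normc_conj normcM.
  have -> : normc (2 : R[i]) = 2 by rewrite -(rmorph_nat (real_complex R) 2) normc_real ger0_norm.
  rewrite mulrCA ler_wpM2l//.
  apply: (@le_trans _ _ (normc (f x) * \int[leb]_y (normc (f y) * pkernel e (x - y)))).
    rewrite ler_wpM2l ?normc_ge0//.
    apply: (le_trans (le_normc_cintegral (cintegrable_poisson x e0 if_))).
    rewrite le_eqVlt; apply/orP; left; apply/eqP; apply: eq_Rintegral => y _.
    by rewrite normcM normc_real ger0_norm// pkernel_ge0.
  have [ip1 ip2] := integrable_pkernel x e0.
  have is1 : leb.-integrable setT (EFin \o (fun y : T => pkernel e (x - y))).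
    move: ip1; apply: eq_integrable => // y _ /=.
    by rewrite -pkernelN opprB.
  have is2 : leb.-integrable setT (EFin \o (fun y : T => pkernel e (x - y) * normc (f y) ^+ 2)).
    apply: (@integrable_le _ _ _ _ _ (fun y => e^-1 * normc (f y) ^+ 2)).
    - by apply: measurable_funM;
        [exact: measurable_pkernel_section|exact: measurable_sqr_normc].
    - exact: integrable_scale.
    - move=> y; rewrite ger0_norm; last first.
        by apply: mulr_ge0; [exact: pkernel_ge0|exact: sqr_ge0].
      exact: (ler_wpM2r (sqr_ge0 _) (pkernel_le _ e0)).
  rewrite [leRHS](_ : _ = \int[leb]_y (normc (f x) ^+ 2 * pkernel e (x - y) +
      pkernel e (x - y) * normc (f y) ^+ 2)); last first.
    rewrite RintegralD//; last exact: integrable_scale.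
    rewrite RintegralZl// /v mulrC; congr (_ * _ + _).
    by rewrite -ip2; apply: eq_Rintegral => y _; rewrite -pkernelN opprB.
  have is3 : leb.-integrable setT (EFin \o (fun y : T => normc (f y) * pkernel e (x - y))).
    have [+ _] := cintegrable_poisson x e0 (cintegrable_real (cintegrable_normc if_)).
    by apply: eq_integrable => // y _ /=; rewrite mul0r subr0.
  rewrite -RintegralZl//; apply: le_Rintegral => //.
  - exact: integrable_scale.
  - by apply: integrable_add => //; exact: integrable_scale.
  - move=> y _; rewrite [normc (f y) * _]mulrC mulrCA [normc (f x) ^+ 2 * _]mulrC -mulrDr.
    rewrite ler_wpM2l ?pkernel_ge0//.
    have : 0 <= (normc (f x) - normc (f y)) ^+ 2 by exact: sqr_ge0.
    have := normc_ge0 (f x); have := normc_ge0 (f y); nra.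
have ifP : cintegrable leb (fun x => f x * (2 * poisson_avg e f x)^*).
  apply: (@cintegrable_le _ _ _ _ _ (fun x => 2 * v x)) => //.
  - apply: cmeasurableM => //; apply: cmeasurable_conj.
    apply: cmeasurableM; first exact: cmeasurable_cst.
    exact: cmeasurable_poisson_avg.
  - exact: integrable_scale.
apply: (le_trans (le_normc_cintegral ifP)).
apply: (@le_trans _ _ (\int[leb]_x (2 * v x))).
  apply: le_Rintegral => //; first exact: cintegrable_normc.
  exact: integrable_scale.
rewrite RintegralZl// /v RintegralD//; last exact: integrable_scale.
rewrite RintegralZl// iv2 /nrm2 le_eqVlt; apply/orP; left; apply/eqP; ring.
Qed.

End Bessel.

(** * The Hardy space in terms of Cauchy kernels *)

Section HardySpace.
Context (R : realType).
Local Notation leb := (@lebesgue_measure R).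
Local Notation T := (measurableTypeR R).
Implicit Types (f g k : T -> R[i]).

(** The weighted bound is uniform in the height, so Fatou removes the weight. *)
Lemma bessel f : cintegrable leb f -> sqi leb f ->
  sqi leb (fourierL1 f) /\ nrm2 leb (fourierL1 f) <= 4 * pi * nrm2 leb f.
Proof.
move=> if_ hf; have mF := cmeasurable_fourierL1 if_.
(* The factor one half is undone by squaring, which leaves a weight below [pweight]. *)
pose E n (w : T) : R := expR (- (2^-1 * (harm R n * `|w|))).
have mE n : measurable_fun setT (E n).
  apply: (measurableT_comp (@measurable_expR R)); apply: measurable_funN.
  apply: measurable_funM; first exact: measurable_cst.
  apply: measurable_funM; first exact: measurable_cst.
  exact: normr_measurable.
have EE n (w : T) : normc ((E n w)%:C * fourierL1 f w) ^+ 2 =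
    expR (- (harm R n * `|w|)) * normc (fourierL1 f w) ^+ 2.
  rewrite normcM (normc_real (E n w)) gtr0_norm ?expR_gt0// exprMn -expRM_natl.
  by congr (expR _ * _); field.
have bw n := bessel_weighted (harm_gt0 R n) if_ hf.
have le_pw n (w : T) : normc ((E n w)%:C * fourierL1 f w) ^+ 2 <=
    pweight (harm R n) w * normc (fourierL1 f w) ^+ 2.
  by rewrite EE; apply: ler_wpM2r; [exact: sqr_ge0|exact: expR_le_pweight].
have sE n : sqi leb (fun w => (E n w)%:C * fourierL1 f w).
  apply: (@sqi_le _ _ _ leb _ (fun w => pweight (harm R n) w * normc (fourierL1 f w) ^+ 2)).
  - by apply: cmeasurableM => //; exact: cmeasurable_real.
  - exact: (bw n).1.
  - by apply: aeW => w; exact: le_pw.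
apply: (fatou_sqi sE) => //.
- apply: aeW => w; rewrite -[X in ccvg _ X]mul1r; apply: ccvgM; last exact: ccvg_cst.
  apply: (@ccvg_real _ _ 1).
  have h : (fun n => - (2^-1 * (harm R n * `|w|))) @ \oo --> (0 : R).
    rewrite -[X in _ --> X]oppr0 -(mulr0 2^-1) -(mul0r `|w|); apply: cvgN.
    apply: cvgM; first exact: cvg_cst.
    by apply: cvgM; [exact: harm_cvg0|exact: cvg_cst].
  rewrite -(@expR0 R); exact: (cvg_comp _ _ h (@continuous_expR R 0)).
- move=> n; have [_ isE] := sE n; apply: le_trans (bw n).2.
  by apply: le_Rintegral => //; exact: (bw n).1.
Qed.

Lemma fourierL1B f g (w : R) : cintegrable leb f -> cintegrable leb g ->
  fourierL1 (fun x => f x - g x) w = fourierL1 f w - fourierL1 g w.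
Proof.
move=> if_ ig; rewrite /fourierL1 -cintegralB.
- by apply: eq_cintegral => x; rewrite mulrBl.
- by apply: cintegrable_expiM => //; apply: measurable_funN; exact: measurable_funM.
- by apply: cintegrable_expiM => //; apply: measurable_funN; exact: measurable_funM.
Qed.

Lemma truncE n f x : trunc n f x = f x * (\1_`[- n%:R : R, n%:R] x)%:C.
Proof.
rewrite /trunc indicE mem_setE in_itv /= -ler_norml.
by case: ifP => _; rewrite ?mulr1 ?mulr0.
Qed.

Lemma sqi_trunc n f : sqi leb f -> sqi leb (trunc n f).
Proof.
move=> hf; rewrite (_ : trunc n f = (fun x => (\1_`[- n%:R : R, n%:R] x)%:C * f x)); last first.
  by apply/funext => x; rewrite truncE mulrC.
apply: (sqi_ae_bounded (M := 1)) => //; first exact: cmeasurable_indic.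
apply: aeW => x; rewrite normc_real indicE.
by case: (_ \in _); rewrite ?normr1 ?normr0.
Qed.

Lemma cintegrable_trunc n f : sqi leb f -> cintegrable leb (trunc n f).
Proof.
move=> hf; rewrite (_ : trunc n f = (fun x => f x * (\1_`[- n%:R : R, n%:R] x)%:C)).
  exact: sqi_cintegrable_itv.
by apply/funext => x; rewrite truncE.
Qed.

Lemma l2cvg_dominated (fs : nat -> T -> R[i]) f g :
  (forall n, sqi leb (fs n)) -> sqi leb f -> sqi leb g ->
  (forall n x, normc (fs n x - f x) <= normc (g x)) ->
  {ae leb, forall x, ccvg (fs ^~ x) (f x)} -> l2cvg leb fs f.
Proof.
move=> hfs hf [mg ig] dom cf.
rewrite /l2cvg /nrm2 -[X in _ --> X](_ : \int[leb]_x (cst 0 x : R) = 0); last first.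
  by rewrite /Rintegral integral0.
apply: (@dominated_cvg_Rintegral _ _ _ leb (fun n x => normc (fs n x - f x) ^+ 2)
  (cst 0) (fun x => normc (g x) ^+ 2)) => //.
- by move=> n; apply: measurable_sqr_normc; have [] := sqiB (hfs n) hf.
- apply: aeW => x n; rewrite ger0_norm ?sqr_ge0//.
  by rewrite ler_sqr ?nnegrE ?normc_ge0.
- apply: filterS cf => x cx; have /ccvg_normc := ccvgB cx (ccvg_cst (f x)).
  rewrite subrr normc0 => h; rewrite /= -(mulr0 (0 : R)).
  by under eq_fun do rewrite expr2; exact: cvgM.
Qed.

Lemma trunc_cvg f : sqi leb f -> l2cvg leb (fun n => trunc n f) f.
Proof.
move=> hf; apply: (l2cvg_dominated (fun n => sqi_trunc n hf) hf hf).
- move=> n x; rewrite /trunc; case: ifP => _; first by rewrite subrr normc0 normc_ge0.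
  by rewrite sub0r normc_opp.
- apply: aeW => x.
  have ev : \forall n \near \oo, trunc n f x = f x.
    exists (Num.Def.truncn `|x|).+1 => // n /= hn; rewrite /trunc ifT//.
    have /andP[_ h] := truncn_itv (normr_ge0 x).
    by rewrite (le_trans (ltW h))// ler_nat.
  by split; apply: cvg_near_cst; apply: filterS ev => n ->.
Qed.

(** Bessel carries the Cauchy property from the truncations to their transforms, and completeness
    supplies the limit. *)
Lemma fourierL2_exists f : sqi leb f -> exists F, is_fourierL2 f F.
Proof.
move=> hf.
have sF n : sqi leb (fourierL1 (trunc n f)).
  exact: (bessel (cintegrable_trunc n hf) (sqi_trunc n hf)).1.
have cau : l2cauchy leb (fun n => fourierL1 (trunc n f)).
  move=> e e0; have p0 := pi_gt0 R.
  have e1 : 0 < e / (4 * pi) by rewrite divr_gt0// mulr_gt0.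
  have [N HN] := l2cvg_l2cauchy (fun n => sqi_trunc n hf) hf (trunc_cvg hf) e1.
  exists N => m n Nm Nn.
  rewrite (_ : (fun x => _) = fourierL1 (fun x => trunc m f x - trunc n f x)); last first.
    by apply/funext => w; rewrite fourierL1B//; exact: cintegrable_trunc.
  apply: (le_trans (bessel _ _).2).
  - by apply: cintegrableB; exact: cintegrable_trunc.
  - by apply: sqiB; exact: sqi_trunc.
  - have := HN m n Nm Nn; rewrite ler_pdivlMr ?mulr_gt0//.
    by rewrite mulrC.
have [F [s [hF cF _ _]]] := riesz_fischer sF cau.
exists F; split; first exact/memL2P.
by apply/l2cvg_L2norm.
Qed.

Definition lower_char (a : R[i]) (w : T) : R[i] :=
  kexp ('i * a) w * (\1_[set x : R | x <= 0] w)%:C.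

Lemma sqi_lower_char (a : R[i]) : complex.Im a < 0 -> sqi leb (lower_char a).
Proof.
move=> a0; have [_ mL _ _] := exhausts_left R.
have c0 : 2 * - complex.Im a != 0 by rewrite mulf_neq0// oppr_eq0 lt_eqF.
apply: (@sqi_le _ _ _ leb _ (fun w : T =>
  expR (2 * - complex.Im a * w) * \1_[set x : R | x <= 0] w)).
- apply: cmeasurableM; first exact: cmeasurable_kexp.
  exact: cmeasurable_indic.
- apply: (integrable_exp_exhausts c0 (exhausts_left R)) => x /= x0.
  by rewrite -mulrA mulr_ge0_le0// mulr_ge0_le0// oppr_ge0 ltW.
- apply: aeW => w; rewrite /lower_char normcM normc_kexp exprMn -expRM_natl.
  rewrite normc_real ReM /= mul0r mul1r sub0r mulrA.
  apply: ler_wpM2l; first exact: expR_ge0.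
  by rewrite indicE; case: (_ \in _); rewrite ?normr1 ?normr0 ?expr1n ?expr0n.
Qed.

(** For truncations this is the multiplication formula with the transform of [lower_char a]; both
    sides are continuous in L_2. *)
Lemma fourierL2_ckernel f F (a : R[i]) : complex.Im a < 0 -> sqi leb f ->
  is_fourierL2 f F ->
  cintegral leb (fun w => F w * lower_char a w) =
  'i * cintegral leb (fun x => f x * ckernel a x).
Proof.
move=> a0 hf [/memL2P hF cF].
have sF n : sqi leb (fourierL1 (trunc n f)).
  exact: (bessel (cintegrable_trunc n hf) (sqi_trunc n hf)).1.
have cF' : l2cvg leb (fun n => fourierL1 (trunc n f)) F by apply/l2cvg_L2norm.
have c1 := l2cvg_cintegralM sF hF (sqi_lower_char a0) cF'.
have sk : sqi leb (ckernel a) by apply: sqi_ckernel; rewrite lt_eqF.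
have c2 := ccvgM (ccvg_cst 'i)
  (l2cvg_cintegralM (fun n => sqi_trunc n hf) hf sk (trunc_cvg hf)).
apply: (ccvg_unique c1); move: c2; congr (ccvg _ _); apply/funext => n.
have ia : cintegrable leb (lower_char a) by exact: (cfourier_left 0 a0).1.
transitivity (cintegral leb (fun w => lower_char a w * fourierL1 (trunc n f) w)); last first.
  by apply: eq_cintegral => w; rewrite mulrC.
rewrite (multiplication_formula (cintegrable_trunc n hf) ia) -cintegralZ; last first.
  by apply: cintegrableM => //; exact: sqi_trunc.
by apply: eq_cintegral => x; rewrite (cfourier_left x a0).2 mulrCA.
Qed.

(** Vanishing of the Cauchy integral throughout the lower half-plane. The pairing is bilinear, which
    makes the condition stable under multiplication by Hardy multipliers. *)
Definition cauchy_null : set (T -> R[i]) :=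
  [set k | sqi leb k /\ forall a : R[i], complex.Im a < 0 ->
    cintegral leb (fun x => k x * ckernel a x) = 0].

Lemma ae_neq (c : R) : {ae leb, forall x : T, x != c :> R}.
Proof.
exists [set c]; split; first exact: measurable_set1.
  exact: lebesgue_measure_set1.
by move=> x /= /negP; rewrite negbK => /eqP.
Qed.

Lemma hardy_plusE : @hardy_plus R = cauchy_null.
Proof.
apply/seteqP; split => f /=.
- move=> [/memL2P hf [F hF F0]]; split => // a a0.
  have := fourierL2_ckernel a0 hf hF.
  have [/memL2P sF _] := hF; have sl := sqi_lower_char a0.
  rewrite (@ae_eq_cintegral _ _ _ leb _ (fun=> 0)).
  + rewrite cintegral0 => /esym/eqP; rewrite mulf_eq0 => /orP[|/eqP//].
    by rewrite eq_complex /= oner_eq0 andbF.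
  + exact: (cintegrable_cmeasurable (cintegrableM sF sl)).
  + exact: cmeasurable_cst.
  (* At [w = 0] the half-line character does not vanish and nothing is known about [F]; that point
     is discarded as a null set. *)
  + move: F0 (ae_neq 0); apply: filterS2; first exact: (ae_filter_ringOfSetsType leb).
    move=> w Fw w0.
    have [wn|wp] := ltP w 0; first by rewrite Fw// mul0r.
    rewrite /lower_char (indic_mkset (fun x => x <= 0)).
    by rewrite leNgt lt_neqAle eq_sym w0 wp /= !mulr0.
- move=> [hf h0]; split; first exact/memL2P.
  have [F hF] := fourierL2_exists hf; exists F => //.
  have [/memL2P sF _] := hF.
  (* Moving the pole along a horizontal line modulates [lower_char] by a character, so all
     conditions together say that the integrable function [F * lower_char (a 0)] has zero Fourier
     transform. *)
  pose a (t : R) : R[i] := (- t) +i* (- 1).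
  have a0 t : complex.Im (a t) < 0 by rewrite /= oppr_lt0.
  have Ea t : 'i * a t = 'i * a 0 + (0 -i* t).
    by apply: complexP => /=; ring.
  have iL := cintegrableM sF (sqi_lower_char (a0 0)).
  have L0 : aeeq leb (fun w => F w * lower_char (a 0) w) (fun=> 0).
    apply: fourier_inj => // t; rewrite /fourierL1.
    have := fourierL2_ckernel (a0 t) hf hF.
    rewrite (h0 _ (a0 t)) mulr0 => <-; apply: eq_cintegral => w.
    rewrite -mulrA; congr (_ * _); rewrite /lower_char mulrAC; congr (_ * _).
    by rewrite (Ea t) kexpD -expi_kexp [(w * t)%R]mulrC.
  apply: filterS L0 => w + w0.
  rewrite /lower_char (indic_mkset (fun x => x <= 0)) ltW//= mulr1.
  move=> /eqP; rewrite mulf_eq0 => /orP[/eqP//|].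
  by rewrite -normc_eq0 normc_kexp gt_eqF// expR_gt0.
Qed.

End HardySpace.

(** * Cauchy kernels with poles in the lower half-plane are mutually null *)

Section CauchyKernelOrthogonality.
Context (R : realType).
Local Notation leb := (@lebesgue_measure R).
Local Notation T := (measurableTypeR R).
Implicit Types (a b : R[i]) (x : R).

Lemma ckernelB a b x : complex.Im a != 0 -> complex.Im b != 0 ->
  ckernel a x - ckernel b x = (a - b) * (ckernel a x * ckernel b x).
Proof.
move=> a0 b0; rewrite /ckernel.
have ha := sub_real_neq0 x a0; have hb := sub_real_neq0 x b0.
by field; rewrite ha hb.
Qed.

Lemma Re_ckernel a x : complex.Re (ckernel a x) =
  (x - complex.Re a) / ((x - complex.Re a) ^+ 2 + complex.Im a ^+ 2).
Proof. by rewrite ReV sqr_normcE !(ReD, ImD, ReN, ImN) /= add0r sqrrN. Qed.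

Lemma Im_ckernel a x : complex.Im a < 0 -> complex.Im (ckernel a x) =
  - pkernel (- complex.Im a) (x - complex.Re a).
Proof.
move=> a0; rewrite ImV sqr_normcE !(ReD, ImD, ReN, ImN) /= add0r sqrrN opprK /pkernel.
by rewrite sqrrN addrC mulNr opprK.
Qed.

Lemma is_derive_half_ln (al be x : R) : be != 0 ->
  is_derive x (1 : R) (fun y => 2^-1 * ln ((y - al) ^+ 2 + be ^+ 2))
    ((x - al) / ((x - al) ^+ 2 + be ^+ 2)).
Proof.
move=> b0; have q0 : 0 < (x - al) ^+ 2 + be ^+ 2.
  by rewrite ltr_wpDl ?sqr_ge0// exprn_even_gt0.
have h1 : is_derive x (1 : R) (fun y => (y - al) ^+ 2 + be ^+ 2) (2 * (x - al)).
  have hy : is_derive x (1 : R) (fun y : R => y - al) 1.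
    by apply: is_derive_eq; rewrite subr0.
  have -> : (fun y : R => (y - al) ^+ 2 + be ^+ 2) =
      (fun y => 1 * ((y - al) * (y - al)) + be ^+ 2 * 1).
    by apply/funext => y; rewrite expr2 mul1r mulr1.
  have hc : is_derive x (1 : R) (fun _ : R => (1 : R)) 0 by exact: is_derive_cst.
  apply: (is_derive_eq (is_derive_lin 1 (be ^+ 2) (is_derive_prod hy hy) hc)).
  by ring.
have h2 := @is_derive_comp _ (@ln R) (fun y => (y - al) ^+ 2 + be ^+ 2) _ _ _
  (is_derive1_ln q0) h1.
apply: (is_derive_eq (is_deriveZ 2^-1 h2)); rewrite /GRing.scale/=.
by field; rewrite gt_eqF.
Qed.

(** Subtracting the common growth gives each logarithm its own limit; [s] is 1 or -1 for the two
    ends of the line. *)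
Lemma cvg_ln_quadratic (al be s : R) : s ^+ 2 = 1 -> be != 0 ->
  (fun n => ln ((s * n.+1%:R - al) ^+ 2 + be ^+ 2) - ln (n.+1%:R ^+ 2)) @ \oo --> (0 : R).
Proof.
move=> s1 b0.
rewrite (_ : (fun n => _) = (fun n => ln ((s - al * harm R n) ^+ 2 + (be * harm R n) ^+ 2))).
  have h : (fun n => (s - al * harm R n) ^+ 2 + (be * harm R n) ^+ 2) @ \oo --> (1 : R).
    have -> : 1 = (s - al * 0) ^+ 2 + (be * 0) ^+ 2 :> R.
      by rewrite !mulr0 subr0 s1 expr0n addr0.
    have hM (c : R) : (fun n => c * harm R n) @ \oo --> c * 0.
      by apply: cvgM; [exact: cvg_cst|exact: harm_cvg0].
    by apply: cvgD; rewrite expr2; under eq_fun do rewrite expr2; apply: cvgM;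
      by [exact: hM|apply: cvgB; [exact: cvg_cst|exact: hM]].
  by rewrite -(@ln1 R); exact: (cvg_comp _ _ h (continuous_ln ltr01)).
apply/funext => n; have n0 : (n.+1%:R : R) != 0 by rewrite pnatr_eq0.
rewrite -ln_div ?posrE ?exprn_gt0//; last first.
  by rewrite ltr_wpDl ?sqr_ge0// exprn_even_gt0.
by congr ln; rewrite /harm; field.
Qed.

(** Partial fractions reduce the product to a difference of kernels. Its real part has a logarithmic
    antiderivative whose boundary terms cancel; its imaginary part is a difference of two Poisson
    kernels of the same mass. *)
Lemma ckernel_orth a b : complex.Im a < 0 -> complex.Im b < 0 -> a != b ->
  cintegral leb (fun x => ckernel a x * ckernel b x) = 0.
Proof.
move=> a0 b0 ab; have an0 : complex.Im a != 0 by rewrite lt_eqF.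
have bn0 : complex.Im b != 0 by rewrite lt_eqF.
have iab := cintegrableM (sqi_ckernel an0) (sqi_ckernel bn0).
apply: (@mulfI _ (a - b)); first by rewrite subr_eq0.
rewrite mulr0 -cintegralZ//.
have iD := cintegrableZ (a - b) iab.
have ED : (fun x => (a - b) * (ckernel a x * ckernel b x)) =
    (fun x : T => ckernel a x - ckernel b x).
  by apply/funext => x; rewrite ckernelB.
rewrite ED in iD *; have [iDr iDi] := iD.
apply: complexP => /=.
- have E : (fun x : T => complex.Re (ckernel a x - ckernel b x)) =
      (fun x : T => ((x - complex.Re a) / ((x - complex.Re a) ^+ 2 + complex.Im a ^+ 2) -
        (x - complex.Re b) / ((x - complex.Re b) ^+ 2 + complex.Im b ^+ 2)) * \1_[set: R] x).
    by apply/funext => x; rewrite ReD ReN !Re_ckernel indicE in_setT mulr1.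
  rewrite E in iDr *.
  pose q (c : R[i]) (y : R) := 2^-1 * ln ((y - complex.Re c) ^+ 2 + complex.Im c ^+ 2).
  apply: (ftc_exhausts (F := fun y => q a y - q b y) (exhausts_line R)) => //.
  + have hc (c : R[i]) : complex.Im c != 0 ->
      continuous (fun x : R => (x - complex.Re c) / ((x - complex.Re c) ^+ 2 + complex.Im c ^+ 2)).
      move=> c0 x; have hx : (fun y : R => y - complex.Re c) y @[y --> x] --> x - complex.Re c.
        by apply: cvgB; [exact: cvg_id|exact: cvg_cst].
      apply: cvgM => //; apply: cvgV.
        by rewrite gt_eqF// ltr_wpDl ?sqr_ge0// exprn_even_gt0.
      apply: cvgD; last exact: cvg_cst.
      by rewrite expr2; under eq_fun do rewrite expr2; exact: cvgM.
    by move=> x; exact: (cvgB (hc a an0 x) (hc b bn0 x)).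
  + move=> x; exact: (is_deriveB (is_derive_half_ln (complex.Re a) x an0)
      (is_derive_half_ln (complex.Re b) x bn0)).
  + have lq (c : R[i]) (s : R) : s ^+ 2 = 1 -> complex.Im c != 0 ->
        (fun n => q c (s * n.+1%:R) - 2^-1 * ln (n.+1%:R ^+ 2)) @ \oo --> (0 : R).
      move=> s1 c0; rewrite -(mulr0 2^-1) /q; under eq_fun do rewrite -mulrBr.
      by apply: cvgM; [exact: cvg_cst|exact: cvg_ln_quadratic].
    have o1 : (1 : R) ^+ 2 = 1 by rewrite expr1n.
    have m1 : (-1 : R) ^+ 2 = 1 by rewrite sqrrN expr1n.
    have h := cvgB (cvgB (lq a _ o1 an0) (lq b _ o1 bn0)) (cvgB (lq a _ m1 an0) (lq b _ m1 bn0)).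
    have : (fun n => (q a n.+1%:R - q b n.+1%:R) - (q a (- n.+1%:R) - q b (- n.+1%:R))) @ \oo --> (0 : R).
      rewrite !subr0 in h; rewrite (_ : (fun n => _) = (fun n =>
        (q a (1 * n.+1%:R) - 2^-1 * ln (n.+1%:R ^+ 2) - (q b (1 * n.+1%:R) - 2^-1 * ln (n.+1%:R ^+ 2))) -
        (q a (-1 * n.+1%:R) - 2^-1 * ln (n.+1%:R ^+ 2) - (q b (-1 * n.+1%:R) - 2^-1 * ln (n.+1%:R ^+ 2))))); first exact: h.
      by apply/funext => n; rewrite !mul1r !mulN1r; ring.
    by [].
- under eq_Rintegral do rewrite ImD ImN !Im_ckernel// opprK addrC.
  have oa : 0 < - complex.Im a by rewrite oppr_gt0.
  have ob : 0 < - complex.Im b by rewrite oppr_gt0.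
  have [ia ja] := integrable_pkernel (complex.Re a) oa.
  have [ib jb] := integrable_pkernel (complex.Re b) ob.
  by rewrite RintegralB// ja jb subrr.
Qed.

End CauchyKernelOrthogonality.

Lemma cintegrable_eq d (S : measurableType d) (R : realType)
    (mu : {measure set S -> \bar R}) (f g : S -> R[i]) :
  f =1 g -> cintegrable mu f -> cintegrable mu g.
Proof. by move=> /funext ->. Qed.

(** * The Cauchy transform at positive height *)

Section CauchyTransform.
Context (R : realType).
Local Notation leb := (@lebesgue_measure R).
Local Notation T := (measurableTypeR R).
Implicit Types (F G k : T -> R[i]) (e x t : R).

(** The first moment pays for the factor [1 + |t|] lost in [ckernel_decay], and integrability gives
    meaning to the constant term that appears when [x] is commuted past [P_+]. *)
Definition decaying F : Prop :=
  [/\ sqi leb F, cintegrable leb F & cintegrable leb (fun t : T => (t : R)%:C * F t)].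

Lemma decaying_conj F : decaying F -> decaying (fun t => (F t)^*).
Proof.
move=> [h1 h2 h3]; split; [exact: sqi_conj|exact: cintegrable_conj|].
have := cintegrable_conj h3.
by under eq_fun do rewrite conjcM conjc_realc.
Qed.

(** The Cauchy integral of [F] at the point [x + i e]. *)
Definition cauchy_tr e F (x : T) : R[i] :=
  (twopii R)^-1 * cintegral leb (fun t => F t * ckernel ((x : R) +i* e) t).

Lemma twopiiE : twopii R = (2 * pi)%:C * 'i.
Proof. by []. Qed.

Lemma realc_neq0 (x : R) : x != 0 -> x%:C != 0 :> R[i].
Proof. by rewrite -normc_eq0 normc_real normr_eq0. Qed.

Lemma pi2_neq0 : 2 * pi != 0 :> R.
Proof. by rewrite gt_eqF// mulr_gt0// pi_gt0. Qed.

Lemma twopii_neq0 : twopii R != 0.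
Proof.
rewrite twopiiE mulf_neq0//; last by rewrite eq_complex /= oner_eq0 andbF.
exact: realc_neq0 pi2_neq0.
Qed.

Lemma ckernel_swap e x t : ckernel (x +i* e) t = - ckernel (t -i* e) x.
Proof.
rewrite /ckernel -invrN; congr (_^-1).
by apply: complexP; rewrite !(ReD, ImD, ReN, ImN) /=; ring.
Qed.

(** Separates the variables as the product form of Fubini requires: growth in [t] is traded for
    square-integrable decay in [x]. *)
Lemma ckernel_decay e x t : 0 < e -> normc (ckernel (x +i* e) t) <=
  (2 + e^-1) * (1 + `|t|) * normc (ckernel 'i x).
Proof.
move=> e0; rewrite /ckernel !normcV.
set D := normc (t%:C - (x +i* e)).
have De : e <= D.
  by have := normc_ge_Im_sub (x +i* e) t; rewrite /= gtr0_norm.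
have D0 : 0 < D by apply: lt_le_trans De.
have N0 : 0 < normc (x%:C - 'i).
  by rewrite normc_gt0 sub_real_neq0//= oner_neq0.
rewrite -[leLHS]mul1r ler_pdivrMr// mulrAC ler_pdivlMr// mul1r.
have h : normc (x%:C - 'i) <= D + `|t| + (1 + e).
  have -> : x%:C - 'i = (t%:C + - (t%:C - (x +i* e))) + (0 -i* (1 + e)).
    by apply: complexP; rewrite !(ReD, ImD, ReN, ImN) /=; ring.
  apply: (le_trans (normc_add _ _)); apply: lerD.
    by apply: (le_trans (normc_add _ _)); rewrite normc_opp normc_real addrC.
  apply: (le_trans (normc_le_ReIm _)); rewrite /= normr0 add0r normrN ger0_norm//.
  by rewrite addr_ge0// ltW.
apply: (le_trans h).
have t0 := normr_ge0 t.
have h1 : 1 <= e^-1 * D by rewrite mulrC ler_pdivlMr// mul1r.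
have h2 : 1 + `|t| <= e^-1 * D * (1 + `|t|) by rewrite ler_peMl// addr_ge0.
have h3 : 0 <= D * `|t| by rewrite mulr_ge0// ltW.
rewrite [leRHS](_ : _ = 2 * D + 2 * (D * `|t|) + e^-1 * D * (1 + `|t|)); last by ring.
by lra.
Qed.

Lemma cmeasurable_cauchy_kernel e :
  cmeasurable (fun p : T * T => ckernel ((p.1 : R) +i* e) p.2).
Proof.
have h : cmeasurable (fun p : T * T => (p.2 : R)%:C - ((p.1 : R)%:C + (0 +i* e))).
  apply: cmeasurableB; first by apply: cmeasurable_real; exact: measurable_snd.
  apply: cmeasurableD; last exact: cmeasurable_cst.
  by apply: cmeasurable_real; exact: measurable_fst.
have := cmeasurableV h; apply: cmeasurable_eq => p; rewrite /ckernel.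
by congr ((_ - _)^-1); apply: complexP => /=; ring.
Qed.

Lemma Im_i_neq0 : complex.Im ('i : R[i]) != 0.
Proof. by rewrite /= oner_neq0. Qed.

Lemma cintegrable_weight F : decaying F -> cintegrable leb (fun t : T => (1 + `|t : R|)%:C * F t).
Proof.
move=> [_ h2 h3]; have [mF _] := h2.
apply: (@cintegrable_le _ _ _ leb _ (fun t : T => normc (F t) + normc ((t : R)%:C * F t))).
- apply: cmeasurableM; last exact: cintegrable_cmeasurable h2.
  apply: cmeasurable_real; apply: measurable_funD; first exact: measurable_cst.
  exact: normr_measurable.
- by apply: integrable_add; exact: cintegrable_normc.
- move=> t; rewrite !normcM !normc_real ger0_norm ?addr_ge0//.
  by rewrite mulrDl mul1r.
Qed.

(** Exchanging the integrals pairs [k] with the kernel read as a function of [x], whose pole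
    [t - i e] lies in the lower half-plane; there the defining condition of [cauchy_null]
    applies. *)
Lemma cauchy_tr_duality e F k : 0 < e -> decaying F -> sqi leb k ->
  cintegral leb (fun x => k x * cauchy_tr e F x) =
  - (twopii R)^-1 * cintegral leb (fun t => F t *
      cintegral leb (fun x => k x * ckernel ((t : R) -i* e) x)).
Proof.
move=> e0 dF sk; have [sF iF _] := dF; have iW := cintegrable_weight dF.
have iK := cintegrableM sk (sqi_ckernel Im_i_neq0).
have [mk _] := sk; have [mF _] := sF.
pose C := 2 + e^-1.
have dom (x t : T) : normc (k x * (F t * ckernel ((x : R) +i* e) t)) <=
    normc (k x * ckernel 'i x) * (C * normc ((1 + `|t : R|)%:C * F t)).
  rewrite [in leRHS]normcM normcM normcM [normc (_%:C * _)]normcM normc_real.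
  rewrite (ger0_norm (_ : 0 <= 1 + `|t : R|)) ?addr_ge0//.
  rewrite -mulrA ler_wpM2l ?normc_ge0//.
  rewrite [leRHS](_ : _ = normc (F t) * (C * (1 + `|t : R|) * normc (ckernel 'i x))); last by ring.
  exact: (ler_wpM2l (normc_ge0 _) (ckernel_decay x t e0)).
have mI : cmeasurable (fun p : T * T => k p.1 * (F p.2 * ckernel ((p.1 : R) +i* e) p.2)).
  apply: cmeasurableM; first exact: cmeasurable_fst.
  by apply: cmeasurableM; [exact: cmeasurable_snd|exact: cmeasurable_cauchy_kernel].
have := @cfubini _ _ _ _ _ leb leb _ _ _ mI (cintegrable_normc iK)
  (integrable_scale C (cintegrable_normc iW)) dom => /= h.
have iFk (x : T) : cintegrable leb (fun t => F t * ckernel ((x : R) +i* e) t).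
  by apply: (cintegrableM sF); apply: sqi_ckernel; rewrite /= gt_eqF.
have ikk (t : T) : cintegrable leb (fun x => k x * ckernel ((t : R) -i* e) x).
  by apply: (cintegrableM sk); apply: sqi_ckernel; rewrite /= oppr_eq0 gt_eqF.
have i1 := cintegrable_fubini1 mI (cintegrable_normc iK)
  (integrable_scale C (cintegrable_normc iW)) dom.
have i2 := cintegrable_fubini2 mI (cintegrable_normc iK)
  (integrable_scale C (cintegrable_normc iW)) dom.
have E1 x : cintegral leb (fun t => k x * (F t * ckernel ((x : R) +i* e) t)) =
    k x * cintegral leb (fun t => F t * ckernel ((x : R) +i* e) t).
  exact: (cintegralZ (k x) (iFk x)).
have E2 t : cintegral leb (fun x => k x * (F t * ckernel ((x : R) +i* e) t)) =
    - (F t * cintegral leb (fun x => k x * ckernel ((t : R) -i* e) x)).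
  rewrite -mulNr -(cintegralZ _ (ikk t)); apply: eq_cintegral => x.
  by rewrite ckernel_swap mulrCA !mulrN mulNr.
rewrite /= in i1 i2.
transitivity ((twopii R)^-1 * cintegral leb (fun x =>
    cintegral leb (fun t => k x * (F t * ckernel ((x : R) +i* e) t)))).
  rewrite -(cintegralZ _ i1); apply: eq_cintegral => x.
  by rewrite E1 /cauchy_tr mulrCA.
have i3 : cintegrable leb (fun t : T => F t * cintegral leb (fun x => k x * ckernel ((t : R) -i* e) x)).
  by apply: (cintegrable_eq _ (cintegrableN i2)) => t; rewrite E2 opprK.
rewrite h [RHS]mulNr -mulrN -(cintegralN i3); congr (_ * _).
by apply: eq_cintegral => t; rewrite E2.
Qed.

Lemma cauchy_tr_null e F k : 0 < e -> decaying F -> cauchy_null k ->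
  cintegral leb (fun x => k x * cauchy_tr e F x) = 0.
Proof.
move=> e0 dF [sk k0]; rewrite cauchy_tr_duality//.
rewrite (@eq_cintegral _ _ _ leb _ (fun=> 0)); first by rewrite cintegral0 mulr0.
by move=> t; rewrite k0 ?mulr0//= oppr_lt0.
Qed.

(** The Fourier side of [cauchy_tr e F]: positive frequencies, damped by the height. The value
    [e = 0] is the limiting object. *)
Definition half_fourier e F (w : T) : R[i] :=
  (expR (- e * w) * \1_[set x : R | 0 <= x] w)%:C * fourierL1 F w.

Lemma half_weight_bounded e (w : T) : 0 <= e ->
  `|expR (- e * w) * \1_[set x : R | 0 <= x] w| <= 1.
Proof.
move=> e0; rewrite (indic_mkset (fun x => 0 <= x)).
have [w0|w0] := leP 0 w; last by rewrite /= mulr0 normr0.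
by rewrite /= mulr1 ger0_norm ?expR_ge0// expR_le1 mulNr oppr_le0 mulr_ge0.
Qed.

Lemma measurable_half_weight e :
  measurable_fun setT (fun w : T => expR (- e * w) * \1_[set x : R | 0 <= x] w).
Proof.
have [_ m1 _ _] := exhausts_right R; apply: measurable_funM; last exact: measurable_indic.
apply: (measurableT_comp (@measurable_expR R)); apply: measurable_funM => //.
Qed.

Lemma sqi_half_fourier e F : 0 <= e -> decaying F -> sqi leb (half_fourier e F).
Proof.
move=> e0 [sF iF _]; apply: (sqi_ae_bounded (M := 1)).
- by apply: cmeasurable_real; exact: measurable_half_weight.
- by apply: aeW => w; rewrite normc_real half_weight_bounded.
- exact: (bessel iF sF).1.
Qed.

Lemma cintegrable_half_fourier e F : 0 < e -> decaying F ->
  cintegrable leb (half_fourier e F).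
Proof.
move=> e0 [sF iF _].
have iw : cintegrable leb (fun w : T =>
    kexp (- e)%:C w * (\1_[set x : R | 0 <= x] w)%:C).
  by apply: (cintegral_kexp_right _).1; rewrite /= oppr_lt0.
have : cintegrable leb (fun w : T => fourierL1 F w *
    (kexp (- e)%:C w * (\1_[set x : R | 0 <= x] w)%:C)).
  apply: (cintegrable_bounded (M := \int[leb]_x normc (F x))) => //.
    exact: cmeasurable_fourierL1.
  by move=> w; exact: fourierL1_bounded.
rewrite (_ : (fun w => _) = half_fourier e F)//.
apply/funext => w; rewrite /half_fourier mulrC; congr (_ * _).
by rewrite /kexp /= mul0r expi0 mulr1 (rmorphM (real_complex R)).
Qed.

(** The inverse transform is written with two conjugations so that [bessel], stated for [fourierL1],
    applies to it. *)
Lemma cauchy_tr_fourier e F (x : T) : 0 < e -> decaying F ->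
  cauchy_tr e F x =
  (2 * pi)^-1%:C * (fourierL1 (fun w => (half_fourier e F w)^*) x)^*.
Proof.
move=> e0 dF; have [sF iF _] := dF.
have b0 : 0 < complex.Im ((x : R) +i* e) by [].
have [ip _] := cfourier_right 0 b0.
have M := multiplication_formula iF ip.
have iFk : cintegrable leb (fun t => F t * ckernel ((x : R) +i* e) t).
  by apply: (cintegrableM sF); apply: sqi_ckernel; rewrite /= gt_eqF.
have E : cintegral leb (fun t => F t * (- 'i * ckernel ((x : R) +i* e) t)) =
    (2 * pi)%:C * cauchy_tr e F x.
  under eq_cintegral do rewrite mulrCA.
  rewrite (cintegralZ _ iFk) /cauchy_tr mulrA; congr (_ * _).
  have p0 : (2 * pi)%:C != 0 :> R[i] := realc_neq0 pi2_neq0.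
  by rewrite twopiiE invfM mulrA (divff p0) mul1r -[RHS]opprK -invrN invNi.
have M' := etrans M (etrans (eq_cintegral leb
  (fun t => congr1 (fun z => F t * z) (cfourier_right t b0).2)) E).
apply: (@mulfI _ (2 * pi)%:C).
  exact: realc_neq0 pi2_neq0.
rewrite -M' mulrA -(rmorphM (real_complex R)) (divff pi2_neq0) mul1r.
rewrite /fourierL1 -cintegral_conj; last first.
  apply: cintegrable_expiM; first by apply: measurable_funN; exact: measurable_funM.
  by apply: cintegrable_conj; exact: cintegrable_half_fourier.
apply: eq_cintegral => w.
rewrite conjcM expi_conj opprK conjcE conjcE conjcK /half_fourier.
have K : kexp ('i * ((x : R) +i* e)) w = (expR (- e * w))%:C * expi ((x : R) * w).
  by rewrite /kexp; congr ((expR _)%:C * expi _); rewrite ?ReM ?ImM /=; ring.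
rewrite K (rmorphM (real_complex R)) -!mulrA; congr (_ * _).
by rewrite mulrC -mulrA.
Qed.

End CauchyTransform.

(** * Existence and uniqueness of the Riesz projection *)

Section RieszProjection.
Context (R : realType).
Local Notation leb := (@lebesgue_measure R).
Local Notation T := (measurableTypeR R).
Implicit Types (F G h k : T -> R[i]) (e : R) (n : nat).

Lemma cauchy_tr_fourier_fun e F : 0 < e -> decaying F ->
  cauchy_tr e F = (fun x => ((2 * pi)^-1)%:C *
    (fourierL1 (fun w => (half_fourier e F w)^*) x)^*).
Proof. by move=> e0 dF; apply/funext => x; exact: cauchy_tr_fourier. Qed.

Let bessel_half e F : 0 < e -> decaying F ->
  sqi leb (fourierL1 (fun w => (half_fourier e F w)^*)).
Proof.
move=> e0 dF; apply: (bessel _ _).1.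
- exact/cintegrable_conj/cintegrable_half_fourier.
- by apply/sqi_conj/sqi_half_fourier => //; exact: ltW.
Qed.

Lemma sqi_cauchy_tr e F : 0 < e -> decaying F -> sqi leb (cauchy_tr e F).
Proof.
move=> e0 dF; rewrite cauchy_tr_fourier_fun//.
by apply: sqiZ; apply: sqi_conj; exact: bessel_half.
Qed.

Lemma nrm2_cauchy_trB e e' F : 0 < e -> 0 < e' -> decaying F ->
  nrm2 leb (fun x => cauchy_tr e F x - cauchy_tr e' F x) <=
  (2 * pi)^-1 ^+ 2 * (4 * pi * nrm2 leb (fun w => half_fourier e F w - half_fourier e' F w)).
Proof.
move=> e0 e0' dF.
have i1 := cintegrable_conj (cintegrable_half_fourier e0 dF).
have i2 := cintegrable_conj (cintegrable_half_fourier e0' dF).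
have s1 := sqi_conj (sqi_half_fourier (ltW e0) dF).
have s2 := sqi_conj (sqi_half_fourier (ltW e0') dF).
pose D w := (half_fourier e F w)^* - (half_fourier e' F w)^*.
have iD : cintegrable leb D := cintegrableB i1 i2.
have sD : sqi leb D := sqiB s1 s2.
have [sB lB] := bessel iD sD.
have -> : (fun x => cauchy_tr e F x - cauchy_tr e' F x) =
    (fun x => ((2 * pi)^-1)%:C * (fourierL1 D x)^*).
  apply/funext => x; rewrite !cauchy_tr_fourier// -mulrBr -conjcB.
  by rewrite -fourierL1B.
have p0 := pi_gt0 R.
rewrite nrm2Z; last exact: sqi_conj.
rewrite nrm2_conj normc_real ger0_norm; last by rewrite invr_ge0 mulr_ge0// ltW.
rewrite ler_wpM2l ?sqr_ge0//; apply: (le_trans lB).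
rewrite -[nrm2 leb (fun w => half_fourier e F w - _)]nrm2_conj.
rewrite le_eqVlt; apply/orP; left; apply/eqP; congr (_ * nrm2 _ _).
by apply/funext => w; rewrite conjcB.
Qed.

Lemma half_fourier_cvg F : decaying F ->
  l2cvg leb (fun n => half_fourier (harm R n) F) (half_fourier 0 F).
Proof.
move=> dF; have [sF iF _] := dF.
have sB := (bessel iF sF).1.
apply: (l2cvg_dominated _ _ (sqiZ 2 sB)).
- by move=> n; apply: sqi_half_fourier => //; exact/ltW/harm_gt0.
- exact: sqi_half_fourier.
- move=> n w; rewrite /half_fourier -mulrBl -(rmorphB (real_complex R)) !normcM.
  rewrite -(rmorph_nat (real_complex R) 2) !normc_real.
  apply: ler_wpM2r; first exact: normc_ge0.
  rewrite [leRHS]ger0_norm// (le_trans (ler_normB _ _))// (_ : 2 = 1 + 1 :> R)//.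
  by apply: lerD; apply: half_weight_bounded => //; exact/ltW/harm_gt0.
- apply: aeW => w; rewrite /half_fourier; apply: ccvgM; last exact: ccvg_cst.
  apply: (@ccvg_real _ (fun n => expR (- harm R n * w) * \1_[set x : R | 0 <= x] w)).
  apply: cvgM; last exact: cvg_cst.
  have h : (fun n => - harm R n * w) @ \oo --> - 0 * w.
    by apply: cvgM; [apply: cvgN; exact: harm_cvg0|exact: cvg_cst].
  exact: (cvg_comp _ _ h (@continuous_expR R _)).
Qed.

(** Boundary value of the Cauchy integral from above, in L_2; a relation, because [h] is determined
    only almost everywhere. *)
Definition cauchy_limit F h : Prop :=
  sqi leb h /\ l2cvg leb (fun n => cauchy_tr (harm R n) F) h.

Lemma cauchy_limit_exists F : decaying F -> exists h, cauchy_limit F h.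
Proof.
move=> dF; have p0 := pi_gt0 R.
have sn n : sqi leb (cauchy_tr (harm R n) F).
  by apply: sqi_cauchy_tr => //; exact: harm_gt0.
pose C : R := (2 * pi)^-1 ^+ 2 * (4 * pi).
have C0 : 0 < C by rewrite mulr_gt0 ?exprn_gt0 ?invr_gt0 ?mulr_gt0.
have cau : l2cauchy leb (fun n => cauchy_tr (harm R n) F).
  move=> e e0; have e1 : 0 < e / C by rewrite divr_gt0.
  have sh n : sqi leb (half_fourier (harm R n) F).
    by apply: sqi_half_fourier => //; exact/ltW/harm_gt0.
  have [N HN] := l2cvg_l2cauchy sh (sqi_half_fourier (lexx 0) dF) (half_fourier_cvg dF) e1.
  exists N => m n Nm Nn.
  apply: (le_trans (nrm2_cauchy_trB (harm_gt0 R m) (harm_gt0 R n) dF)).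
  have := HN m n Nm Nn; rewrite ler_pdivlMr// => hmn; apply: le_trans hmn.
  by rewrite [leRHS]mulrC /C -!mulrA.
have [h [s [hs hc _ _]]] := riesz_fischer sn cau.
by exists h.
Qed.

Lemma cauchy_limit_integral F h k : decaying F -> cauchy_limit F h -> sqi leb k ->
  ccvg (fun n => cintegral leb (fun x => cauchy_tr (harm R n) F x * k x))
    (cintegral leb (fun x => h x * k x)).
Proof.
move=> dF [sh ch] sk; apply: l2cvg_cintegralM => // n.
by apply: sqi_cauchy_tr => //; exact: harm_gt0.
Qed.

Lemma ccvg_near_eq (zs : nat -> R[i]) z c : (\forall n \near \oo, zs n = c) ->
  ccvg zs z -> z = c.
Proof.
move=> zc cz; apply: (ccvg_unique cz).
by split; apply: cvg_near_cst; apply: filterS zc => n ->.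
Qed.

Lemma harm_near_lt (b : R) : 0 < b -> \forall n \near \oo, harm R n < b.
Proof. by move=> b0; have /cvgr_lt/(_ b b0) := @harm_cvg0 R. Qed.

(** The bilinear orthogonality of Hardy functions, inherited from positive height. *)
Lemma cauchy_limit_null_integral F h k : decaying F -> cauchy_limit F h ->
  cauchy_null k -> cintegral leb (fun x => h x * k x) = 0.
Proof.
move=> dF ch kn; have [sk _] := kn.
apply: (ccvg_near_eq _ (cauchy_limit_integral dF ch sk)); apply: nearW => n.
have := cauchy_tr_null (harm_gt0 R n) dF kn.
by under eq_cintegral do rewrite mulrC.
Qed.

Lemma cauchy_limit_null F h : decaying F -> cauchy_limit F h -> cauchy_null h.
Proof.
move=> dF ch; have [sh _] := ch; split=> // a a0.
have an0 : complex.Im a != 0 by rewrite lt_eqF.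
have sa := sqi_ckernel an0.
apply: (ccvg_near_eq _ (cauchy_limit_integral dF ch sa)).
have a1 : 0 < - complex.Im a by rewrite oppr_gt0.
(* Once the height is below [- Im a], the pole [t - i harm n] differs from [a], as [ckernel_orth]
   demands. *)
apply: filterS (harm_near_lt a1) => n hn.
rewrite (_ : cintegral _ _ = cintegral leb (fun x => ckernel a x * cauchy_tr (harm R n) F x)).
  rewrite (cauchy_tr_duality (harm_gt0 R n) dF sa).
  rewrite (@eq_cintegral _ _ _ leb _ (fun=> 0)); first by rewrite cintegral0 mulr0.
  move=> t; rewrite ckernel_orth ?mulr0//=.
    by rewrite oppr_lt0 harm_gt0.
  by apply: contraTneq hn => -> /=; rewrite opprK ltxx.
by apply: eq_cintegral => x; rewrite mulrC.
Qed.

(** The conjugate term carries the kernel with pole [x - i e]; the difference of the two kernels is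
    [2 i] times the Poisson kernel. *)
Lemma cauchy_trD_poisson e F (x : T) : 0 < e -> decaying F ->
  cauchy_tr e F x + (cauchy_tr e (fun t => (F t)^*) x)^* =
  (pi^-1)%:C * poisson_avg e F x.
Proof.
move=> e0 dF; have [sF iF _] := dF; have [sF' iF' _] := decaying_conj dF.
have en0 : complex.Im ((x : R) +i* e) != 0 by rewrite /= gt_eqF.
have i1 := cintegrableM sF (sqi_ckernel en0).
have i2 := cintegrableM sF' (sqi_ckernel en0).
rewrite /cauchy_tr conjcM -(cintegral_conj i2).
have -> : (twopii R)^-1^* = - (twopii R)^-1.
  rewrite -invrN; have := conjc_inv (twopii R); rewrite -!conjcE => ->; congr (_^-1).
  rewrite twopiiE conjcM conjc_realc -mulrN; congr (_ * _).
  by rewrite conjcE; apply: complexP => /=; rewrite ?oppr0.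
rewrite mulNr -mulrBr.
rewrite -(cintegralB i1 (cintegrable_conj i2)).
have pt (t : T) : F t * ckernel ((x : R) +i* e) t - ((F t)^* * ckernel ((x : R) +i* e) t)^* =
    (2 * 'i) * (F t * (pkernel e (x - t))%:C).
  rewrite conjcM conjcE conjcE conjcK -mulrBr mulrCA; congr (_ * _).
  have Im_K : complex.Im (ckernel ((x : R) +i* e) t) = pkernel e (x - t).
    rewrite ImV sqr_normcE !(ReD, ImD, ReN, ImN) /= add0r opprK sqrrN /pkernel.
    by congr (_ / _); rewrite addrC; congr (_ + _); rewrite -sqrrN opprB.
  rewrite -Im_K; move: (ckernel _ _) => z.
  by apply: complexP; rewrite !(ReD, ImD, ReN, ImN, ReM, ImM, Re_conj, Im_conj) /=; ring.
rewrite (eq_cintegral _ pt) (cintegralZ _ (cintegrable_poisson x e0 iF)) mulrA.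
congr (_ * _); apply: (@mulfI _ (twopii R)); first exact: twopii_neq0.
rewrite mulrA divff ?twopii_neq0// mul1r twopiiE mulrAC; congr (_ * _).
have p0 : pi != 0 :> R by rewrite gt_eqF// pi_gt0.
by rewrite -(rmorphM (real_complex R)) mulfK// (rmorph_nat (real_complex R) 2).
Qed.

(** The limit of the previous identity as the height tends to zero, tested on intervals. It is the
    splitting of [F] into positive and negative frequencies. *)
Lemma cauchy_limit_decomposition F h h' : decaying F -> cauchy_limit F h ->
  cauchy_limit (fun t => (F t)^*) h' -> aeeq leb F (fun x => h x + (h' x)^*).
Proof.
move=> dF ch ch'; have dF' := decaying_conj dF; have [sF iF _] := dF.
have [sh _] := ch; have [sh' _] := ch'.
have sD : sqi leb (fun x => h x + (h' x)^* - F x).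
  by apply: sqiB => //; apply: sqiD => //; exact: sqi_conj.
suff : aeeq leb (fun x => h x + (h' x)^* - F x) (fun=> 0).
  by apply: filterS => x /eqP; rewrite subr_eq0 => /eqP.
apply: cintegral_itv_ae0; first by case: sD.
  by move=> a b; exact: sqi_cintegrable_itv.
move=> a b ab; pose I (x : T) : R[i] := (\1_`[a, b] x)%:C.
have sI : sqi leb I := sqi_indic_itv a b.
have IC x : (I x)^* = I x by rewrite conjc_realc.
have iF1 : cintegrable leb (fun x => F x * I x) by exact: cintegrableM.
have ih : cintegrable leb (fun x => h x * I x) by exact: cintegrableM.
have ih' : cintegrable leb (fun x => (h' x * I x)^*) by exact/cintegrable_conj/cintegrableM.
transitivity (cintegral leb (fun x => h x * I x) + cintegral leb (fun x => (h' x * I x)^*) -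
    cintegral leb (fun x => F x * I x)).
  rewrite -(cintegralD ih ih') -cintegralB//; last exact: cintegrableD.
  by apply: eq_cintegral => x; rewrite conjcM IC -mulrDl -mulrBl.
apply/eqP; rewrite subr_eq0; apply/eqP.
rewrite cintegral_conj; last exact: cintegrableM.
have c1 := ccvgD (cauchy_limit_integral dF ch sI)
  (ccvg_conj (cauchy_limit_integral dF' ch' sI)).
have c2 := ccvgM (ccvg_cst (pi^-1 : R)%:C) (poisson_avg_cvg ab iF).
have E : cintegral leb (fun x => F x * I x) =
    (pi^-1)%:C * cintegral leb (fun x => F x * (pi * \1_`[a, b] x)%:C).
  rewrite -cintegralZ; last first.
    have -> : (fun x : T => F x * (pi * \1_`[a, b] x)%:C) = (fun x => (pi : R)%:C * (F x * I x)).
      by apply/funext => x; rewrite (rmorphM (real_complex R)) mulrCA.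
    exact: cintegrableZ.
  apply: eq_cintegral => x; rewrite mulrCA -(rmorphM (real_complex R)) mulrA mulVf ?mul1r//.
  by rewrite gt_eqF// pi_gt0.
rewrite E; apply: (ccvg_unique _ c2); move: c1; congr ccvg; apply/funext => n.
have e0 := harm_gt0 R n.
have s1 := sqi_cauchy_tr e0 dF; have s2 := sqi_cauchy_tr e0 dF'.
have i1 := cintegrableM s1 sI; have i2 := cintegrableM s2 sI.
rewrite -(cintegral_conj i2) -(cintegralD i1 (cintegrable_conj i2)) -cintegralZ; last first.
  have : cintegrable leb (fun x => pi%:C * (cauchy_tr (harm R n) F x * I x +
    (cauchy_tr (harm R n) (fun t => (F t)^*) x * I x)^*)).
    by apply: cintegrableZ; apply: cintegrableD => //; exact: cintegrable_conj.
  apply: cintegrable_eq => x; rewrite conjcM IC -mulrDl cauchy_trD_poisson//.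
  rewrite mulrA mulrA -(rmorphM (real_complex R)) mulfV ?mul1r; first by rewrite mulrC.
  by rewrite gt_eqF// pi_gt0.
apply: eq_cintegral => x; rewrite conjcM IC -mulrDl cauchy_trD_poisson//.
by rewrite -mulrA [_ * I x]mulrC.
Qed.

Lemma cauchy_nullB h k : cauchy_null h -> cauchy_null k ->
  cauchy_null (fun x => h x - k x).
Proof.
move=> [sh h0] [sk k0]; split; first exact: sqiB.
move=> a a0; have sa : sqi leb (ckernel a) by apply: sqi_ckernel; rewrite lt_eqF.
under eq_cintegral do rewrite mulrBl.
by rewrite cintegralB ?h0 ?k0 ?subr0//; exact: cintegrableM.
Qed.

(** The remainder is [conj h'], and its inner product with a Hardy function [k] is the conjugate of
    the integral of [h' k], which is zero. *)
Lemma is_orthproj_cauchy_limit F h : decaying F -> cauchy_limit F h ->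
  is_orthproj leb (@hardy_plus R) F h.
Proof.
move=> dF ch; rewrite hardy_plusE; split; first exact: cauchy_limit_null ch.
move=> k kn; have [sk _] := kn.
have dF' := decaying_conj dF; have [h' ch'] := cauchy_limit_exists dF'.
have D := cauchy_limit_decomposition dF ch ch'.
have [sF _ _] := dF; have [sh _] := ch; have [sh' _] := ch'.
rewrite /inner (@ae_eq_cintegral _ _ _ leb _ (fun x => (h' x * k x)^*)).
- rewrite cintegral_conj; last exact: cintegrableM.
  by rewrite (cauchy_limit_null_integral dF' ch' kn) conjcE; apply: complexP => /=; rewrite ?oppr0.
- apply: cmeasurableM; first by case: (sqiB sF sh).
  by case: (sqi_conj sk).
- by apply: cmeasurable_conj; apply: cmeasurableM; [case: sh'|case: sk].
- by apply: filterS D => x ->; rewrite addrC addKr conjcM.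
Qed.

(** The difference of two candidates lies in the space, so it may itself be tested in both
    orthogonality relations. *)
Lemma is_orthproj_unique F h1 h2 : sqi leb F ->
  is_orthproj leb (@hardy_plus R) F h1 -> is_orthproj leb (@hardy_plus R) F h2 ->
  aeeq leb h1 h2.
Proof.
rewrite hardy_plusE => sF [n1 o1] [n2 o2].
have [s1 _] := n1; have [s2 _] := n2.
have n3 := cauchy_nullB n1 n2; have [s3 _] := n3.
suff : nrm2 leb (fun x => h1 x - h2 x) = 0.
  by move=> /(nrm2_eq0 s3); apply: filterS => x /eqP; rewrite subr_eq0 => /eqP.
have i1 := cintegrableM (sqiB sF s1) (sqi_conj s3).
have i2 := cintegrableM (sqiB sF s2) (sqi_conj s3).
apply: (@complexI R); rewrite /nrm2 -cintegral_real.
transitivity (inner leb (fun x => F x - h2 x) (fun x => h1 x - h2 x) -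
    inner leb (fun x => F x - h1 x) (fun x => h1 x - h2 x)); last first.
  by rewrite o1// o2// subrr.
rewrite /inner -(cintegralB i2 i1).
by apply: eq_cintegral => x; rewrite -mulc_conj -mulrBl; congr (_ * _); ring.
Qed.

Lemma is_orthproj_Pplus F : decaying F ->
  is_orthproj leb (@hardy_plus R) F (Pplus F).
Proof.
move=> dF; have [h ch] := cauchy_limit_exists dF.
rewrite /Pplus /orthproj; apply: (@xgetPex _ _ [set h | is_orthproj leb (@hardy_plus R) F h]).
by exists h; exact: is_orthproj_cauchy_limit.
Qed.

Lemma Pplus_ae F h : sqi leb F -> is_orthproj leb (@hardy_plus R) F h ->
  aeeq leb (Pplus F) h.
Proof.
move=> sF oh; apply: (is_orthproj_unique sF) => //.
rewrite /Pplus /orthproj; apply: (@xgetPex _ _ [set h | is_orthproj leb (@hardy_plus R) F h]).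
by exists h.
Qed.

End RieszProjection.

(** * Bounded multipliers of the Hardy space and multiplication by the variable *)

Section HardyMultipliers.
Context (R : realType).
Local Notation leb := (@lebesgue_measure R).
Local Notation T := (measurableTypeR R).
Implicit Types (F G h k p q : T -> R[i]).

(** Replacing [p] by its Cauchy integrals and using duality leaves [k] against a product of two
    kernels with poles in the lower half-plane; partial fractions reduce this to single kernels. *)
Lemma cauchy_null_mul G p k (M : R) : decaying G -> cauchy_limit G p ->
  {ae leb, forall x, normc (p x) <= M} -> cauchy_null k ->
  cauchy_null (fun x => p x * k x).
Proof.
move=> dG cp pM [sk k0]; have [sp _] := cp; have [mp _] := sp.
have spk : sqi leb (fun x => p x * k x) := sqi_ae_bounded mp pM sk.
split=> // a a0; have an0 : complex.Im a != 0 by rewrite lt_eqF.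
have sa : sqi leb (ckernel a) := sqi_ckernel an0.
have ska : sqi leb (fun x => k x * ckernel a x).
  have cb : {ae leb, forall x : T, normc (ckernel a x) <= `|complex.Im a|^-1}.
    by apply: aeW => x; exact: ckernel_bounded.
  have := sqi_ae_bounded (cmeasurable_ckernel a) cb sk.
  by under eq_fun do rewrite mulrC.
rewrite (_ : cintegral _ _ = cintegral leb (fun x => p x * (k x * ckernel a x))); last first.
  by apply: eq_cintegral => x; rewrite mulrA.
apply: (ccvg_near_eq _ (cauchy_limit_integral dG cp ska)).
have a1 : 0 < - complex.Im a by rewrite oppr_gt0.
apply: filterS (harm_near_lt a1) => n hn.
rewrite (_ : cintegral _ _ = cintegral leb (fun x =>
    (k x * ckernel a x) * cauchy_tr (harm R n) G x)); last first.
  by apply: eq_cintegral => x; rewrite mulrC.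
rewrite (cauchy_tr_duality (harm_gt0 R n) dG ska).
rewrite (@eq_cintegral _ _ _ leb _ (fun=> 0)); first by rewrite cintegral0 mulr0.
move=> t; pose b : R[i] := (t : R) -i* harm R n.
have b0 : complex.Im b < 0 by rewrite /= oppr_lt0 harm_gt0.
have bn0 : complex.Im b != 0 by rewrite lt_eqF.
have sb : sqi leb (ckernel b) := sqi_ckernel bn0.
have ab : a - b != 0.
  by rewrite subr_eq0; apply: contraTneq hn => -> /=; rewrite opprK ltxx.
have i1 := cintegrableM sk sa; have i2 := cintegrableM sk sb.
rewrite (_ : cintegral _ _ = (a - b)^-1 * cintegral leb (fun x =>
    k x * ckernel a x - k x * ckernel b x)).
  by rewrite (cintegralB i1 i2) (k0 a a0) (k0 b b0) subrr !mulr0.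
rewrite -(cintegralZ _ (cintegrableB i1 i2)); apply: eq_cintegral => x.
by rewrite -mulrBr ckernelB// mulrCA [_^-1 * _]mulrA mulVf// mul1r mulrA.
Qed.

Lemma normc_inv1D q x : normc (q x) <= 2^-1 -> 1 + q x != 0 /\ normc (1 + q x)^-1 <= 2.
Proof.
move=> q2; have h : 2^-1 <= normc (1 + q x).
  have := normc_sub (1 + q x) (q x); rewrite addrK normc1; move: q2; lra.
have p0 : 0 < normc (1 + q x) by apply: lt_le_trans h; rewrite invr_gt0.
split; first by rewrite -normc_gt0.
by rewrite normcV -[leRHS]invrK lef_pV2// posrE invr_gt0.
Qed.

(* Since [k / (1 + q) = k - q k / (1 + q)], the integral against a Cauchy kernel
   only changes sign when [k] is replaced by [q k], whose norm is at most half. *)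
Lemma cauchy_null_inv1D q k : cmeasurable q ->
  {ae leb, forall x, normc (q x) <= 2^-1} ->
  (forall h, cauchy_null h -> cauchy_null (fun x => q x * h x)) ->
  cauchy_null k -> cauchy_null (fun x => (1 + q x)^-1 * k x).
Proof.
move=> mq q2 qn kn.
have mi : cmeasurable (fun x => (1 + q x)^-1).
  by apply: cmeasurableV; apply: cmeasurableD => //; exact: cmeasurable_cst.
have bi : {ae leb, forall x, normc (1 + q x)^-1 <= 2}.
  by apply: filterS q2 => x /normc_inv1D[].
have sI h : cauchy_null h -> sqi leb (fun x => (1 + q x)^-1 * h x).
  by move=> [sh _]; exact: sqi_ae_bounded bi sh.
split=> [|a a0]; first exact: sI.
have sa : sqi leb (ckernel a) by apply: sqi_ckernel; rewrite lt_eqF.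
pose I h := cintegral leb (fun x => (1 + q x)^-1 * h x * ckernel a x).
pose C := nrm2 leb (ckernel a).
have C0 : 0 <= C by exact: nrm2_ge0.
have bound j : forall h, cauchy_null h -> normc (I h) ^+ 2 <= 4 * 4^-1 ^+ j * (nrm2 leb h * C).
  elim: j => [|j ih] h hn; have [sh h0] := hn.
    apply: (le_trans (cauchy_schwarz (sI h hn) sa)).
    rewrite expr0 mulr1 mulrA ler_wpM2r//.
    by have := nrm2_ae_bounded mi bi sh; rewrite (_ : 2 ^+ 2 = 4 :> R)// -natrX.
  have qh := qn h hn; have [sqh _] := qh.
  have -> : I h = - I (fun x => q x * h x).
    have i1 := cintegrableM sh sa; have i2 := cintegrableM (sI _ qh) sa.
    rewrite -[RHS]add0r -(h0 a a0) /I -(cintegralB i1 i2).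
    apply: ae_eq_cintegral.
    - exact: (cintegrable_cmeasurable (cintegrableM (sI _ hn) sa)).
    - exact: (cintegrable_cmeasurable (cintegrableB i1 i2)).
    - apply: filterS q2 => x /normc_inv1D[qx _].
      by rewrite -mulrBl; congr (_ * _); field.
  rewrite normc_opp; apply: (le_trans (ih _ qh)).
  rewrite [4^-1 ^+ j.+1]exprS; have := nrm2_ae_bounded mq q2 sh.
  rewrite (_ : 2^-1 ^+ 2 = 4^-1 :> R); last by lra.
  move=> hq; have e0 : 0 <= 4 * 4^-1 ^+ j :> R by rewrite mulr_ge0// exprn_ge0// invr_ge0.
  rewrite [leRHS](_ : _ = 4 * 4^-1 ^+ j * (4^-1 * nrm2 leb h * C)); last by ring.
  by rewrite ler_wpM2l// ler_wpM2r.
have c0 : (fun j => 4 * 4^-1 ^+ j * (nrm2 leb k * C) : R) @ \oo --> (0 : R).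
  rewrite -(mul0r (nrm2 leb k * C)) -(mulr0 4); apply: cvgM; last exact: cvg_cst.
  apply: cvgM; first exact: cvg_cst.
  by apply: cvg_expr; rewrite ger0_norm ?invr_ge0// invf_lt1// ltr1n.
apply/eqP; rewrite -normc_eq0 -sqrf_eq0 eq_le sqr_ge0 andbT.
rewrite -(cvg_lim _ c0)//; apply: limr_ge; first by apply/cvg_ex; eexists; exact: c0.
by apply: nearW => j; exact: bound.
Qed.

(** At height [e], with [z = x + i e], write [x = t - i e - (t - z)] under the Cauchy integral: the
    last term cancels the kernel and produces the constant, and the middle one vanishes in the
    limit. *)
Lemma cauchy_limit_shift F h h2 : decaying F -> decaying (fun t : T => (t : R)%:C * F t) ->
  cauchy_limit F h -> cauchy_limit (fun t : T => (t : R)%:C * F t) h2 ->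
  {ae leb, forall x, (x : R)%:C * h x = h2 x - (twopii R)^-1 * cintegral leb F}.
Proof.
move=> dF dtF [sh ch] [sh2 ch2].
have s1 n : sqi leb (cauchy_tr (harm R n) F) := sqi_cauchy_tr (harm_gt0 R n) dF.
have s2 n := sqi_cauchy_tr (harm_gt0 R n) dtF.
have [s soo as1] := l2cvg_ae_subseq s1 sh ch.
(* Extracted from the first subsequence, so that both transforms converge almost everywhere along
   the same indices. *)
have [t too at2] := l2cvg_ae_subseq (fun n => s2 (s n)) sh2 (l2cvg_sub soo ch2).
have sF := let: And3 a _ _ := dF in a; have iF := let: And3 _ a _ := dF in a.
have stF := let: And3 a _ _ := dtF in a.
have id_ n (x : T) : (x : R)%:C * cauchy_tr (harm R n) F x =
    cauchy_tr (harm R n) (fun t : T => (t : R)%:C * F t) x -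
    (0 +i* harm R n) * cauchy_tr (harm R n) F x - (twopii R)^-1 * cintegral leb F.
  have bn0 : complex.Im ((x : R) +i* harm R n) != 0 by rewrite /= gt_eqF// harm_gt0.
  have i1 := cintegrableM sF (sqi_ckernel bn0).
  have i2 := cintegrableM stF (sqi_ckernel bn0).
  rewrite /cauchy_tr mulrCA [(0 +i* _) * _]mulrCA -!mulrBr; congr (_ * _).
  rewrite -(cintegralZ _ i1) -(cintegralZ (0 +i* harm R n) i1).
  rewrite -(cintegralB i2 (cintegrableZ _ i1)).
  rewrite -(cintegralB (cintegrableB i2 (cintegrableZ _ i1)) iF).
  apply: eq_cintegral => t'; rewrite /ckernel.
  have := sub_real_neq0 t' bn0.
  have -> : ((x : R) +i* harm R n) = (x : R)%:C + (0 +i* harm R n).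
    by apply: complexP => /=; rewrite ?addr0 ?add0r.
  by move=> hne; field.
apply: filterS2 as1 at2 => x c1 c2.
have c1' := ccvg_sub too c1.
apply: (ccvg_unique (ccvgM (ccvg_cst (x : R)%:C) c1')).
have ch0 : ccvg (fun n => 0 +i* harm R (s (t n))) 0.
  split => /=; first exact: cvg_cst.
  exact: (cvg_comp _ _ (cvg_comp _ _ too soo) (@harm_cvg0 R)).
have := ccvgB (ccvgB c2 (ccvgM ch0 c1')) (ccvg_cst ((twopii R)^-1 * cintegral leb F)).
rewrite mul0r subr0; congr ccvg; apply/funext => n /=.
by rewrite id_.
Qed.

Lemma cauchy_limit_bounded F h (M : R) : decaying F -> cauchy_limit F h ->
  (forall n x, normc (cauchy_tr (harm R n) F x) <= M) ->
  {ae leb, forall x, normc (h x) <= M}.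
Proof.
move=> dF [sh ch] FM.
have s1 n : sqi leb (cauchy_tr (harm R n) F) := sqi_cauchy_tr (harm_gt0 R n) dF.
have [s soo as1] := l2cvg_ae_subseq s1 sh ch.
by apply: filterS as1 => x c1; apply: (ccvg_normc_le c1) => n; exact: FM.
Qed.

Lemma cauchy_null_sqi k : cauchy_null k -> sqi leb k.
Proof. by case. Qed.

(** Self-adjointness of the projection: both sides equal the inner product of [h] and [k]. *)
Lemma inner_orthproj F G h k : sqi leb F -> sqi leb G ->
  is_orthproj leb (@hardy_plus R) F h -> is_orthproj leb (@hardy_plus R) G k ->
  inner leb h G = inner leb F k.
Proof.
rewrite hardy_plusE => sF sG [hn ho] [kn ko].
have sh := cauchy_null_sqi hn; have sk := cauchy_null_sqi kn.
have c1 := sqi_conj sh; have c2 := sqi_conj sk; have c3 := sqi_conj sG.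
have c4 := sqi_conj (sqiB sG sk).
have e1 : inner leb F k = inner leb h k.
  apply/eqP; rewrite -subr_eq0 /inner -cintegralB; [|exact: cintegrableM..].
  apply/eqP; rewrite -(ho _ kn) /inner; apply: eq_cintegral => x.
  by rewrite mulrBl.
rewrite e1; apply/eqP; rewrite -subr_eq0 /inner -cintegralB; [|exact: cintegrableM..].
have iGk := cintegrableM (sqiB sG sk) c1.
transitivity ((inner leb (fun x => G x - k x) h)^* == 0); last first.
  by rewrite (ko _ hn) conjcE conjc0 eqxx.
rewrite /inner -(cintegral_conj iGk); congr (_ == _); apply: eq_cintegral => x.
have cK (z : R[i]) : (z^*)^* = z by rewrite !conjcE conjcK.
by rewrite conjcM conjcB cK [RHS]mulrC mulrBr.
Qed.

End HardyMultipliers.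

(** * The BTB bound compares [rho] with length on intervals *)

Section Density.
Context (R : realType).
Local Notation leb := (@lebesgue_measure R).
Local Notation T := (measurableTypeR R).
Variable rho : {finite_measure set T -> \bar R}.
Variable M : R.
Hypothesis M0 : 0 < M.
Hypothesis rhoM : forall l : R[i], 0 < complex.Im l -> normc (borel_transform rho l) <= M.

Lemma Im_ckernel_upper (e x t : R) : complex.Im (ckernel (x +i* e) t) = pkernel e (x - t).
Proof.
rewrite ImV sqr_normcE !(ReD, ImD, ReN, ImN) /= add0r opprK sqrrN /pkernel.
by congr (_ / _); rewrite addrC; congr (_ + _); rewrite -sqrrN opprB.
Qed.

Lemma integrable_rho_cst (c : R) : rho.-integrable setT (EFin \o (fun _ : T => c)).
Proof. exact: finite_measure_integrable_cst. Qed.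

(** The Poisson integral is the imaginary part of the Borel transform at [x + i e]. *)
Lemma poisson_rho_le (e x : R) : 0 < e -> \int[rho]_t (pkernel e (x - t)) <= M.
Proof.
move=> e0; have := rhoM (e0 : 0 < complex.Im (x +i* e)).
apply: le_trans; apply: le_trans (ler_normc_Im _); apply: le_trans (ler_norm _).
rewrite /borel_transform /=; rewrite le_eqVlt; apply/orP; left; apply/eqP.
by apply: eq_Rintegral => t _; rewrite -Im_ckernel_upper.
Qed.

Lemma integral_indic_itv (a b : R) : a < b -> \int[leb]_x (\1_`[a, b] x) = b - a :> R.
Proof.
move=> ab; have c1 : continuous (fun _ : R => 1 : R) by move=> x; exact: cvg_cst.
have := ftc_itv ab c1 (fun x => is_derive_id x 1).
by under eq_Rintegral do rewrite mul1r.
Qed.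

Lemma poisson_rho_itv_le (e a b : R) : 0 < e -> a < b ->
  \int[rho]_t (\int[leb]_x (pkernel e (x - t) * \1_`[a, b] x)) <= M * (b - a).
Proof.
move=> e0 ab.
have mk : measurable_fun setT (fun p : T * T => pkernel e (p.1 - p.2) * \1_`[a, b] p.1).
  apply: measurable_funM; first exact: measurable_pkernel2.
  by apply: (measurableT_comp (@measurable_indic _ T R _ _ (measurable_itv `[a, b]))); exact: measurable_fst.
have iI : leb.-integrable setT (EFin \o (fun x : T => e^-1 * \1_`[a, b] x)).
  by apply: integrable_scale; exact: integrable_indic_itv.
have dom (x t : T) : normc ((pkernel e (x - t) * \1_`[a, b] x)%:C : R[i]) <=
    (e^-1 * \1_`[a, b] x) * 1.
  have i0 : 0 <= \1_`[a, b] x :> R by [].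
  rewrite mulr1 normc_real normrM (ger0_norm (pkernel_ge0 (x - t) e0)) (ger0_norm i0).
  exact: (ler_wpM2r i0 (pkernel_le (x - t) e0)).
have mkc := @cmeasurable_real _ _ R _ mk.
have i1 := (@cintegrable_fubini1 _ _ _ _ _ leb rho _ _ _ mkc iI (integrable_rho_cst 1) dom).1.
have := @cfubini _ _ _ _ _ leb rho _ _ _ mkc iI (integrable_rho_cst 1) dom.
rewrite /= in i1 *.
under eq_cintegral do rewrite cintegral_real.
rewrite cintegral_real; under [in X in _ = X]eq_cintegral do rewrite cintegral_real.
rewrite cintegral_real => /(@complexI R) <-.
rewrite -(integral_indic_itv ab) -RintegralZl//; last exact: integrable_indic_itv.
apply: le_Rintegral => //.
  by apply: integrable_scale; exact: integrable_indic_itv.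
move=> x _.
have ipk : rho.-integrable setT (EFin \o (fun t : T => pkernel e (x - t))).
  apply: (integrable_le _ (integrable_rho_cst e^-1)).
    exact: measurable_pkernel_section.
  by move=> t; rewrite (ger0_norm (pkernel_ge0 (x - t) e0)) pkernel_le.
rewrite RintegralZr//; apply: ler_wpM2r; first by [].
exact: poisson_rho_le.
Qed.

(** Integrate the Poisson bound over the interval and let the height tend to zero. Absolute
    continuity is not yet known, so the limit is taken at every point and possible atoms at the
    endpoints are left out. *)
Lemma rho_oo_le (a b : R) : a < b -> pi * fine (rho `]a, b[%classic) <= M * (b - a).
Proof.
move=> ab; have p0 := pi_gt0 R.
(* The limit everywhere: [pi] inside, [pi / 2] at the endpoints, 0 outside. It dominates [pi] times
   the indicator of the open interval. *)
pose L (t : T) : R := Num.sg (b - t) * (pi / 2) - Num.sg (a - t) * (pi / 2).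
pose g n (t : T) : R := \int[leb]_x (pkernel (harm R n) (x - t) * \1_`[a, b] x).
have gE n t : g n t = atan (n.+1%:R * (b - t)) - atan (n.+1%:R * (a - t)).
  by rewrite /g integral_pkernel_itv ?harm_gt0// /harm invrK.
have mg n : measurable_fun setT (g n).
  have -> : g n = (fun t => atan (n.+1%:R * (b - t)) - atan (n.+1%:R * (a - t))).
    by apply/funext => t; rewrite gE.
  have mA (c : R) : measurable_fun setT (fun x : T => atan (n.+1%:R * (c - x))).
    apply: (@measurableT_comp _ _ _ _ _ _ (@atan R : T -> T)).
      by apply: continuous_measurableR => x; exact: continuous_atan.
    by apply: measurable_funM => //; exact: measurable_funB.
  exact: measurable_funB.
have cg t : (fun n => g n t) @ \oo --> L t.
  under eq_fun do rewrite gE.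
  by apply: cvgB; exact: cvg_atan_natS.
have mL : measurable_fun setT L.
  by apply: (measurable_fun_cvg mg) => t _; exact: cg.
have gpi n t : `|g n t| <= pi by exact: poisson_itv_bounded.
have Lpi t : `|L t| <= pi.
  have h : (fun n => `|g n t|) @ \oo --> `|L t| by apply: cvg_norm; exact: cg.
  rewrite -(cvg_lim _ h)//; apply: limr_le.
    by apply/cvg_ex; eexists; exact: h.
  by apply: nearW => n; exact: gpi.
have c : (fun n => \int[rho]_t g n t) @ \oo --> \int[rho]_t L t.
  apply: (dominated_cvg_Rintegral mg mL (integrable_rho_cst pi)); exact: aeW.
apply: (@le_trans _ _ (\int[rho]_t L t)); last first.
  rewrite -(cvg_lim _ c)//; apply: limr_le; first by apply/cvg_ex; eexists; exact: c.
  by apply: nearW => n; apply: poisson_rho_itv_le => //; exact: harm_gt0.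
have iI : rho.-integrable setT (EFin \o (\1_`]a, b[ : T -> R)).
  by apply: integrable_indic => //; exact: measurable_itv.
have -> : fine (rho `]a, b[%classic) = \int[rho]_t (\1_`]a, b[ t).
  rewrite /Rintegral integral_indic ?setIT//; exact: measurable_itv.
rewrite -RintegralZl//; apply: le_Rintegral => //.
- exact: integrable_scale.
- by apply: (integrable_le mL (integrable_rho_cst pi)).
- move=> t _; rewrite indicE mem_setE in_itv /= /L.
  have [bt|bt|->] := ltgtP t b; last by rewrite subrr sgr0 ltr0_sg ?subr_lt0// andbF /=; lra.
  + rewrite (gtr0_sg (_ : 0 < b - t)) ?subr_gt0// andbT.
    have [at_|at_|->] := ltgtP a t.
    * by rewrite ltr0_sg ?subr_lt0//=; lra.
    * by rewrite gtr0_sg ?subr_gt0//=; lra.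
    * by rewrite subrr sgr0 /=; lra.
  + rewrite andbF /= ltr0_sg ?subr_lt0// ltr0_sg ?subr_lt0 ?(lt_trans ab)//; lra.
Qed.

Let C := M / pi.
Let C0 : 0 < C. Proof. by rewrite divr_gt0// pi_gt0. Qed.

(** Half-open intervals are the ones from which Lebesgue outer measure is built; they are approached
    by open intervals ending at [b + harm n]. *)
Lemma rho_oc_le (a b : R) : a <= b -> (rho `]a, b]%classic <= (C * (b - a))%:E)%E.
Proof.
move=> ab; have p0 := pi_gt0 R.
have fr (A : set T) : measurable A -> (fine (rho A))%:E = rho A.
  by move=> mA; rewrite fineK// fin_num_measure.
have H n : fine (rho `]a, b]%classic) <= C * (b + harm R n - a).
  have h0 := harm_gt0 R n.
  have abn : a < b + harm R n by rewrite (le_lt_trans ab)// ltrDl.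
  have := rho_oo_le abn; rewrite mulrC -ler_pdivlMr// mulrAC => h; apply: le_trans h.
  apply: fine_le; [exact: fin_num_measure..|].
  apply: le_measure; rewrite ?inE; [exact: measurable_itv..|].
  move=> x /=; rewrite !in_itv /= => /andP[-> xb] /=.
  by rewrite (le_lt_trans xb)// ltrDl.
rewrite -fr ?lee_fin; last exact: measurable_itv.
have c : (fun n => C * (b + harm R n - a)) @ \oo --> C * (b + 0 - a).
  apply: cvgM; first exact: cvg_cst.
  apply: cvgB; last exact: cvg_cst.
  by apply: cvgD; [exact: cvg_cst|exact: harm_cvg0].
rewrite addr0 in c; rewrite -(cvg_lim _ c)//; apply: limr_ge.
  by apply/cvg_ex; eexists; exact: c.
exact: nearW.
Qed.

End Density.

(** * Absolute continuity, bounds on the density, change of measure *)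

Section AbsoluteContinuity.
Context (R : realType).
Local Notation leb := (@lebesgue_measure R).
Local Notation T := (measurableTypeR R).
Local Open Scope charge_scope.
Variable rho : {finite_measure set T -> \bar R}.
Variable C : R.
Hypothesis C0 : 0 < C.
Hypothesis rho_oc : forall a b : R, a <= b -> (rho `]a, b]%classic <= (C * (b - a))%:E)%E.

(** Lebesgue measure is an infimum over countable covers by half-open intervals; countable
    subadditivity of [rho] and the interval bound compare each cover. *)
Lemma rho_le_leb (A : set T) : measurable A -> (rho A <= C%:E * leb A)%E.
Proof.
move=> mA; rewrite -lee_pdivrMl//.
rewrite /lebesgue_measure /lebesgue_stieltjes_measure /measure_extension /=.
rewrite /mu_ext; apply: le_ereal_inf_tmp => _ [F [mF AF] <-].
(* A covering interval with reversed endpoints is empty and is rewritten as []a, a]]. *)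
have FE k : exists a b : R, a <= b /\ F k = `]a, b]%classic.
  have [[a b] _ /= <-] := mF k; have [ab|ba] := leP a b; first by exists a, b.
  exists a, a; split=> //; apply/seteqP; split=> x /=; rewrite !in_itv /=.
    by move=> /andP[ax xb]; have := lt_trans (lt_le_trans ax xb) ba; rewrite ltxx.
  by move=> /andP[ax xa]; have := lt_le_trans ax xa; rewrite ltxx.
have mF' k : measurable (F k : set T).
  by have [a [b [_ ->]]] := FE k; exact: measurable_itv.
rewrite lee_pdivrMl// -nneseriesZl//.
apply: (@le_trans _ _ (\sum_(k <oo) rho (F k))%E).
  exact: measure_sigma_subadditive.
apply: lee_nneseries => // k _.
have [a [b [ab ->]]] := FE k; apply: (le_trans (rho_oc ab)).
rewrite wlength_itv /= lte_fin; have [ab'|ba] := ltP a b.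
  by rewrite -EFinB -EFinM.
by rewrite mule0 lee_fin (_ : b = a) ?subrr ?mulr0//; apply/le_anti/andP.
Qed.

Lemma rho_dominated : rho `<< leb.
Proof.
apply/null_content_dominatesP => A mA A0.
by apply/eqP; rewrite -measure_le0 (le_trans (rho_le_leb mA))// A0 mule0.
Qed.

(** This makes the embedding [J] well defined on classes and carries identities proved in L_2(R)
    over to L_2(rho). *)
Lemma rho_ae (P : T -> Prop) : {ae leb, forall x, P x} -> {ae rho, forall x, P x}.
Proof.
move=> [N [mN N0 NP]]; exists N; split=> //.
by apply/eqP; rewrite -measure_le0 (le_trans (rho_le_leb mN))// N0 mule0.
Qed.

Definition rdensity (x : T) : R :=
  fine (('d (charge_of_finite_measure rho) '/d leb) x).

Lemma rho_dominated_charge : charge_of_finite_measure rho `<< leb.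
Proof. exact: rho_dominated. Qed.

Lemma densityE x : density rho x = (rdensity x)%:C.
Proof. by []. Qed.

Lemma EFin_rdensity x : (rdensity x)%:E = ('d (charge_of_finite_measure rho) '/d leb) x.
Proof. by rewrite fineK// Radon_Nikodym_fin_num//; exact: rho_dominated_charge. Qed.

Lemma integrable_rdensity : leb.-integrable setT (EFin \o rdensity).
Proof.
have := Radon_Nikodym_integrable rho_dominated_charge.
by apply: eq_integrable => // x _ /=; rewrite EFin_rdensity.
Qed.

Lemma measurable_rdensity : measurable_fun setT rdensity.
Proof. exact: integrable_measurable integrable_rdensity. Qed.

Lemma rho_rdensity (A : set T) : measurable A ->
  rho A = (\int[leb]_(x in A) (rdensity x)%:E)%E.
Proof.
move=> mA; have := Radon_Nikodym_integral rho_dominated_charge mA.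
move=> /= h; transitivity (charge_of_finite_measure rho A); first by [].
rewrite [LHS]h; by apply: eq_integral => x _; rewrite EFin_rdensity.
Qed.

Lemma measurable_gt0 (u : T -> R) : measurable_fun setT u ->
  measurable [set x | 0 < u x].
Proof.
move=> mu; have := measurable_fun_ltr (@measurable_cst _ _ T R setT 0) mu.
have mt : measurable [set true] by [].
move=> /(_ measurableT [set true] mt); rewrite setTI.
by congr (measurable _); apply/seteqP; split.
Qed.

Lemma ae_le0_of_integral (u : T -> R) : leb.-integrable setT (EFin \o u) ->
  (\int[leb]_(x in [set x | (0 < u x)%R]) (u x)%:E <= 0)%E ->
  {ae leb, forall x, u x <= 0}.
Proof.
move=> iu; set A := [set x | 0 < u x] => uA.
have mu := integrable_measurable iu.
have mA : measurable A.
  exact: measurable_gt0.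
have h0 : (\int[leb]_(x in A) `|(u x)%:E| = 0)%E.
  apply/eqP; rewrite eq_le integral_ge0// andbT; apply: le_trans uA.
  rewrite le_eqVlt; apply/orP; left; apply/eqP; apply: eq_integral => x.
  by rewrite inE => ux; rewrite gee0_abs// lee_fin ltW.
have mEu : measurable_fun A (EFin \o u).
  by apply: measurable_funTS; exact/measurable_EFinP.
have := (ae_eq_integral_abs leb mA mEu).1 h0.
apply: filterS => x h; rewrite leNgt; apply/negP => ux.
by have [] := h ux => /eqP; rewrite gt_eqF.
Qed.

Lemma rdensity_ge0 : {ae leb, forall x, 0 <= rdensity x}.
Proof.
have iw := integrable_rdensity; have mw := measurable_rdensity.
have iN : leb.-integrable setT (EFin \o (fun x => - rdensity x)).
  by have := integrableN iw; apply: eq_integrable.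
suff : {ae leb, forall x, - rdensity x <= 0}.
  by apply: filterS => x; rewrite oppr_le0.
apply: (ae_le0_of_integral iN); set A := [set x | _].
have mA : measurable A by exact: (measurable_gt0 (integrable_measurable iN)).
rewrite (_ : (\int[leb]_(x in A) _)%E = ((- 1)%:E * \int[leb]_(x in A) (rdensity x)%:E)%E).
  rewrite -rho_rdensity// mule_le0_ge0//.
rewrite -integralZl//; last exact: (integrableS measurableT).
by apply: eq_integral => x _; rewrite -EFinM mulN1r.
Qed.

(** On the set [A] where the density exceeds [C], the integral of the excess is [rho A - C leb A],
    which is at most 0. *)
Lemma rdensity_le : {ae leb, forall x, rdensity x <= C}.
Proof.
have iw := integrable_rdensity; have mw := measurable_rdensity.
have mwC : measurable_fun setT (fun x => rdensity x - C) by exact: measurable_funB.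
pose A : set T := [set x | 0 < rdensity x - C].
have mA : measurable A by exact: (measurable_gt0 mwC).
(* The cutoff keeps the excess integrable, which the constant [C] on the whole line is not. *)
pose u x := (rdensity x - C) * \1_A x.
have uA : [set x | 0 < u x] = A.
  apply/seteqP; split => x; rewrite /u /A /= indicE.
    by case: (boolP (x \in _)) => [|_]; rewrite ?inE ?mulr1// mulr0 ltxx.
  by move=> h; rewrite mem_set ?mulr1.
have iu : leb.-integrable setT (EFin \o u).
  apply: (integrable_le _ (integrable_norm iw)).
    by apply: measurable_funM => //; exact: measurable_indic.
  move=> x; rewrite /u indicE; case: (boolP (x \in A)) => [/set_mem|_]; last by rewrite mulr0 normr0 /= normr_ge0.
  rewrite /A /= => h; rewrite mulr1 (ger0_norm (ltW h)) [leRHS]/=.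
  rewrite ger0_norm; move: h C0; lra.
have iwA : leb.-integrable A (EFin \o rdensity) by exact: (integrableS measurableT).
(* Finiteness of [rho] thus forces [leb A] to be finite, and the subtraction below makes sense. *)
have wC : (C%:E * leb A <= rho A)%E.
  rewrite rho_rdensity// -integral_cst//; apply: ge0_le_integral => //.
  - by move=> x _; rewrite lee_fin ltW.
  - by apply: measurable_funTS; exact/measurable_EFinP.
  - by move=> x; rewrite /A /= lee_fin subr_gt0 => /ltW.
have rhoA : (rho A < +oo)%E by rewrite ltey_eq fin_num_measure.
have fA : (C%:E * leb A \is a fin_num)%E.
  by rewrite ge0_fin_numE ?mule_ge0 ?lee_fin ?(ltW C0)// (le_lt_trans wC).
have lA : (leb A < +oo)%E.
  rewrite ltey; apply/eqP => e; move: fA; rewrite e.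
  by rewrite gt0_muley ?lte_fin.
suff h : {ae leb, forall x, u x <= 0}.
  apply: filterS h => x; rewrite /u indicE; case: (boolP (x \in A)) => [_|].
    by rewrite mulr1 subr_le0.
  by rewrite notin_setE /A /= => /negP; rewrite -leNgt subr_le0.
apply: (ae_le0_of_integral iu); rewrite uA.
rewrite (_ : (\int[leb]_(x in A) (u x)%:E)%E = (rho A - C%:E * leb A)%E).
  by rewrite sube_le0 rho_le_leb.
rewrite rho_rdensity// -integral_cst// -integralB_EFin//.
- by apply: eq_integral => x xA; rewrite /u indicE xA mulr1 EFinB.
- apply/integrableP; split; first exact: measurable_cst.
  rewrite (_ : (\int[leb]_(x in A) _)%E = (\int[leb]_(x in A) cst C%:E x)%E).
    by rewrite integral_cst// ltey_eq fA.
  by apply: eq_integral => x _; rewrite /= gtr0_norm.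
Qed.

Lemma change_density (u : T -> R) : rho.-integrable setT (EFin \o u) ->
  leb.-integrable setT (EFin \o (fun x => rdensity x * u x)) /\
  \int[leb]_x (rdensity x * u x) = \int[rho]_x u x.
Proof.
move=> iu; have mu := integrable_measurable iu; have mw := measurable_rdensity.
have E (v : T -> R) : rho.-integrable setT (EFin \o v) ->
    (\int[leb]_x (rdensity x * v x)%:E = \int[rho]_x (v x)%:E)%E.
  move=> iv; rewrite -(Radon_Nikodym_change_of_variables rho_dominated measurableT iv).
  by apply: eq_integral => x _ /=; rewrite mulrC EFinM EFin_rdensity.
have iN := integrable_norm iu.
split; last by rewrite /Rintegral E.
apply/integrableP; split; first by apply/measurable_EFinP; exact: measurable_funM.
rewrite (_ : (\int[leb]_x _)%E = (\int[leb]_x (rdensity x * `|u x|)%:E)%E).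
  rewrite (E (fun x => `|u x|))//; exact: integrable_lty.
apply: ae_eq_integral => //.
- exact: (measurableT_comp (@abse_measurable R setT) ((measurable_EFinP _ _).2 (measurable_funM mw mu))).
- exact: ((measurable_EFinP _ _).2 (measurable_funM mw (measurableT_comp (@normr_measurable R setT) mu))).
- by apply: filterS rdensity_ge0 => x w0 _ /=; rewrite normrM ger0_norm.
Qed.

Lemma cintegrable_density f : cintegrable rho f ->
  cintegrable leb (fun x => density rho x * f x).
Proof.
move=> [fr fi]; split.
- have [h _] := change_density fr; move: h; apply: eq_integrable => // x _ /=.
  by rewrite densityE ReM /= mul0r subr0.
- have [h _] := change_density fi; move: h; apply: eq_integrable => // x _ /=.
  by rewrite densityE ImM /= mul0r addr0.
Qed.

Lemma cintegral_density f : cintegrable rho f ->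
  cintegral leb (fun x => density rho x * f x) = cintegral rho f.
Proof.
move=> [fr fi]; apply: complexP => /=.
- rewrite -(change_density fr).2; apply: eq_Rintegral => x _.
  by rewrite densityE ReM /= mul0r subr0.
- rewrite -(change_density fi).2; apply: eq_Rintegral => x _.
  by rewrite densityE ImM /= mul0r addr0.
Qed.

Lemma cmeasurable_density : cmeasurable (density rho).
Proof. by apply: cmeasurable_real; exact: measurable_rdensity. Qed.

(** From [w^2 |f|^2 <= C w |f|^2]: multiplication by the density is bounded from L_2(rho) to
    L_2(R). *)
Lemma sqi_density f : sqi rho f -> sqi leb (fun x => density rho x * f x) /\
  nrm2 leb (fun x => density rho x * f x) <= C * nrm2 rho f.
Proof.
move=> [mf if_]; have [iwf ewf] := change_density if_.
have m : cmeasurable (fun x => density rho x * f x).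
  by apply: cmeasurableM => //; exact: cmeasurable_density.
have ae_le : {ae leb, forall x, normc (density rho x * f x) ^+ 2 <=
    C * (rdensity x * normc (f x) ^+ 2)}.
  apply: filterS2 rdensity_ge0 rdensity_le => x w0 wC.
  rewrite normcM densityE normc_real ger0_norm// exprMn expr2 -mulrA.
  by rewrite ler_wpM2r// mulr_ge0// sqr_ge0.
have s := sqi_le m (integrable_scale C iwf) ae_le.
split=> //; rewrite /nrm2 -ewf -RintegralZl//; case: s => _ is_.
by apply: ae_le_Rintegral => //; exact: integrable_scale.
Qed.

(** Boundedness of the embedding [J], by comparing the two measures directly. *)
Lemma sqi_rho k : sqi leb k -> sqi rho k /\ nrm2 rho k <= C * nrm2 leb k.
Proof.
move=> [mk ik]; have mk2 := measurable_sqr_normc mk.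
have mE : measurable_fun setT (fun x : T => (normc (k x) ^+ 2)%:E).
  by apply/measurable_EFinP.
have le_int : (\int[rho]_x (normc (k x) ^+ 2)%:E <= C%:E * \int[leb]_x (normc (k x) ^+ 2)%:E)%E.
  have C0' := ltW C0.
  have := @ge0_integral_mscale _ T R leb setT measurableT (NngNum C0') (fun x => (normc (k x) ^+ 2)%:E).
  rewrite /= => <-//; last by move=> x _; rewrite lee_fin sqr_ge0.
  apply: ge0_le_measure_integral => //.
    by move=> A mA; rewrite /mscale /=; exact: rho_le_leb.
  by move=> x; rewrite lee_fin sqr_ge0.
have fk : (\int[leb]_x (normc (k x) ^+ 2)%:E = (nrm2 leb k)%:E)%E.
  by rewrite /nrm2 /Rintegral fineK//; exact: integrable_fin_num.
rewrite fk -EFinM in le_int.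
have ir : rho.-integrable setT (EFin \o (fun x => normc (k x) ^+ 2)).
  apply/integrableP; split; first exact/measurable_EFinP.
  under eq_integral do rewrite gee0_abs ?lee_fin ?sqr_ge0//.
  exact: le_lt_trans le_int (ltry _).
split; first by [].
rewrite -lee_fin [X in (X <= _)%E](_ : _ = (\int[rho]_x (normc (k x) ^+ 2)%:E)%E)//.
by rewrite /nrm2 /Rintegral fineK//; exact: integrable_fin_num.
Qed.

Lemma sqi_cintegrable_rho f : sqi rho f -> cintegrable rho f.
Proof.
move=> [mf if_]; apply: (cintegrable_le mf (integrable_add (integrable_rho_cst rho 1) if_)) => x.
by have := normc_ge0 (f x); nra.
Qed.

End AbsoluteContinuity.

(** * Calculus of the Riesz projection *)

Section ProjectionOperators.
Context (R : realType).
Local Notation leb := (@lebesgue_measure R).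
Local Notation T := (measurableTypeR R).
Implicit Types (F G h k m f g : T -> R[i]).

Lemma conjcK_num (z : R[i]) : (z^*)^* = z.
Proof. by rewrite !conjcE conjcK. Qed.

Lemma cauchy_limit_ae_eq F h h' : decaying F -> cauchy_limit F h -> cmeasurable h' ->
  aeeq leb h h' -> cauchy_limit F h'.
Proof.
move=> dF [sh ch] mh' hh'; have sh' := sqi_ae_eq mh' hh' sh; split=> //.
rewrite /l2cvg (_ : (fun n => _) = (fun n => nrm2 leb (fun x => cauchy_tr (harm R n) F x - h x)))//.
apply/funext => n; have s := sqi_cauchy_tr (harm_gt0 R n) dF.
apply: nrm2_ae_eq; first by case: (sqiB s sh').
  by case: (sqiB s sh).
by apply: filterS hh' => x ->.
Qed.

Lemma cauchy_limit_Pplus F : decaying F -> cauchy_limit F (Pplus F).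
Proof.
move=> dF; have [h ch] := cauchy_limit_exists dF.
have oP := is_orthproj_Pplus dF; have [sF _ _] := dF.
have oh := is_orthproj_cauchy_limit dF ch.
apply: (cauchy_limit_ae_eq dF ch).
  by move: oP; rewrite hardy_plusE => -[[[]]].
exact: is_orthproj_unique sF oh oP.
Qed.

Lemma cauchy_null_Pplus F : decaying F -> cauchy_null (Pplus F).
Proof. by move=> dF; exact: cauchy_limit_null (cauchy_limit_Pplus dF). Qed.

Lemma sqi_Pplus F : decaying F -> sqi leb (Pplus F).
Proof. by move=> /cauchy_null_Pplus []. Qed.

Lemma cauchy_nullD h k : cauchy_null h -> cauchy_null k ->
  cauchy_null (fun x => h x + k x).
Proof.
move=> [sh h0] [sk k0]; split; first exact: sqiD.
move=> a a0; have sa : sqi leb (ckernel a) by apply: sqi_ckernel; rewrite lt_eqF.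
rewrite (_ : cintegral _ _ = cintegral leb (fun x => h x * ckernel a x + k x * ckernel a x)).
  by rewrite (cintegralD (cintegrableM sh sa) (cintegrableM sk sa)) h0// k0// addr0.
by apply: eq_cintegral => x; rewrite mulrDl.
Qed.

Lemma cauchy_nullZ (a : R[i]) h : cauchy_null h -> cauchy_null (fun x => a * h x).
Proof.
move=> [sh h0]; split; first exact: sqiZ.
move=> b b0; have sb : sqi leb (ckernel b) by apply: sqi_ckernel; rewrite lt_eqF.
rewrite (_ : cintegral _ _ = cintegral leb (fun x => a * (h x * ckernel b x))).
  by rewrite (cintegralZ _ (cintegrableM sh sb)) h0// mulr0.
by apply: eq_cintegral => x; rewrite mulrA.
Qed.

Lemma Pplus_decomposition F : decaying F ->
  aeeq leb F (fun x => Pplus F x + (Pplus (fun t => (F t)^*) x)^*).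
Proof.
move=> dF; apply: cauchy_limit_decomposition => //; first exact: cauchy_limit_Pplus.
exact/cauchy_limit_Pplus/decaying_conj.
Qed.

(** The device for computing projections: split off a Hardy part so that the rest is the conjugate
    of a function bilinearly orthogonal to the Hardy space. *)
Lemma Pplus_eq F h k : sqi leb F -> cauchy_null h -> sqi leb k ->
  (forall l, cauchy_null l -> cintegral leb (fun x => k x * l x) = 0) ->
  aeeq leb F (fun x => h x + (k x)^*) -> aeeq leb (Pplus F) h.
Proof.
move=> sF hn sk k0 Fhk; have [sh _] := hn.
apply: Pplus_ae => //; rewrite hardy_plusE; split=> // l ln; have [sl _] := ln.
rewrite /inner (@ae_eq_cintegral _ _ _ leb _ (fun x => (k x * l x)^*)).
- rewrite cintegral_conj; last exact: cintegrableM.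
  by rewrite k0// conjcE conjc0.
- apply: cmeasurableM; first by case: (sqiB sF sh).
  by case: (sqi_conj sl).
- by apply: cmeasurable_conj; apply: cmeasurableM; [case: sk|case: sl].
- by apply: filterS Fhk => x ->; rewrite addrC addKr conjcM.
Qed.

(** Linearity holds only almost everywhere, since [Pplus] picks a representative for each function;
    it follows by adding the two decompositions. *)
Lemma Pplus_lin (a : R[i]) F G : decaying F -> decaying G ->
  aeeq leb (Pplus (fun x => a * F x + G x)) (fun x => a * Pplus F x + Pplus G x).
Proof.
move=> dF dG; have [sF _ _] := dF; have [sG _ _] := dG.
have dF' := decaying_conj dF; have dG' := decaying_conj dG.
have sF' := sqi_Pplus dF'; have sG' := sqi_Pplus dG'.
apply: (@Pplus_eq _ _ (fun x => a^* * Pplus (fun t => (F t)^*) x + Pplus (fun t => (G t)^*) x)).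
- by apply: sqiD => //; exact: sqiZ.
- by apply: cauchy_nullD; [apply: cauchy_nullZ|]; exact: cauchy_null_Pplus.
- by apply: sqiD => //; exact: sqiZ.
- move=> l ln; have [sl _] := ln.
  have i1 := cintegrableM sF' sl; have i2 := cintegrableM sG' sl.
  rewrite (_ : cintegral _ _ = cintegral leb (fun x =>
    a^* * (Pplus (fun t => (F t)^*) x * l x) + Pplus (fun t => (G t)^*) x * l x)).
    rewrite (cintegralD (cintegrableZ _ i1) i2) (cintegralZ _ i1).
    rewrite (cauchy_limit_null_integral dF' (cauchy_limit_Pplus dF') ln).
    by rewrite (cauchy_limit_null_integral dG' (cauchy_limit_Pplus dG') ln) mulr0 addr0.
  by apply: eq_cintegral => x; rewrite mulrDl mulrA.
- apply: filterS2 (Pplus_decomposition dF) (Pplus_decomposition dG) => x {1}-> {1}->.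
  by rewrite conjcD conjcM conjcK_num; ring.
Qed.

(** Orthogonality makes the squared norm of [Pplus F] equal to its pairing with [F]; Cauchy-Schwarz
    concludes. *)
Lemma nrm2_Pplus_le F : decaying F -> nrm2 leb (Pplus F) <= nrm2 leb F.
Proof.
move=> dF; have [sF _ _] := dF; have sP := sqi_Pplus dF.
have [_ oP] := is_orthproj_Pplus dF.
have hP : @hardy_plus R (Pplus F) by rewrite hardy_plusE; exact: cauchy_null_Pplus.
have c1 := sqi_conj sP.
have E : (nrm2 leb (Pplus F))%:C = cintegral leb (fun x => F x * (Pplus F x)^*).
  rewrite /nrm2 -cintegral_real.
  have i1 := cintegrableM sF c1; have i2 := cintegrableM (sqiB sF sP) c1.
  rewrite (_ : cintegral _ (fun x => F x * _) = cintegral leb (fun x => F x * (Pplus F x)^*) -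
    inner leb (fun x => F x - Pplus F x) (Pplus F)); last by rewrite oP// subr0.
  rewrite /inner -(cintegralB i1 i2); apply: eq_cintegral => x.
  by rewrite -mulc_conj; ring.
have := cauchy_schwarz sF c1; rewrite -E normc_real nrm2_conj ger0_norm ?nrm2_ge0//.
have nF := @nrm2_ge0 _ _ _ leb F; have p0 := @nrm2_ge0 _ _ _ leb (Pplus F).
have [n0|n0] := eqVneq (nrm2 leb (Pplus F)) 0; first by rewrite n0.
have pp : 0 < nrm2 leb (Pplus F) by rewrite lt_def n0.
by rewrite expr2 ler_pM2r.
Qed.

End ProjectionOperators.

(** * Operators bounded in the squared norm *)

Section BoundedOperators.
Context d (T : measurableType d) (R : realType).
Variable mu : {measure set T -> \bar R}.
Implicit Types (S V : (T -> R[i]) -> T -> R[i]).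

Definition sq_bounded S (K : R) : Prop :=
  [/\ forall f, sqi mu f -> sqi mu (S f),
      forall (a : R[i]) f g, sqi mu f -> sqi mu g ->
        aeeq mu (S (fun x => a * f x + g x)) (fun x => a * S f x + S g x),
      0 <= K & forall f, sqi mu f -> nrm2 mu (S f) <= K * nrm2 mu f].

(** Compatibility with almost-everywhere equality comes from linearity and the bound: [S (f - g)]
    has norm zero. *)
Lemma sq_bounded_ae S K f g : sq_bounded S K -> sqi mu f -> sqi mu g ->
  aeeq mu f g -> aeeq mu (S f) (S g).
Proof.
move=> [sS lS _ bS] sf sg fg.
have sfg := sqiB sf sg.
have n0 : nrm2 mu (fun x => f x - g x) = 0.
  rewrite (@nrm2_ae_eq _ _ _ mu _ (fun=> 0)).
  - by rewrite /nrm2 normc0 expr0n /Rintegral integral0.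
  - by case: sfg.
  - exact: cmeasurable_cst.
  - by apply: filterS fg => x ->; rewrite subrr.
have z0 : aeeq mu (S (fun x => f x - g x)) (fun=> 0).
  apply: nrm2_eq0; first exact: sS.
  by apply/eqP; rewrite eq_le nrm2_ge0 andbT; have := bS _ sfg; rewrite n0 mulr0.
have := lS (-1) g f sg sf.
have -> : (fun x => -1 * g x + f x) = (fun x => f x - g x).
  by apply/funext => x; rewrite mulN1r addrC.
move: z0; apply: filterS2 => x -> /eqP.
by rewrite mulN1r addrC eq_sym subr_eq0 => /eqP.
Qed.

Lemma sq_bounded_opnorm S K M : sq_bounded S K -> 0 <= M -> K <= M ^+ 2 ->
  opnorm_le mu S M.
Proof.
move=> [sS _ _ bS] M0 KM; apply: opnorm_le_nrm2 => // f sf.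
by rewrite (le_trans (bS f sf))// ler_wpM2r// nrm2_ge0.
Qed.

Lemma sq_bounded_op S K : sq_bounded S K -> bounded_op mu S.
Proof.
move=> h; have [sS lS K0 bS] := h; split.
- by move=> f /memL2P sf; apply/memL2P; exact: sS.
- by move=> f g /memL2P sf /memL2P sg; exact: sq_bounded_ae h sf sg.
- by move=> a f g /memL2P sf /memL2P sg; exact: lS.
- by exists (Num.sqrt K); apply: (sq_bounded_opnorm h); rewrite ?sqrtr_ge0// sqr_sqrtr.
Qed.

Lemma sq_bounded_idD S K (a : R[i]) : sq_bounded S K ->
  sq_bounded (fun f x => f x + a * S f x) (2 + 2 * (normc a ^+ 2 * K)).
Proof.
move=> [sS lS K0 bS]; split.
- by move=> f sf; apply: sqiD => //; apply: sqiZ; exact: sS.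
- move=> b f g sf sg; apply: filterS (lS b f g sf sg) => x ->; ring.
- by rewrite addr_ge0// mulr_ge0// mulr_ge0// sqr_ge0.
- move=> f sf; apply: (le_trans (nrm2D sf (sqiZ a (sS f sf)))).
  rewrite nrm2Z; last exact: sS.
  rewrite [leRHS](_ : _ = 2 * nrm2 mu f + 2 * (normc a ^+ 2 * (K * nrm2 mu f))); last by ring.
  by rewrite lerD2l ler_wpM2l// ler_wpM2l ?sqr_ge0//; exact: bS.
Qed.

End BoundedOperators.

(** * The operators [U]: bounds, unitarity, intertwining, holomorphy *)

Section PerturbedMultiplication.
Context (R : realType).
Local Notation leb := (@lebesgue_measure R).
Local Notation T := (measurableTypeR R).
Variable rho : {finite_measure set T -> \bar R}.
Variables M N : R.
Hypothesis M0 : 0 < M.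
Hypothesis rhoM : forall l : R[i], 0 < complex.Im l -> normc (borel_transform rho l) <= M.
Hypothesis rhoN : {ae rho, forall t : T, `|t : R| <= N}.
Implicit Types (f g h k m : T -> R[i]) (z c : R[i]).

Let C := M / pi.
Let C0 : 0 < C. Proof. by rewrite divr_gt0// pi_gt0. Qed.
Let oc := rho_oc_le rhoM.
Let w := density rho.
Let p := Pplus (density rho).
Let rae (P : T -> Prop) (h : {ae leb, forall x, P x}) : {ae rho, forall x, P x} := rho_ae C0 oc h.

Lemma sqi_mul_id f : sqi rho f -> sqi rho (fun t : T => (t : R)%:C * f t).
Proof.
apply: (sqi_ae_bounded (M := N)); first exact: cmeasurable_real.
by apply: filterS rhoN => t; rewrite normc_real.
Qed.

(** Finiteness of [rho] puts [f] in L_1(rho), and the bounded support does the same for [t f]. *)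
Lemma decaying_density f : sqi rho f -> decaying (fun x => w x * f x).
Proof.
move=> sf; split; first exact: (sqi_density C0 oc sf).1.
  exact: (cintegrable_density C0 oc (sqi_cintegrable_rho sf)).
apply: (cintegrable_eq _ (cintegrable_density C0 oc (sqi_cintegrable_rho (sqi_mul_id sf)))) => t.
exact: mulrCA.
Qed.

Lemma sqi_rho1 : sqi rho (fun _ : T => 1 : R[i]).
Proof.
split; first exact: cmeasurable_cst.
have := integrable_rho_cst rho 1; apply: eq_integrable => // x _.
by rewrite [RHS]/comp [in RHS]normc1 expr1n.
Qed.

Lemma decaying_w : decaying w.
Proof.
have := decaying_density sqi_rho1; congr decaying.
by apply/funext => x; rewrite mulr1.
Qed.

Lemma normc_twopii : normc (twopii R) = 2 * pi.
Proof.
rewrite twopiiE normcM normc_real ger0_norm ?mulr_ge0 ?pi_ge0//.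
by rewrite [normc 'i]/= expr0n expr1n add0r sqrtr1 mulr1.
Qed.

(** The Cauchy integrals of the density are values of the Borel transform of [rho] divided by
    [2 pi i]; the uniform bound survives the limit. *)
Lemma Pplus_density_bounded : {ae leb, forall x, normc (p x) <= M / (2 * pi)}.
Proof.
apply: (cauchy_limit_bounded decaying_w (cauchy_limit_Pplus decaying_w)) => n x.
have b0 : 0 < complex.Im ((x : R) +i* harm R n) by exact: harm_gt0.
have bn0 : complex.Im ((x : R) +i* harm R n) != 0 by rewrite gt_eqF.
have ik : cintegrable rho (ckernel ((x : R) +i* harm R n)).
  apply: (cintegrable_le (cmeasurable_ckernel _) (integrable_rho_cst rho
    `|complex.Im ((x : R) +i* harm R n)|^-1)) => t.
  exact: ckernel_bounded.
rewrite /cauchy_tr (cintegral_density C0 oc ik) normcM normcV normc_twopii mulrC.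
rewrite ler_wpM2r ?invr_ge0 ?mulr_ge0 ?pi_ge0//.
exact: rhoM.
Qed.

Lemma cmeasurable_Pplus_density : cmeasurable p.
Proof. by have [] := sqi_Pplus decaying_w. Qed.

Lemma density_eq_Pplus : aeeq leb w (fun x => p x + (p x)^*).
Proof.
have := Pplus_decomposition decaying_w.
have -> : (fun t => (w t)^*) = w by apply/funext => t; rewrite /w densityE conjc_realc.
by [].
Qed.

(** The threshold at which [|2 pi i z p| <= 1/2], hence [|psi| <= 2]. *)
Definition small z := normc z <= (2 * M)^-1.

Lemma small_bounded z : small z ->
  {ae leb, forall x, normc (twopii R * z * p x) <= 2^-1}.
Proof.
move=> sz; apply: filterS Pplus_density_bounded => x px.
rewrite 2!normcM normc_twopii; have p0 := pi_gt0 R.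
have h : normc z * normc (p x) <= (2 * M)^-1 * (M / (2 * pi)).
  by apply: ler_pM => //; exact: normc_ge0.
rewrite -mulrA; apply: (@le_trans _ _ (2 * pi * ((2 * M)^-1 * (M / (2 * pi))))).
  by rewrite ler_wpM2l// mulr_ge0// ltW.
have p1 : pi != 0 :> R by rewrite gt_eqF.
have M1 : M != 0 by rewrite gt_eqF.
have p2 : 2 * pi != 0 :> R by rewrite mulf_neq0.
rewrite le_eqVlt; apply/orP; left; apply/eqP.
by rewrite mulrCA [2 * pi * _]mulrC divfK// [(2 * M)^-1](invfM 2 M) divfK.
Qed.

Lemma psiE z x : psi rho z x = (1 + twopii R * z * p x)^-1.
Proof. by []. Qed.

Lemma cmeasurable_q z : cmeasurable (fun x => twopii R * z * p x).
Proof.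
by apply: cmeasurableM; [exact: cmeasurable_cst|exact: cmeasurable_Pplus_density].
Qed.

Lemma cmeasurable_psi z : cmeasurable (psi rho z).
Proof.
apply: cmeasurableV; apply: cmeasurableD; first exact: cmeasurable_cst.
exact: cmeasurable_q.
Qed.

Lemma psi_ae z : small z -> {ae leb, forall x,
  1 + twopii R * z * p x != 0 /\ normc (psi rho z x) <= 2}.
Proof.
move=> sz; apply: filterS (small_bounded sz) => x qx.
exact: (normc_inv1D (q := fun x : T => twopii R * z * p x)).
Qed.

Lemma psi_le2 z : small z -> {ae leb, forall x, normc (psi rho z x) <= 2}.
Proof. by move=> /psi_ae; apply: filterS => x []. Qed.

Lemma psi_boundedP z : small z -> psi_bounded rho z.
Proof.
move=> sz; split; first by apply: filterS (psi_ae sz) => x [].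
split; first exact: cmeasurable_psi.
rewrite /Lpnorm unlock; case: ifP => _; last exact: ltry.
apply: (@le_lt_trans _ _ 2%:E); last exact: ltry.
apply/ess_supP; apply: filterS (psi_le2 sz) => x h /=.
by rewrite lee_fin ger0_norm// normc_ge0.
Qed.

Lemma cauchy_null_q z h : cauchy_null h -> cauchy_null (fun x => twopii R * z * p x * h x).
Proof.
move=> hn; have := cauchy_nullZ (twopii R * z)
  (cauchy_null_mul decaying_w (cauchy_limit_Pplus decaying_w) Pplus_density_bounded hn).
by congr cauchy_null; apply/funext => x; rewrite mulrA.
Qed.

Lemma cauchy_null_psi z h : small z -> cauchy_null h -> cauchy_null (fun x => psi rho z x * h x).
Proof.
move=> sz; apply: (cauchy_null_inv1D (cmeasurable_q z) (small_bounded sz)).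
by move=> k; exact: cauchy_null_q.
Qed.

Lemma cauchy_null_phi z h : cauchy_null h ->
  cauchy_null (fun x => (1 + twopii R * z * p x) * h x).
Proof.
move=> hn; have := cauchy_nullD hn (cauchy_null_q z hn).
by congr cauchy_null; apply/funext => x; rewrite mulrDl mul1r.
Qed.

Definition Qproj f : T -> R[i] := Pplus (fun x => w x * f x).

Lemma sqi_Qproj f : sqi rho f -> sqi leb (Qproj f).
Proof. by move=> /decaying_density /sqi_Pplus. Qed.

(** Up to the identity and scalar factors, [U], its adjoint, its derivative in [z] and the error of
    the difference quotient all have this form, so one norm bound serves them all. *)
Definition mQm m m' f : T -> R[i] := fun x => m x * Qproj (fun y => m' y * f y) x.

(** Multiplication by the density into L_2(R) and the embedding back into L_2(rho) cost [sqrt C]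
    each. *)
Lemma mQm_bounded m m' (B B' : R) : cmeasurable m -> cmeasurable m' ->
  {ae leb, forall x, normc (m x) <= B} -> {ae leb, forall x, normc (m' x) <= B'} ->
  sq_bounded rho (mQm m m') ((C * B * B') ^+ 2).
Proof.
move=> mm mm' mB mB'.
have sm' f : sqi rho f -> sqi rho (fun y => m' y * f y).
  by move=> sf; exact: sqi_ae_bounded mm' (rae mB') sf.
have sQ f : sqi rho f -> sqi leb (mQm m m' f).
  by move=> sf; exact: sqi_ae_bounded mm mB (sqi_Qproj (sm' f sf)).
split.
- by move=> f /sQ sf; exact: (sqi_rho C0 oc sf).1.
- move=> a f g sf sg; apply: rae.
  have dF := decaying_density (sm' f sf); have dG := decaying_density (sm' g sg).
  apply: filterS (Pplus_lin a dF dG) => x; rewrite /mQm /Qproj => h.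
  rewrite [Pplus _ x](_ : _ = Pplus (fun x0 => a * (w x0 * (m' x0 * f x0)) + w x0 * (m' x0 * g x0)) x).
    by rewrite h; ring.
  by congr (Pplus _ x); apply/funext => y; ring.
- exact: sqr_ge0.
- move=> f sf; have [_ h1] := sqi_rho C0 oc (sQ f sf); apply: (le_trans h1).
  have h2 := nrm2_ae_bounded mm mB (sqi_Qproj (sm' f sf)).
  have h3 := nrm2_Pplus_le (decaying_density (sm' f sf)).
  have [_ h4] := sqi_density C0 oc (sm' f sf).
  have h5 := nrm2_ae_bounded mm' (rae mB') sf.
  rewrite [leRHS](_ : _ = C * (B ^+ 2 * (C * (B' ^+ 2 * nrm2 rho f)))); last by ring.
  apply: ler_wpM2l; first exact: ltW.
  apply: (le_trans h2); apply: ler_wpM2l; first exact: sqr_ge0.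
  apply: (le_trans h3); apply: (le_trans h4); apply: ler_wpM2l; first exact: ltW.
  exact: h5.
Qed.

Let g1 : T -> R[i] := fun=> 1.

Lemma UplusE z f : Uplus rho g1 z f = (fun x => f x + - twopii R * z * mQm (psi rho z) g1 f x).
Proof.
apply/funext => x; rewrite /Uplus /J /mult /mQm /Qproj /g1 mulr1.
rewrite -mulNr -mulNr; congr (_ + _ * (_ * Pplus _ x)); apply/funext => y.
by rewrite mul1r conjcE conjc1 mul1r.
Qed.

Lemma g1_bounded : {ae leb, forall x, normc (g1 x) <= 1}.
Proof. by apply: aeW => x; rewrite /g1 normc1. Qed.

Lemma cmeasurable_g1 : cmeasurable g1.
Proof. exact: cmeasurable_cst. Qed.

Lemma Uplus_bounded z : small z -> exists K, sq_bounded rho (Uplus rho g1 z) K.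
Proof.
move=> sz; have := sq_bounded_idD (- twopii R * z) (mQm_bounded (cmeasurable_psi z)
  cmeasurable_g1 (psi_le2 sz) g1_bounded).
set K := (X in sq_bounded _ _ X) => h; exists K.
rewrite (_ : Uplus rho g1 z = (fun f x => f x + - twopii R * z * mQm (psi rho z) g1 f x))//.
by apply/funext => f; exact: UplusE.
Qed.

Let rsqi_mul m f (B : R) : cmeasurable m -> {ae leb, forall x, normc (m x) <= B} ->
  sqi rho f -> sqi rho (fun x => m x * f x).
Proof. by move=> mm mB; exact: sqi_ae_bounded mm (rae mB). Qed.

(** The density turns the inner product of L_2(rho) into that of L_2(R); being real it can be moved
    to the other factor, where self-adjointness of [P_+] applies. *)
Lemma mQm_adjoint m m' (B B' : R) f h : cmeasurable m -> cmeasurable m' ->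
  {ae leb, forall x, normc (m x) <= B} -> {ae leb, forall x, normc (m' x) <= B'} ->
  sqi rho f -> sqi rho h ->
  inner rho (mQm m m' f) h =
  inner rho f (mQm (fun x => (m' x)^*) (fun x => (m x)^*) h).
Proof.
move=> mm mm' mB mB' sf sh.
have mc := cmeasurable_conj mm; have mc' := cmeasurable_conj mm'.
have mcB : {ae leb, forall x, normc ((m x)^*) <= B} by apply: filterS mB => x; rewrite normc_conj.
have mcB' : {ae leb, forall x, normc ((m' x)^*) <= B'} by apply: filterS mB' => x; rewrite normc_conj.
have s1 := rsqi_mul mm' mB' sf; have s2 := rsqi_mul mc mcB sh.
have d1 := decaying_density s1; have d2 := decaying_density s2.
have [w1 _ _] := d1; have [w2 _ _] := d2.
have [l1 _ _ _] := mQm_bounded mm mm' mB mB'.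
have [l2 _ _ _] := mQm_bounded mc' mc mcB' mcB.
have := inner_orthproj w1 w2 (is_orthproj_Pplus d1) (is_orthproj_Pplus d2).
rewrite /inner => E.
rewrite -(cintegral_density C0 oc (cintegrableM (l1 f sf) (sqi_conj sh))).
rewrite -(cintegral_density C0 oc (cintegrableM sf (sqi_conj (l2 h sh)))).
transitivity (cintegral leb (fun x => Pplus (fun x0 => w x0 * (m' x0 * f x0)) x *
    (w x * ((m x)^* * h x))^*)).
  apply: eq_cintegral => x; rewrite /mQm /Qproj !conjcM conjcK_num {3}/w densityE conjc_realc.
  by rewrite -densityE; ring.
rewrite E; apply: eq_cintegral => x; rewrite /mQm /Qproj !conjcM conjcK_num.
by rewrite /w; ring.
Qed.

Section RealParameter.
Variable c : R.
Hypothesis sc : small c%:C.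
Let dc := twopii R * c%:C.
Let U := Uplus rho g1 c%:C.
Let ps := psi rho c%:C.

Definition Uplus_adj f : T -> R[i] :=
  fun x => f x + twopii R * c%:C * mQm g1 (fun y => (psi rho c%:C y)^*) f x.

Let mps : cmeasurable ps. Proof. exact: cmeasurable_psi. Qed.
Let bps : {ae leb, forall x, normc (ps x) <= 2}. Proof. exact: psi_le2. Qed.
Let mpc : cmeasurable (fun x => (ps x)^*). Proof. exact: cmeasurable_conj. Qed.
Let bpc : {ae leb, forall x, normc ((ps x)^*) <= 2}.
Proof. by apply: filterS bps => x; rewrite normc_conj. Qed.

Lemma Uplus_adj_bounded : exists K, sq_bounded rho Uplus_adj K.
Proof.
have := sq_bounded_idD (twopii R * c%:C)
  (mQm_bounded cmeasurable_g1 mpc g1_bounded bpc).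
by set K := (X in sq_bounded _ _ X) => h; exists K.
Qed.

Lemma conjc_twopii : (twopii R)^* = - twopii R.
Proof. by rewrite twopiiE conjcE; apply: complexP => /=; ring. Qed.

Lemma Uplus_sqi f : sqi rho f -> sqi rho (U f).
Proof. by have [K []] := Uplus_bounded sc => h _ _ _; exact: h. Qed.

Lemma Uplus_adj_sqi f : sqi rho f -> sqi rho (Uplus_adj f).
Proof. by have [K []] := Uplus_adj_bounded => h _ _ _; exact: h. Qed.

Lemma dc_conj : dc^* = - dc.
Proof. by rewrite conjcM conjc_twopii conjc_realc mulNr. Qed.

Lemma inner_Uplus f h : sqi rho f -> sqi rho h -> inner rho (U f) h = inner rho f (Uplus_adj h).
Proof.
move=> sf sh; have E := mQm_adjoint mps cmeasurable_g1 bps g1_bounded sf sh.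
have [l1 _ _ _] := mQm_bounded mps cmeasurable_g1 bps g1_bounded.
have [l2 _ _ _] := mQm_bounded cmeasurable_g1 mpc g1_bounded bpc.
have i0 := cintegrableM sf (sqi_conj sh).
have i1 := cintegrableM (l1 f sf) (sqi_conj sh).
have i2 := cintegrableM sf (sqi_conj (l2 h sh)).
transitivity (inner rho f h + - dc * inner rho (mQm ps g1 f) h).
  rewrite /inner -(cintegralZ _ i1) -(cintegralD i0 (cintegrableZ _ i1)).
  by apply: eq_cintegral => x; rewrite /U UplusE mulrDl mulrA mulNr.
rewrite E (_ : (fun x => (g1 x)^*) = g1); last first.
  by apply/funext => x; rewrite /g1 conjcE conjc1.
rewrite /inner -(cintegralZ _ i2) -(cintegralD i0 (cintegrableZ _ i2)).
apply: eq_cintegral => x; rewrite /Uplus_adj conjcD conjcM -/dc dc_conj.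
by rewrite mulrDr; congr (_ + _); rewrite mulrCA.
Qed.

Let ph x := 1 + dc * p x.

Lemma phiB : {ae leb, forall x, [/\ ph x != 0, ps x = (ph x)^-1,
  (ps x)^* = ((ph x)^*)^-1 & dc * w x = ph x - (ph x)^*]}.
Proof.
apply: filterS2 (psi_ae sc) density_eq_Pplus => x [p0 _] wE; split=> //.
  by rewrite /ps psiE fmorphV.
by rewrite wE /ph conjcD conjcM dc_conj rmorph1; ring.
Qed.

(** Let [w f = P + conj P'] be the splitting and [q = conj phi]. Since
    [d w / (q phi) = 1 / q - 1 / phi], the function [w conj psi (U f)] equals
    [psi P + conj (psi P')], and [psi] preserves the Hardy space. *)
Lemma Qproj_Uplus f : sqi rho f ->
  aeeq leb (Qproj (fun y => (ps y)^* * U f y)) (fun x => ps x * Qproj f x).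
Proof.
move=> sf; have dF := decaying_density sf.
have dF' := decaying_conj dF.
have nF := cauchy_null_Pplus dF; have nF' := cauchy_null_Pplus dF'.
have dU := decaying_density (rsqi_mul mpc bpc (Uplus_sqi sf)).
have [sU _ _] := dU.
apply: (Pplus_eq (k := fun x => ps x * Pplus (fun t => (w t * f t)^*) x)) => //.
- exact: (cauchy_null_psi sc nF).
- exact: (sqi_ae_bounded mps bps (sqi_Pplus dF')).
- move=> l ln; have ln' := cauchy_null_psi sc ln.
  rewrite -(cauchy_limit_null_integral dF' (cauchy_limit_Pplus dF') ln').
  by apply: eq_cintegral => x; rewrite -mulrA mulrCA.
- apply: filterS2 phiB (Pplus_decomposition dF) => x [p0 E1 E2 E3] FE.
  rewrite /U UplusE /mQm /Qproj.
  have -> : (fun x0 => w x0 * (g1 x0 * f x0)) = (fun x0 => w x0 * f x0).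
    by apply/funext => y; rewrite mul1r.
  rewrite conjcM -/ps mulNr -/dc E2 E1.
  have q0 : (ph x)^* != 0 by rewrite fmorph_eq0.
  set P := Pplus _ x; set P' := Pplus _ x.
  transitivity (((ph x)^*)^-1 * (w x * f x) - (dc * w x) * ((ph x)^*)^-1 * (ph x)^-1 * P).
    by ring.
  rewrite E3 FE -/P -/P'; move: (ph x)^* q0 => q q0; by field; rewrite p0 q0.
Qed.

Lemma Uplus_adjK f : sqi rho f -> aeeq rho (Uplus_adj (U f)) f.
Proof.
move=> sf; apply: rae; apply: filterS (Qproj_Uplus sf) => x h.
rewrite /Uplus_adj /mQm h /U UplusE /mQm.
have -> : Qproj (fun y => g1 y * f y) = Qproj f.
  by rewrite /Qproj; congr Pplus; apply/funext => y; rewrite mul1r.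
by rewrite -/ps /g1; ring.
Qed.

(** With [w conj psi h = P + conj P'], the relation [d w = phi - conj phi] gives
    [w (V h) = phi P + conj (phi P')], and [phi] preserves the Hardy space. *)
Lemma Qproj_Uplus_adj h : sqi rho h ->
  aeeq leb (Qproj (Uplus_adj h)) (fun x => ph x * Qproj (fun y => (ps y)^* * h y) x).
Proof.
move=> sh; have dG := decaying_density (rsqi_mul mpc bpc sh).
have dG' := decaying_conj dG.
have nG := cauchy_null_Pplus dG; have nG' := cauchy_null_Pplus dG'.
have [sV _ _] := decaying_density (Uplus_adj_sqi sh).
have nk : cauchy_null (fun x => ph x * Pplus (fun t => (w t * ((ps t)^* * h t))^*) x).
  exact: (cauchy_null_phi c%:C nG').
apply: (@Pplus_eq _ (fun x => w x * Uplus_adj h x)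
  (fun x => ph x * Pplus (fun y => w y * ((ps y)^* * h y)) x)
  (fun x => ph x * Pplus (fun t => (w t * ((ps t)^* * h t))^*) x)).
- exact: sV.
- exact: (cauchy_null_phi c%:C nG).
- by case: nk.
- move=> l ln; have ln' : cauchy_null (fun x => ph x * l x) by exact: (cauchy_null_phi c%:C ln).
  rewrite -(cauchy_limit_null_integral dG' (cauchy_limit_Pplus dG') ln').
  by apply: eq_cintegral => x; rewrite -mulrA mulrCA.
- apply: filterS2 phiB (Pplus_decomposition dG) => x [p0 E1 E2 E3] FE.
  rewrite /Uplus_adj /mQm /Qproj -/dc -/ps /g1 mul1r conjcM.
  have q0 : (ph x)^* != 0 by rewrite fmorph_eq0.
  move: FE; set P := Pplus _ x; set P' := Pplus _ x => FE.
  transitivity ((ph x)^* * (w x * ((ps x)^* * h x)) + (dc * w x) * P).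
    by rewrite E2; move: (ph x)^* q0 => q q0; field.
  by rewrite E3 FE; ring.
Qed.

Lemma Uplus_adjKV h : sqi rho h -> aeeq rho (U (Uplus_adj h)) h.
Proof.
move=> sh; apply: rae; apply: filterS2 phiB (Qproj_Uplus_adj sh) => x [p0 E1 _ _] E.
rewrite /U UplusE /mQm.
have -> : Qproj (fun y => g1 y * Uplus_adj h y) = Qproj (Uplus_adj h).
  by rewrite /Qproj; congr Pplus; apply/funext => y; rewrite mul1r.
rewrite E {1}/Uplus_adj /mQm -/ps E1 /g1 mul1r [X in - _ * _ * X]mulrA mulVf// mul1r.
by ring.
Qed.

(** Isometry is the left inverse property of the adjoint; surjectivity is the right inverse
    property. *)
Lemma Uplus_unitary : unitary_op rho U.
Proof.
have [K bU] := Uplus_bounded sc; split; first exact: sq_bounded_op bU.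
- move=> f h /memL2P sf /memL2P sh; have sU := Uplus_sqi sh.
  rewrite (inner_Uplus sf sU) /inner; apply: ae_eq_cintegral.
  + exact: (cintegrable_cmeasurable (cintegrableM sf (sqi_conj (Uplus_adj_sqi sU)))).
  + exact: (cintegrable_cmeasurable (cintegrableM sf (sqi_conj sh))).
  + by apply: filterS (Uplus_adjK sh) => x ->.
- move=> h /memL2P sh; exists (Uplus_adj h); first exact/memL2P/Uplus_adj_sqi.
  exact: Uplus_adjKV.
Qed.

Lemma perturb_sqi f : sqi rho f -> sqi rho (perturb (@opA R) (rank_one rho g1) c f).
Proof.
move=> sf; apply: sqiD; first exact: sqi_mul_id.
by apply: sqiZ; apply: sqiZ; exact: sqi_rho1.
Qed.

(** Let [I] be the integral of [f] against [rho]. Commuting [x] past [P_+] contributes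
    [d psi I / (2 pi i) = c psi I]. On the other side the rank-one term contributes
    [c I (1 - d psi p)], which is the same because [1 - d psi p = psi]. *)
Lemma opA_Uplus f : sqi rho f ->
  aeeq rho (opA (U f)) (U (perturb (@opA R) (rank_one rho g1) c f)).
Proof.
move=> sf; apply: rae.
have dF := decaying_density sf; have sxf := sqi_mul_id sf.
have dxF' := decaying_density sxf.
have exF : (fun t : T => (t : R)%:C * (w t * f t)) = (fun t : T => w t * ((t : R)%:C * f t)).
  by apply/funext => t; rewrite mulrCA.
have dxF : decaying (fun t : T => (t : R)%:C * (w t * f t)) by rewrite exF.
pose I := inner rho f g1.
have IE : cintegral leb (fun x => w x * f x) = I.
  rewrite (cintegral_density C0 oc (sqi_cintegrable_rho sf)) /I /inner.
  by apply: eq_cintegral => x; rewrite /g1 conjcE conjc1 mulr1.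
have shift := cauchy_limit_shift dF dxF (cauchy_limit_Pplus dF) (cauchy_limit_Pplus dxF).
have lin := Pplus_lin (c%:C * I) decaying_w dxF.
apply: filterS3 phiB shift lin => x [p0 E1 _ _] E2 E3.
rewrite /opA /mult /U !UplusE /mQm -/ps /Qproj.
rewrite (_ : (fun y => w y * (g1 y * perturb _ _ _ _ y)) =
  (fun y : T => c%:C * I * w y + (y : R)%:C * (w y * f y))); last first.
  by apply/funext => y; rewrite /perturb /mult /rank_one -/I /g1 !mul1r mulr1; ring.
rewrite (_ : (fun y => w y * (g1 y * f y)) = (fun y => w y * f y)); last first.
  by apply/funext => y; rewrite /g1 mul1r.
rewrite E3 -/p /perturb /rank_one -/I /mult E1.
move: E2; rewrite IE; set P := Pplus _ x; set P' := Pplus _ x => E2.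
have -> : P' = (x : R)%:C * P + (twopii R)^-1 * I by rewrite E2 subrK.
move: p0; rewrite /ph /dc /g1 => p0; have t0 := twopii_neq0 R.
by field; rewrite t0 p0.
Qed.

Lemma Uplus_conjugate :
  conjugate_by rho U (@opA R) (perturb (@opA R) (rank_one rho g1) c).
Proof.
have [K bV] := Uplus_adj_bounded; exists Uplus_adj.
  split; first exact: sq_bounded_op bV.
  - by move=> f /memL2P; exact: Uplus_adjK.
  - by move=> f /memL2P; exact: Uplus_adjKV.
move=> f /memL2P sf; have sA := perturb_sqi sf; have sU := Uplus_sqi sA.
have h1 := sq_bounded_ae bV (sqi_mul_id (Uplus_sqi sf)) sU (opA_Uplus sf).
by apply: filterS2 h1 (Uplus_adjK sA) => x /= -> ->.
Qed.

End RealParameter.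

Lemma small_cdisk z : cdisk (4 * M)^-1 z -> small z.
Proof.
move=> /= /ltW h; apply: (le_trans h); rewrite lef_pV2 ?posrE ?mulr_gt0//.
by rewrite ler_wpM2r ?(ltW M0)// ler_nat.
Qed.

(** The derivative of [z psi_z] in [z] is [psi_z^2], because [z] enters [phi] affinely; this is the
    origin of [m']. *)
Lemma Uplus_holomorphic :
  holomorphic_on rho (cdisk (4 * M)^-1) (Uplus rho g1).
Proof.
split=> [z /small_cdisk sz|z zD].
  by have [K] := Uplus_bounded sz; exact: sq_bounded_op.
have sz := small_cdisk zD; pose t := twopii R; have t0 := twopii_neq0 R.
pose m' := fun x => - t * (psi rho z x * psi rho z x).
have mps := cmeasurable_psi z.
have mm' : cmeasurable m'.
  by apply: cmeasurableM; [exact: cmeasurable_cst|exact: cmeasurableM].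
have bm' : {ae leb, forall x, normc (m' x) <= 2 * pi * (2 * 2)}.
  apply: filterS (psi_le2 sz) => x h; rewrite /m' 2!normcM normc_opp normc_twopii.
  rewrite ler_wpM2l ?mulr_ge0 ?pi_ge0//.
  by apply: ler_pM => //; exact: normc_ge0.
exists (mQm m' g1).
  exact: sq_bounded_op (mQm_bounded mm' cmeasurable_g1 bm' g1_bounded).
(* The error symbol is exactly [t psi_z^2 psi_(z+h) (t h p)]; [L] bounds it after removal of [|h|],
   with [|t| = 2 pi], each [psi] at most 2, and [|p| <= M / (2 pi)]. *)
move=> e e0; pose L := 2 * pi * (2 * 2) * 2 * (2 * pi * (M / (2 * pi))).
have L0 : 0 < L by rewrite /L !mulr_gt0 ?pi_gt0 ?invr_gt0 ?mulr_gt0 ?pi_gt0.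
have CL0 : 0 < C * L by rewrite mulr_gt0.
(* The first bound keeps [z + h] in the range [small], even if it leaves the disk; the second makes
   the operator error at most [e]. *)
exists (Num.min (4 * M)^-1 (e / (C * L))).
  by rewrite lt_min invr_gt0 mulr_gt0//= divr_gt0.
move=> h /andP[h0]; rewrite lt_min => /andP[h1 h2].
have sh : small h by apply: small_cdisk.
have szh : small (z + h).
  rewrite /small; apply: (le_trans (normc_add z h)).
  apply: (@le_trans _ _ ((4 * M)^-1 + (4 * M)^-1)).
    by apply: lerD; apply: ltW.
  by rewrite le_eqVlt; apply/orP; left; apply/eqP; field; rewrite gt_eqF.
have hn0 : h != 0 by rewrite -normc_gt0.
pose k := fun x => h^-1 * (t * z * psi rho z x - t * (z + h) * psi rho (z + h) x) - m' x.
have mk : cmeasurable k.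
  apply: cmeasurableB => //; apply: cmeasurableM; first exact: cmeasurable_cst.
  apply: cmeasurableB; (apply: cmeasurableM; first exact: cmeasurable_cst) => //.
  exact: cmeasurable_psi.
have bk : {ae leb, forall x, normc (k x) <= normc h * L}.
  apply: filterS3 (psi_ae sz) (psi_ae szh) Pplus_density_bounded.
  move=> x [p0 b1] [q0 b2] b3.
  have -> : k x = t * (psi rho z x * psi rho z x) * psi rho (z + h) x * (t * h * p x).
    by rewrite /k /m' !psiE -/t; field; rewrite ?hn0 ?p0 ?q0.
  have tE : normc t = 2 * pi := normc_twopii.
  clearbody t; rewrite !normcM tE.
  have n0 (a : R[i]) := normc_ge0 a; have p2 : 0 <= 2 * pi :> R by rewrite mulr_ge0 ?pi_ge0.
  rewrite [leRHS](_ : _ = 2 * pi * (2 * 2) * 2 * (2 * pi * normc h * (M / (2 * pi)))); last first.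
    by rewrite /L; ring.
  apply: ler_pM => //; first by rewrite !mulr_ge0 ?pi_ge0 ?n0.
  - by rewrite !mulr_ge0 ?pi_ge0 ?n0.
  - apply: ler_pM => //; first by rewrite !mulr_ge0 ?pi_ge0 ?n0.
    by apply: ler_wpM2l => //; apply: ler_pM.
  - by apply: ler_wpM2l => //; rewrite mulr_ge0.
have bQ := mQm_bounded mk cmeasurable_g1 bk g1_bounded.
have := sq_bounded_opnorm bQ (ltW e0); rewrite mulr1.
have /[swap] /[apply] : (C * (normc h * L)) ^+ 2 <= e ^+ 2.
  rewrite lerXn2r ?nnegrE ?(ltW e0)//; first by rewrite mulrCA mulr_ge0 ?normc_ge0// ltW.
  by rewrite mulrCA -ler_pdivlMr// ltW.
congr opnorm_le; apply/funext => f; apply/funext => x.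
rewrite !UplusE /k /mQm -/t; ring.
Qed.

End PerturbedMultiplication.

Theorem theorem4p10 (R : realType)
    (rho : {finite_measure set (measurableTypeR R) -> \bar R})
    (rho_supp : compactly_supported rho)
    (rho_BTB : BTB rho) :
  let g : measurableTypeR R -> R[i] := fun=> 1 in
  let A := @opA R in
  let B := rank_one rho g in
  (exists2 delta : R, 0 < delta &
    [/\ forall c : R[i], cdisk delta c -> psi_bounded rho c,
        holomorphic_on rho (cdisk delta) (Uplus rho g) &
        forall c : R, `|c| < delta ->
          unitary_op rho (Uplus rho g c%:C) /\
          conjugate_by rho (Uplus rho g c%:C) A (perturb A B c)]) /\
  HUE rho A B.
Proof.
move=> g A B.
have [K cK K0] := rho_supp.
have [N rhoN] : exists N : R, {ae rho, forall t : measurableTypeR R, `|t : R| <= N}.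
  (* The bound on [K] holds for every number strictly above [N], whence the added 1. *)
  have [N [_ bN]] := compact_bounded cK; exists (N + 1).
  have mK : measurable (K : set (measurableTypeR R)).
    exact: compact_measurable.
  exists (~` K); split => //; first exact: measurableC.
  move=> t /= h Kt; apply: h; apply: bN => //.
  by rewrite ltrDl.
have [M M0 rhoM] : exists2 M : R, 0 < M & forall l : R[i], 0 < complex.Im l ->
    normc (borel_transform rho l) <= M.
  (* The BTB constant may be zero or negative; enlarging it makes the radius [1 / (4 M)]
     positive. *)
  have [M hM] := rho_BTB; exists (`|M| + 1) => [|l l0]; first by rewrite ltr_wpDl.
  by rewrite (le_trans (hM l l0))// (le_trans (ler_norm M))// lerDl.
have hol := Uplus_holomorphic M0 rhoM rhoN.
have smallW z : cdisk (4 * M)^-1 z -> small M z := small_cdisk M0 (z := z).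
have cW (c : R) : `|c| < (4 * M)^-1 -> small M c%:C.
  by rewrite -normc_real; exact: smallW.
have uc (c : R) : `|c| < (4 * M)^-1 -> unitary_op rho (Uplus rho g c%:C) /\
    conjugate_by rho (Uplus rho g c%:C) A (perturb A B c).
  move=> /cW sc; split; first exact: (Uplus_unitary M0 rhoM rhoN sc).
  exact: (Uplus_conjugate M0 rhoM rhoN sc).
have d0 : 0 < (4 * M)^-1 by rewrite invr_gt0 mulr_gt0.
split; exists (4 * M)^-1 => //.
  by split=> // c /smallW sc; exact: (psi_boundedP M0 rhoM rhoN sc).
exists (fun c => Uplus rho g c%:C); split=> //.
by exists (Uplus rho g) => // c _ f _; apply: aeW.
Qed.
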